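(* Let $\mathbb{X}$ be a weighted projective line of domestic or tubular type over an algebraically closed field $\mathbf{k}$. Then every stability data on $\mathrm{coh}\,\mathbb{X}$ can be refined to a finest one; that is, for every stability data on $\mathrm{coh}\,\mathbb{X}$ there exists a finest stability data on $\mathrm{coh}\,\mathbb{X}$ that is finer than it.
   Context: Weighted projective lines (Geigle–Lenzing): given a weight sequence $\mathbf{p}=(p_1,\dots,p_t)$ of positive integers (weights $1$ may be added so that $t\geq 2$) and pairwise distinct closed points $\lambda_1=\infty,\lambda_2=0,\lambda_3=1,\dots,\lambda_t$ of $\mathbb{P}^1_{\mathbf{k}}$, let $\mathbb{L}$ be the abelian group with generators $\vec{x}_1,\dots,\vec{x}_t$ and relations $p_1\vec{x}_1=\cdots=p_t\vec{x}_t=:\vec{c}$, and let $S=\mathbf{k}[X_1,\dots,X_t]/(X_i^{p_i}-X_2^{p_2}+\lambda_iX_1^{p_1}\mid 3\leq i\leq t)$, $\mathbb{L}$-graded by $\deg X_i=\vec{x}_i$. Then $\mathbb{X}=\mathrm{Proj}^{\mathbb{L}}S$ and $\mathrm{coh}\,\mathbb{X}$ is the quotient of the category of finitely generated $\mathbb{L}$-graded $S$-modules by the Serre subcategory of finite length modules. $\mathbb{X}$ is of domestic (resp. tubular) type if $(t-2)-\sum_{i=1}^t\frac1{p_i}<0$ (resp. $=0$). Up to permutation and omitting weights $1$: domestic types are $()$, $(p)$, $(p_1,p_2)$, $(2,2,p_3)$, $(2,3,3)$, $(2,3,4)$, $(2,3,5)$; tubular types are $(2,2,2,2)$, $(3,3,3)$,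 $(4,4,2)$, $(6,3,2)$. All subcategories are full and closed under isomorphisms. $\langle\mathcal{S}\rangle$ denotes the smallest subcategory containing $\mathcal{S}$ and closed under extensions and direct summands. A stability data on an abelian category $\mathcal{A}$ is a pair $(\Phi,\{\Pi_\varphi\}_{\varphi\in\Phi})$ where $\Phi$ is a linearly ordered set and each $\Pi_\varphi\subset\mathcal{A}$ is a non-zero extension-closed subcategory, such that: (1) $\mathrm{Hom}(\Pi_{\varphi'},\Pi_{\varphi''})=0$ for all $\varphi'>\varphi''$ in $\Phi$; (2) every non-zero $X\in\mathcal{A}$ has a finite filtration $0=X_0\subset X_1\subset\cdots\subset X_n=X$ with non-zero factors $X_i/X_{i-1}\in\Pi_{\varphi_i}$ and $\varphi_1>\cdots>\varphi_n$. Two stability data $(\Phi,\{\Pi_\varphi\})$, $(\Psi,\{P_\psi\})$ are equivalent if there is an order-preserving bijection $r:\Phi\to\Psi$ with $P_{r(\varphi)}=\Pi_\varphi$ for all $\varphi$. $(\Psi,\{P_\psi\})$ is finer than $(\Phi,\{\Pi_\varphi\})$ if there is a surjective map $r:\Psi\to\Phi$ such that $\psi'>\psi''$ implies $r(\psi')\geq r(\psi'')$, and $\Pi_\varphi=\langle P_\psi\mid\psi\in r^{-1}(\varphi)\rangle$ for every $\varphi\in\Phi$. A stability data is finest if every stability data finer than it is equivalent to it. *)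

(* Defs.v *)
From HB Require Import structures.
From mathcomp Require Import all_boot all_order all_algebra.
From mathcomp Require Import boolp.
From mathcomp Require Import mpoly.

Set Implicit Arguments.
Unset Strict Implicit.
Unset Printing Implicit Defensive.

Import GRing.Theory.
Local Open Scope ring_scope.
Local Open Scope quotient_scope.

(* Points of P^1(k) are encoded in [option k], with [None] the point infinity.
   Exceptional points are indexed from 0: (p_i, lambda_i) is (wt (i-1), pt (i-1)),
   and t = nexc.+2 builds in the convention t >= 2. *)
Record weighted_line (k : fieldType) := WeightedLine {
  nexc : nat;
  wt : 'I_nexc.+2 -> nat;
  pt : 'I_nexc.+2 -> option k;
  wt_gt0 : forall i, (0 < wt i)%N;
  pt_inj : injective pt;
  pt_first : forall i : 'I_nexc.+2, i = 0%N :> nat -> pt i = None;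
  pt_second : forall i : 'I_nexc.+2, i = 1%N :> nat -> pt i = Some 0;
  pt_third : forall i : 'I_nexc.+2, i = 2%N :> nat -> pt i = Some 1 }.

Definition npts (k : fieldType) (X : weighted_line k) : nat := (nexc X).+2.

Definition wl_type (k : fieldType) (X : weighted_line k) : rat :=
  (npts X)%:R - 2 - \sum_(i < npts X) (wt i)%:R^-1.

Definition domestic (k : fieldType) (X : weighted_line k) : Prop :=
  wl_type X < 0.

Definition tubular (k : fieldType) (X : weighted_line k) : Prop :=
  wl_type X = 0.

Section GradingGroup.
Variables (k : fieldType) (X : weighted_line k).

Definition free_gen (i : 'I_(npts X)) : 'rV[int]_(npts X) := delta_mx 0 i.

(* The subgroup of Z^t generated by the p_i x_i - p_1 x_1. *)
Definition Lrel : {pred 'rV[int]_(npts X)} := fun v => `[< exists a : 'I_(npts X) -> int,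
  v = \sum_i (free_gen i *+ wt i - free_gen ord0 *+ wt (ord0 : 'I_(npts X))) *~ a i >].

Fact Lrel_closed : zmod_closed Lrel.
Proof.
split.
  by apply/asboolP; exists (fun=> 0); rewrite big1 // => i _; rewrite mulr0z.
move=> u v /asboolP[a ->] /asboolP[b ->]; apply/asboolP.
exists (fun i => a i - b i); rewrite -sumrB.
by apply: eq_bigr => i _; rewrite mulrzBr.
Qed.

HB.instance Definition _ := GRing.isZmodClosed.Build _ Lrel Lrel_closed.

Definition Lgrp : zmodType := Quotient.quot Lrel.

Definition Lgen (i : 'I_(npts X)) : Lgrp := \pi_(Quotient.quot Lrel) (free_gen i).

Local Notation P := {mpoly k[npts X]}.

(* X_i^p_i - X_2^p_2 + lambda_i X_1^p_1; only used for i >= 3, where lambda_i is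
   finite, so that the default value of odflt is irrelevant. *)
Definition wl_eq (i : 'I_(npts X)) : P :=
  'X_i ^+ wt i
  - 'X_(Ordinal (isT : (1 < npts X)%N)) ^+ wt (Ordinal (isT : (1 < npts X)%N))
  + odflt 0 (pt i) *: 'X_ord0 ^+ wt (ord0 : 'I_(npts X)).

Definition wl_ideal : {pred P} := fun q => `[< exists a : 'I_(npts X) -> P,
  q = \sum_(i : 'I_(npts X) | (2 <= i)%N) a i * wl_eq i >].

Fact wl_ideal_closed : idealr_closed wl_ideal.
Proof.
split.
- by apply/asboolP; exists (fun=> 0); rewrite big1 // => i _; rewrite mul0r.
- apply/asboolP => -[a /(congr1 (mmap idfun (fun=> 0)))].
  rewrite rmorph1 rmorph_sum big1 ?(eqP (oner_neq0 _)) => [/eqP|i _].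
    by rewrite oner_eq0.
  rewrite rmorphM /= [X in _ * X](_ : _ = 0) ?mulr0 //.
  rewrite rmorphD rmorphB /= mmapZ !rmorphXn /= !mmapX !mmap1U !expr0n.
  by rewrite !gtn_eqF ?wt_gt0 //= mulr0 subr0 addr0.
- move=> c u v /asboolP[a ->] /asboolP[b ->]; apply/asboolP.
  exists (fun i => c * a i + b i); rewrite mulr_sumr -big_split /=.
  by apply: eq_bigr => i _; rewrite mulrDl mulrA.
Qed.

HB.instance Definition _ := isIdealr.Build P wl_ideal wl_ideal_closed.

Definition Salg : comNzRingType := {ideal_quot wl_ideal}.

Definition mdegL (m : 'X_{1..npts X}) : Lgrp := \sum_i Lgen i *+ m i.

Definition Shomog (d : Lgrp) (a : Salg) : Prop :=
  exists2 q : P, a = \pi_({ideal_quot wl_ideal}) q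
    & forall m, m \in msupp q -> mdegL m = d.

End GradingGroup.

Section GradedModules.
Variables (k : fieldType) (X : weighted_line k).
Local Notation L := (Lgrp X).
Local Notation S := (Salg X).

(* A decomposition of M as the direct sum of the M_l is given by the family of
   its projections gproj l : M -> M_l; thus M_l = {x | gproj l x = x}. *)
Record gmod := GMod {
  gmod_sort :> lmodType S;
  gproj : L -> gmod_sort -> gmod_sort;
  gprojB : forall l, zmod_morphism (gproj l);
  gprojK : forall l l' x,
    gproj l (gproj l' x) = if l == l' then gproj l x else 0;
  gproj_sum : forall x, exists2 s : seq L, uniq s & x = \sum_(l <- s) gproj l x;
  gproj_act : forall d l (a : S) x,
    Shomog d a -> gproj l x = x -> gproj (d + l) (a *: x) = a *: x }.

Definition fin_gen (M : gmod) : Prop :=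
  exists n (g : 'I_n -> M), forall x : M,
    exists a : 'I_n -> S, x = \sum_i a i *: g i.

Definition gsub (M : gmod) (U : M -> Prop) : Prop :=
  [/\ U 0, forall (a : S) x y, U x -> U y -> U (a *: x + y)
    & forall l x, U x -> U (gproj l x)].

Definition subset (T : Type) (U V : T -> Prop) : Prop := forall x, U x -> V x.

Definition gsub0 (M : gmod) : M -> Prop := fun x => x = 0.
Definition gsubT (M : gmod) : M -> Prop := fun=> True.

(* U 0 < U 1 < ... < U n is a strictly increasing chain of graded submodules of M
   between A and B. *)
Definition gchain (M : gmod) (A B : M -> Prop) (n : nat) (U : nat -> M -> Prop) :=
  (forall i, (i <= n)%N -> [/\ gsub (U i), subset A (U i) & subset (U i) B]) /\
  (forall i, (i < n)%N -> subset (U i) (U i.+1) /\ ~ subset (U i.+1) (U i)).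

(* For graded submodules A <= B of M: B / A is a graded module of finite length,
   i.e. the lengths of its chains of graded submodules are bounded. *)
Definition fin_length (M : gmod) (A B : M -> Prop) : Prop :=
  exists n, ~ exists U : nat -> M -> Prop, gchain A B n U.

(* Graded submodules of the direct sum of M and N, in curried form. *)
Definition grel (M N : gmod) (G : M -> N -> Prop) : Prop :=
  [/\ G 0 0,
      forall (a : S) x y x' y', G x y -> G x' y' -> G (a *: x + x') (a *: y + y')
    & forall l x y, G x y -> G (gproj l x) (gproj l y)].

Definition rdom (M N : Type) (G : M -> N -> Prop) : M -> Prop :=
  fun x => exists y, G x y.
Definition rindet (M N : gmod) (G : M -> N -> Prop) : N -> Prop :=
  fun y => G 0 y.

(* A representative of a morphism M -> N in the quotient of the category of
   graded modules by the modules of finite length is a homogeneous morphism of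
   degree zero f : M' -> N / N', with M' <= M and N' <= N graded submodules such
   that M / M' and N' have finite length. It is encoded as the graded submodule
   {(x, y) | x \in M', y \in f x} of M (+) N; conversely such a graded submodule G
   determines M' = rdom G, N' = rindet G and f. *)
Record qmor (M N : gmod) := QMor {
  qgraph :> M -> N -> Prop;
  qgraph_rel : grel qgraph;
  qgraph_dom : fin_length (rdom qgraph) (@gsubT M);
  qgraph_indet : fin_length (@gsub0 N) (rindet qgraph) }.

(* U (resp. M / U) is a graded module of finite length. *)
Definition finsub (M : gmod) (U : M -> Prop) : Prop :=
  gsub U /\ fin_length (@gsub0 M) U.
Definition cofinsub (M : gmod) (U : M -> Prop) : Prop :=
  gsub U /\ fin_length U (@gsubT M).

(* Equality of the classes of F and G in colim Hom(M', N / N'): they induce the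
   same morphism M'' -> N / N'' for some smaller M'' and some larger N''. *)
Definition qequiv (M N : gmod) (F G : qmor M N) : Prop :=
  exists M'' N'',
    [/\ cofinsub M'', subset M'' (rdom F) & subset M'' (rdom G)] /\
    [/\ finsub N'', subset (rindet F) N'', subset (rindet G) N''
      & forall x y y', M'' x -> F x y -> G x y' -> N'' (y - y')].

Definition rcomp (M N Q : Type) (G : N -> Q -> Prop) (F : M -> N -> Prop) :
  M -> Q -> Prop := fun x z => exists2 y, F x y & G y z.
Definition rid (M : Type) : M -> M -> Prop := eq.
Definition radd (M : Type) (N : zmodType) (F G : M -> N -> Prop) :
    M -> N -> Prop :=
  fun x z => exists y y', [/\ F x y, G x y' & z = y + y'].
Definition ropp (M : Type) (N : zmodType) (F : M -> N -> Prop) : M -> N -> Prop :=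
  fun x y => F x (- y).
Definition rzero (M : Type) (N : zmodType) : M -> N -> Prop := fun _ y => y = 0.
Definition rconv (M N : Type) (F : M -> N -> Prop) : N -> M -> Prop :=
  fun y x => F x y.
Definition rimg (M N : Type) (F : M -> N -> Prop) (U : M -> Prop) : N -> Prop :=
  fun y => exists2 x, U x & F x y.

Lemma gproj0 (M : gmod) l : gproj l (0 : M) = 0.
Proof. by rewrite -[in LHS](subrr 0) gprojB subrr. Qed.

Lemma gprojN (M : gmod) l (x : M) : gproj l (- x) = - gproj l x.
Proof. by rewrite -[in LHS](sub0r x) gprojB gproj0 sub0r. Qed.

Lemma gprojD (M : gmod) l (x y : M) : gproj l (x + y) = gproj l x + gproj l y.
Proof. by rewrite -{1}(opprK y) gprojB gprojN opprK. Qed.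

Section SubTheory.
Variables (M : gmod) (U : M -> Prop) (hU : gsub U).
Lemma gsub_0 : U 0. Proof. by case: hU. Qed.
Lemma gsub_p l x : U x -> U (gproj l x). Proof. by case: hU => _ _; apply. Qed.
Lemma gsub_Z a x : U x -> U (a *: x).
Proof. by case: hU => u0 h _ ux; rewrite -[_ *: _]addr0; apply: h. Qed.
Lemma gsub_D x y : U x -> U y -> U (x + y).
Proof. by case: hU => _ h _ ux uy; rewrite -[x]scale1r; apply: h. Qed.
Lemma gsub_N x : U x -> U (- x).
Proof. by rewrite -scaleN1r; apply: gsub_Z. Qed.
Lemma gsub_B x y : U x -> U y -> U (x - y).
Proof. by move=> ux uy; apply: gsub_D => //; apply: gsub_N. Qed.
End SubTheory.

Section RelTheory.
Variables (M N : gmod) (G : M -> N -> Prop) (hG : grel G).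
Lemma grel_0 : G 0 0. Proof. by case: hG. Qed.
Lemma grel_D x y x' y' : G x y -> G x' y' -> G (x + x') (y + y').
Proof.
by case: hG => _ h _ g g'; rewrite -[x]scale1r -[y]scale1r; apply: h.
Qed.
Lemma grel_Z a x y : G x y -> G (a *: x) (a *: y).
Proof.
case: hG => g0 h _ g; rewrite -[_ *: x]addr0 -[_ *: y]addr0; exact: h.
Qed.
Lemma grel_N x y : G x y -> G (- x) (- y).
Proof. by rewrite -!scaleN1r; apply: grel_Z. Qed.
Lemma grel_B x y x' y' : G x y -> G x' y' -> G (x - x') (y - y').
Proof. by move=> g /grel_N; apply: grel_D. Qed.
Lemma grel_p l x y : G x y -> G (gproj l x) (gproj l y).
Proof. by case: hG => _ _; apply. Qed.
Lemma grel_conv : grel (rconv G).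
Proof.
split; first exact: grel_0.
- by move=> a x y x' y' g g'; case: hG => _ h _; apply: h.
- by move=> l x y; apply: grel_p.
Qed.
Lemma gsub_img U : gsub U -> gsub (rimg G U).
Proof.
move=> hU; split.
- by exists 0; [apply: gsub_0|apply: grel_0].
- move=> a y y' [x ux g] [x' ux' g']; exists (a *: x + x').
    by apply: gsub_D => //; apply: gsub_Z.
  by apply: grel_D => //; apply: grel_Z.
- by move=> l y [x ux g]; exists (gproj l x); [apply: gsub_p|apply: grel_p].
Qed.
End RelTheory.

Lemma gsub_zero (M : gmod) : gsub (@gsub0 M).
Proof.
split=> //; first by move=> a x y -> ->; rewrite scaler0 addr0.
by move=> l x ->; rewrite /gsub0 gproj0.
Qed.

Lemma gsub_T (M : gmod) : gsub (@gsubT M).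
Proof. by []. Qed.

Definition gand (M : gmod) (U V : M -> Prop) : M -> Prop := fun x => U x /\ V x.
Definition gadd (M : gmod) (U V : M -> Prop) : M -> Prop :=
  fun z => exists x y, [/\ U x, V y & z = x + y].

Lemma gsub_and (M : gmod) (U V : M -> Prop) : gsub U -> gsub V -> gsub (gand U V).
Proof.
move=> hU hV; split; first by split; apply: gsub_0.
- move=> a x y [ux vx] [uy vy].
  by split; apply: gsub_D => //; apply: gsub_Z.
- by move=> l x [ux vx]; split; apply: gsub_p.
Qed.

Lemma gsub_add (M : gmod) (U V : M -> Prop) : gsub U -> gsub V -> gsub (gadd U V).
Proof.
move=> hU hV; split.
- by exists 0, 0; split; [exact: gsub_0|exact: gsub_0|rewrite addr0].
- move=> a _ _ [x [y [ux vy ->]]] [x' [y' [ux' vy' ->]]].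
  exists (a *: x + x'), (a *: y + y'); split.
  + by apply: gsub_D => //; apply: gsub_Z.
  + by apply: gsub_D => //; apply: gsub_Z.
  + by rewrite scalerDr addrACA.
- move=> l _ [x [y [ux vy ->]]]; exists (gproj l x), (gproj l y).
  by split; [exact: gsub_p|exact: gsub_p|rewrite gprojD].
Qed.

Lemma subset_addl (M : gmod) (U V : M -> Prop) : gsub V -> subset U (gadd U V).
Proof. by move=> hV x ux; exists x, 0; split=> //; [exact: gsub_0|rewrite addr0]. Qed.

Lemma subset_addr (M : gmod) (U V : M -> Prop) : gsub U -> subset V (gadd U V).
Proof. by move=> hU x ux; exists 0, x; split=> //; [exact: gsub_0|rewrite add0r]. Qed.

Lemma gsub_rdom (M N : gmod) (G : M -> N -> Prop) : grel G -> gsub (rdom G).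
Proof.
move=> hG; have := gsub_img (grel_conv hG) (gsub_T N); congr gsub.
by apply/funext => x; apply/propext; split=> [[y _ g]|[y g]]; exists y.
Qed.

Lemma gsub_rindet (M N : gmod) (G : M -> N -> Prop) : grel G -> gsub (rindet G).
Proof.
move=> hG; have := gsub_img hG (gsub_zero M); congr gsub.
by apply/funext => y; apply/propext; split=> [[x -> g]|g] //; exists 0.
Qed.

Lemma fin_length_sub (M : gmod) (A B A' B' : M -> Prop) :
  subset A A' -> subset B' B -> fin_length A B -> fin_length A' B'.
Proof.
move=> AA BB [n hn]; exists n => -[U [h1 h2]]; apply: hn; exists U; split=> //.
move=> i /h1[hU hA hB]; split=> // x; first by move/AA/hA.
by move/hB/BB.
Qed.

Lemma fin_length_refl (M : gmod) (A : M -> Prop) : fin_length A A.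
Proof.
exists 1%N => -[U [h1 h2]]; have [_] := h2 0%N isT; apply=> x.
have [_ hA _] := h1 0%N isT; have [_ _ hB] := h1 1%N isT.
by move/hB/hA.
Qed.

Lemma fin_length_img (M N : gmod) (G : M -> N -> Prop) (A B : M -> Prop) :
  grel G -> gsub A -> gsub B -> subset A B ->
  fin_length A B -> fin_length (rimg G A) (rimg G B).
Proof.
move=> hG hA hB AB [n hn]; exists n => -[U [h1 h2]]; apply: hn.
exists (fun i => gadd (gand (rimg (rconv G) (U i)) B) A); split.
  move=> i /h1[hU hAU hUB]; have hI := gsub_img (grel_conv hG) hU.
  have hIB := gsub_and hI hB.
  split; [exact: gsub_add|exact: subset_addr|].
  by move=> _ [x [y [[_ bx] /AB ay ->]]]; apply: gsub_D.
move=> i lt_in; have [s12 ns21] := h2 i lt_in.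
split.
  move=> _ [x [y [[[u /s12 uu g] bx] ay ->]]]; exists x, y; split=> //.
  by split=> //; exists u.
move=> sub; apply: ns21 => u uu.
have [hU' _ hUB'] := h1 i.+1 lt_in; have [hU hAU _] := h1 i (ltnW lt_in).
have [b bb g] := hUB' u uu.
have [|b' [a [[[u' uu' g'] bb'] aa eb]]] := sub b.
  by apply: subset_addl => //; split=> //; exists u.
rewrite -(subrK u' u); apply: gsub_D => //; apply: hAU; exists a => //.
by have := grel_B hG g g'; rewrite eb addrC addKr.
Qed.

Lemma gchain_ext (M : gmod) (A B : M -> Prop) n U V :
  gchain A B n U -> gsub V -> subset A V -> subset V B ->
  subset (U n) V -> ~ subset V (U n) ->
  gchain A B n.+1 (fun i => if (i <= n)%N then U i else V).
Proof.
move=> [h1 h2] hV AV VB UV nVU; split=> i.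
  by rewrite leq_eqVlt => /orP[/eqP->|/[1!ltnS] le]; [rewrite ltnn|rewrite le; apply: h1].
rewrite ltnS => le_in; rewrite le_in; case: ltnP => [/h2 //|le_ni].
by have -> : i = n by apply/eqP; rewrite eqn_leq le_in.
Qed.

Lemma gchain_trunc (M : gmod) (A B : M -> Prop) m n U :
  (m <= n)%N -> gchain A B n U -> gchain A B m U.
Proof.
move=> le_mn [h1 h2]; split=> i hi; first by apply: h1; apply: leq_trans le_mn.
by apply: h2; apply: leq_trans le_mn.
Qed.

Lemma fin_length_trans (M : gmod) (A B C : M -> Prop) :
  gsub A -> gsub B -> gsub C -> subset A B -> subset B C ->
  fin_length A B -> fin_length B C -> fin_length A C.
Proof.
move=> hA hB hC AB BC [n1 hn1] [n2 hn2]; exists (n1 + n2)%N => -[U [h1 h2]].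
suff step m : (m <= n1 + n2)%N -> exists a b V W,
    [/\ (m <= a + b)%N, gchain A B a V, gchain B C b W,
        subset (V a) (gand (U m) B) & subset (W b) (gadd (U m) B)].
  have [a [b [V [W [le_ab cV cW _ _]]]]] := step _ (leqnn _).
  have [le_a|lt_a] := leqP n1 a.
    by apply: hn1; exists V; apply: gchain_trunc cV.
  apply: hn2; exists W; apply: gchain_trunc cW.
  rewrite leqNgt; apply/negP => lt_b; move: le_ab.
  by rewrite leqNgt -addSn leq_add // ltnW.
elim: m => [_|m IHm lt_m].
  exists 0%N, 0%N, (fun=> A), (fun=> B); have [hU AU UC] := h1 0%N isT.
  split=> //.
  - split=> // i _; split=> //.
  - split=> // i _; split=> //.
  - by move=> x ax; split; [move/AU: ax|move/AB: ax].
  - exact: subset_addr.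
have [a [b [V [W [le_ab cV cW sV sW]]]]] := IHm (ltnW lt_m).
have [hU AU UC] := h1 m (ltnW lt_m); have [hU' AU' UC'] := h1 m.+1 lt_m.
have [sUU nUU] := h2 m lt_m.
have [sI|nI] := pselect (subset (gand (U m.+1) B) (gand (U m) B)); last first.
  exists a.+1, b, (fun i => if (i <= a)%N then V i else gand (U m.+1) B), W.
  rewrite ltnn; split=> //.
  - apply: gchain_ext => //.
    + exact: gsub_and.
    + by move=> x ax; split; [move/AU': ax|move/AB: ax].
    + by move=> x [].
    + by move=> x /sV[/sUU ? ?].
    + by move=> s; apply: nI => x /s/sV.
  - by move=> x /sW[y [z [/sUU uy bz ->]]]; exists y, z.
have [sD|nD] := pselect (subset (gadd (U m.+1) B) (gadd (U m) B)); last first.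
  exists a, b.+1, V, (fun i => if (i <= b)%N then W i else gadd (U m.+1) B).
  rewrite ltnn addnS; split=> //.
  - apply: gchain_ext => //.
    + exact: gsub_add.
    + exact: subset_addr.
    + by move=> _ [x [y [/UC' cx /BC cy ->]]]; apply: gsub_D.
    + by move=> x /sW[y [z [/sUU uy bz ->]]]; exists y, z.
    + by move=> s; apply: nD => x /s/sW.
  - by move=> x /sV[/sUU ? ?].
case: nUU => x ux; have /sD[y [z [uy bz exyz]]] : gadd (U m.+1) B x by apply: subset_addl.
have [] : gand (U m) B z; last by move=> uz _; rewrite exyz; apply: gsub_D.
apply: (sI); split=> //; have -> : z = x - y by rewrite exyz addrC addKr.
by apply: gsub_B => //; move/sUU: uy.
Qed.

Lemma subset0 (M : gmod) (U : M -> Prop) : gsub U -> subset (@gsub0 M) U.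
Proof. by move=> hU x ->; apply: gsub_0. Qed.

Lemma rimg0 (M N : gmod) (G : M -> N -> Prop) : rimg G (@gsub0 M) = rindet G.
Proof.
by apply/funext => y; apply/propext; split=> [[x -> g]|g] //; exists 0.
Qed.

Lemma rimg_convT (M N : gmod) (G : M -> N -> Prop) :
  rimg (rconv G) (@gsubT N) = rdom G.
Proof.
by apply/funext => x; apply/propext; split=> [[y _ g]|[y g]]; exists y.
Qed.

Lemma finsub_img (M N : gmod) (G : M -> N -> Prop) U :
  grel G -> finsub (rindet G) -> finsub U -> finsub (rimg G U).
Proof.
move=> hG [hI fI] [hU fU]; have hGU := gsub_img hG hU; split=> //.
apply: (fin_length_trans (gsub_zero N) hI hGU) => //; first exact: subset0.
- by move=> y g; exists 0 => //; apply: gsub_0.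
- by rewrite -rimg0; apply: fin_length_img => //; [apply: gsub_zero|apply: subset0].
Qed.

Lemma cofinsub_preimg (M N : gmod) (G : M -> N -> Prop) V :
  grel G -> cofinsub (rdom G) -> cofinsub V -> cofinsub (rimg (rconv G) V).
Proof.
move=> hG [hD fD] [hV fV]; have hGV := gsub_img (grel_conv hG) hV; split=> //.
apply: (fin_length_trans hGV hD (gsub_T M)) => //.
- by move=> x [y _ g]; exists y.
- by rewrite -rimg_convT; apply: fin_length_img => //; apply: grel_conv.
Qed.

Lemma cofinsub_and (M : gmod) (U V : M -> Prop) :
  cofinsub U -> cofinsub V -> cofinsub (gand U V).
Proof.
move=> [hU fU] [hV fV].
pose G : M -> M -> Prop := fun x y => U x /\ x = y.
have hG : grel G.
  split; first by split=> //; apply: gsub_0.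
  - move=> a x y x' y' [ux <-] [ux' <-]; split=> //.
    by apply: gsub_D => //; apply: gsub_Z.
  - by move=> l x y [ux <-]; split=> //; apply: gsub_p.
suff -> : gand U V = rimg (rconv G) V.
  apply: cofinsub_preimg => //; split; first exact: gsub_rdom.
  by apply: fin_length_sub fU => // x ux; exists x.
apply/funext => x; apply/propext; split=> [[ux vx]|[y vy [ux e]]].
  by exists x.
by split=> //; rewrite e.
Qed.

Lemma finsub_add (M : gmod) (U V : M -> Prop) :
  finsub U -> finsub V -> finsub (gadd U V).
Proof.
move=> [hU fU] [hV fV].
pose G : M -> M -> Prop := fun x y => U (y - x).
have hG : grel G.
  split; first by rewrite /G subr0; apply: gsub_0.
  - move=> a x y x' y' u u'; rewrite /G opprD addrACA -scalerBr.
    by case: hU => _ + _; apply.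
  - by move=> l x y u; rewrite /G -gprojB; apply: gsub_p.
suff -> : gadd U V = rimg G V.
  apply: finsub_img => //; split; first exact: gsub_rindet.
  by apply: fin_length_sub fU => // x; rewrite /rindet /G subr0.
apply/funext => z; apply/propext; split=> [[x [y [ux vy ->]]]|[y vy u]].
  by exists y => //; rewrite /G addrK.
by exists (z - y), y; rewrite subrK.
Qed.

Lemma finsub_zero (M : gmod) : finsub (@gsub0 M).
Proof. by split; [exact: gsub_zero|exact: fin_length_refl]. Qed.

Lemma cofinsub_T (M : gmod) : cofinsub (@gsubT M).
Proof. by split; [exact: gsub_T|exact: fin_length_refl]. Qed.

Lemma finsub_sub (M : gmod) (U V : M -> Prop) :
  gsub U -> subset U V -> finsub V -> finsub U.
Proof. by move=> hU UV [_ fV]; split=> //; apply: fin_length_sub fV. Qed.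

Lemma cofinsub_sub (M : gmod) (U V : M -> Prop) :
  gsub V -> subset U V -> cofinsub U -> cofinsub V.
Proof. by move=> hV UV [_ fV]; split=> //; apply: fin_length_sub fV. Qed.

Section Qmor.
Variables (M N : gmod) (F : qmor M N).
Lemma finsub_indet : finsub (rindet F).
Proof.
by split; [apply: gsub_rindet; apply: qgraph_rel|apply: qgraph_indet].
Qed.
Lemma cofinsub_dom : cofinsub (rdom F).
Proof. by split; [apply: gsub_rdom; apply: qgraph_rel|apply: qgraph_dom]. Qed.
End Qmor.

Definition mkqmor (M N : gmod) (G : M -> N -> Prop) (hG : grel G)
    (hD : cofinsub (rdom G)) (hI : finsub (rindet G)) : qmor M N :=
  QMor hG hD.2 hI.2.

Section Ops.

Fact qid_rel (M : gmod) : grel (@rid M).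
Proof. by split=> // [a x y x' y' -> ->|l x y ->]. Qed.
Fact qid_dom (M : gmod) : cofinsub (rdom (@rid M)).
Proof.
apply: cofinsub_sub (cofinsub_T M); first exact: gsub_rdom (qid_rel M).
by move=> x _; exists x.
Qed.
Fact qid_indet (M : gmod) : finsub (rindet (@rid M)).
Proof.
apply: finsub_sub (finsub_zero M); first exact: gsub_rindet (qid_rel M).
by move=> x <-.
Qed.
Definition qid (M : gmod) : qmor M M := mkqmor (qid_rel M) (qid_dom M) (qid_indet M).

Fact qzero_rel (M N : gmod) : grel (@rzero M N).
Proof.
split=> // [a x y x' y' -> ->|l x y ->]; first by rewrite scaler0 addr0.
by rewrite /rzero gproj0.
Qed.
Fact qzero_dom (M N : gmod) : cofinsub (rdom (@rzero M N)).
Proof.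
apply: cofinsub_sub (cofinsub_T M); first exact: gsub_rdom (qzero_rel M N).
by move=> x _; exists 0.
Qed.
Fact qzero_indet (M N : gmod) : finsub (rindet (@rzero M N)).
Proof. exact: finsub_zero. Qed.
Definition qzero (M N : gmod) : qmor M N :=
  mkqmor (qzero_rel M N) (qzero_dom M N) (qzero_indet M N).

Section Opp.
Variables (M N : gmod) (F : qmor M N).
Fact qopp_rel : grel (ropp F).
Proof.
have [h0 hD hp] := qgraph_rel F.
split; first by rewrite /ropp oppr0.
- by move=> a x y x' y' f f'; rewrite /ropp opprD -scalerN; apply: hD.
- by move=> l x y f; rewrite /ropp -gprojN; apply: hp.
Qed.
Fact qopp_dom : cofinsub (rdom (ropp F)).
Proof.
apply: cofinsub_sub (cofinsub_dom F); first exact: gsub_rdom qopp_rel.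
by move=> x [y f]; exists (- y); rewrite /ropp opprK.
Qed.
Fact qopp_indet : finsub (rindet (ropp F)).
Proof.
apply: finsub_sub (finsub_indet F); first exact: gsub_rindet qopp_rel.
move=> y f; rewrite -(opprK y); apply: gsub_N => //.
by apply: gsub_rindet; apply: qgraph_rel.
Qed.
Definition qopp : qmor M N := mkqmor qopp_rel qopp_dom qopp_indet.
End Opp.

Section Add.
Variables (M N : gmod) (F G : qmor M N).
Fact qadd_rel : grel (radd F G).
Proof.
have [f0 fD fp] := qgraph_rel F; have [g0 gD gp] := qgraph_rel G.
split.
- by exists 0, 0; rewrite addr0.
- move=> a x _ x' _ [y [z [fy gz ->]]] [y' [z' [fy' gz' ->]]].
  exists (a *: y + y'), (a *: z + z'); split; [exact: fD|exact: gD|].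
  by rewrite scalerDr addrACA.
- move=> l x _ [y [z [fy gz ->]]]; exists (gproj l y), (gproj l z).
  by split; [exact: fp|exact: gp|rewrite gprojD].
Qed.
Fact qadd_dom : cofinsub (rdom (radd F G)).
Proof.
apply: cofinsub_sub (cofinsub_and (cofinsub_dom F) (cofinsub_dom G)).
  exact: gsub_rdom qadd_rel.
by move=> x [[y f] [z g]]; exists (y + z), y, z.
Qed.
Fact qadd_indet : finsub (rindet (radd F G)).
Proof.
apply: finsub_sub (finsub_add (finsub_indet F) (finsub_indet G)).
  exact: gsub_rindet qadd_rel.
by move=> _ [y [z [f g ->]]]; exists y, z.
Qed.
Definition qadd : qmor M N := mkqmor qadd_rel qadd_dom qadd_indet.
End Add.

Section Comp.
Variables (M N Q : gmod) (G : qmor N Q) (F : qmor M N).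
Fact qcomp_rel : grel (rcomp G F).
Proof.
have [f0 fD fp] := qgraph_rel F; have [g0 gD gp] := qgraph_rel G.
split; first by exists 0.
- move=> a x z x' z' [y fy gz] [y' fy' gz'].
  by exists (a *: y + y'); [exact: fD|exact: gD].
- by move=> l x z [y fy gz]; exists (gproj l y); [exact: fp|exact: gp].
Qed.
Fact qcomp_dom : cofinsub (rdom (rcomp G F)).
Proof.
apply: cofinsub_sub (cofinsub_preimg (qgraph_rel F) (cofinsub_dom F) (cofinsub_dom G)).
  exact: gsub_rdom qcomp_rel.
by move=> x [y [z g] f]; exists z, y.
Qed.
Fact qcomp_indet : finsub (rindet (rcomp G F)).
Proof.
apply: finsub_sub (finsub_img (qgraph_rel G) (finsub_indet G) (finsub_indet F)).
  exact: gsub_rindet qcomp_rel.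
by move=> z [y f g]; exists y.
Qed.
Definition qcomp : qmor M Q := mkqmor qcomp_rel qcomp_dom qcomp_indet.
End Comp.

End Ops.

Section Equiv.
Implicit Types M N : gmod.

Lemma qequiv_refl M N (F : qmor M N) : qequiv F F.
Proof.
exists (rdom F), (rindet F); split; first by split=> //; apply: cofinsub_dom.
split=> //; first exact: finsub_indet.
by move=> x y y' _ f f'; have := grel_B (qgraph_rel F) f f'; rewrite subrr.
Qed.

Lemma qequiv_sym M N (F G : qmor M N) : qequiv F G -> qequiv G F.
Proof.
move=> [A [B [[hA AF AG] [hB FB GB h]]]]; exists A, B; split=> //; split=> //.
move=> x y y' ax g f; rewrite -opprB; apply: gsub_N; first by case: hB.
exact: (h x).
Qed.

Lemma qequiv_trans M N (F G H : qmor M N) :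
  qequiv F G -> qequiv G H -> qequiv F H.
Proof.
move=> [A [B [[hA AF AG] [hB FB GB h]]]] [A' [B' [[hA' AG' AH'] [hB' GB' HB' h']]]].
exists (gand A A'), (gadd B B'); split.
  split; first exact: cofinsub_and.
  - by move=> x [/AF].
  - by move=> x [_ /AH'].
split; first exact: finsub_add.
- by move=> y /FB; apply: subset_addl; case: hB'.
- by move=> y /HB'; apply: subset_addr; case: hB.
move=> x y y' [ax ax'] f hh; have [z g] := AG x ax.
exists (y - z), (z - y'); split; [exact: (h x)|exact: (h' x)|].
by rewrite addrA subrK.
Qed.

Lemma qequiv_subset M N (F G : qmor M N) :
  (forall x y, F x y -> G x y) -> qequiv F G.
Proof.
move=> FG; exists (rdom F), (rindet G); split.
  split=> //; first exact: cofinsub_dom.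
  by move=> x [y /FG g]; exists y.
split=> //; [exact: finsub_indet|by move=> y /FG|].
by move=> x y y' _ /FG f f'; have := grel_B (qgraph_rel G) f f'; rewrite subrr.
Qed.

Lemma qequiv_opp M N (F G : qmor M N) : qequiv F G -> qequiv (qopp F) (qopp G).
Proof.
move=> [A [B [[hA AF AG] [hB FB GB h]]]]; exists A, B; have [gB _] := hB.
split; split=> //.
- by move=> x /AF[y f]; exists (- y); rewrite /= /ropp opprK.
- by move=> x /AG[y f]; exists (- y); rewrite /= /ropp opprK.
- by move=> y /FB /(gsub_N gB); rewrite opprK.
- by move=> y /GB /(gsub_N gB); rewrite opprK.
- move=> x y y' ax f g; rewrite -(opprK (y - y')); apply: gsub_N => //.
  by rewrite opprD; apply: (h x).
Qed.

Lemma qequiv_add M N (F F' G G' : qmor M N) :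
  qequiv F F' -> qequiv G G' -> qequiv (qadd F G) (qadd F' G').
Proof.
move=> [A [B [[hA AF AF'] [hB FB FB' h]]]] [C [D [[hC CG CG'] [hD GD GD' h']]]].
exists (gand A C), (gadd B D); split.
  split; first exact: cofinsub_and.
  - by move=> x [/AF[y f] /CG[z g]]; exists (y + z), y, z.
  - by move=> x [/AF'[y f] /CG'[z g]]; exists (y + z), y, z.
split; first exact: finsub_add.
- by move=> _ [y [z [/FB by_ /GD dz ->]]]; exists y, z.
- by move=> _ [y [z [/FB' by_ /GD' dz ->]]]; exists y, z.
move=> x _ _ [ax cx] [y [z [f g ->]]] [y' [z' [f' g' ->]]].
exists (y - y'), (z - z'); split; [exact: (h x)|exact: (h' x)|].
by rewrite opprD addrACA.
Qed.

Lemma qequiv_comp M N Q (F F' : qmor M N) (G G' : qmor N Q) :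
  qequiv F F' -> qequiv G G' -> qequiv (qcomp G F) (qcomp G' F').
Proof.
move=> [A [B [[hA AF AF'] [hB FB FB' h]]]] [C [D [[hC CG CG'] [hD GD GD' h']]]].
have [gB _] := hB; have [gD _] := hD.
have hGB : finsub (rimg G B) by apply: finsub_img => //; [exact: qgraph_rel|exact: finsub_indet].
have hGB' : finsub (rimg G' B) by apply: finsub_img => //; [exact: qgraph_rel|exact: finsub_indet].
have [gGB _] := hGB; have [gGB' _] := hGB'.
exists (gand A (gand (rimg (rconv F) C) (rimg (rconv F') C))).
exists (gadd (gadd (rimg G B) D) (rimg G' B)); split.
  split.
  - apply: cofinsub_and => //; apply: cofinsub_and; apply: cofinsub_preimg => //.
    + exact: qgraph_rel.
    + exact: cofinsub_dom.
    + exact: qgraph_rel.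
    + exact: cofinsub_dom.
  - by move=> x [_ [[y /CG[z g] f] _]]; exists z, y.
  - by move=> x [_ [_ [y /CG'[z g] f]]]; exists z, y.
have hS := gsub_add gGB gD.
split; first by apply: finsub_add => //; apply: finsub_add.
- move=> z [y /FB yB g]; apply: subset_addl => //; apply: subset_addl => //.
  by exists y.
- by move=> z [y /FB' yB g]; apply: subset_addr => //; exists y.
move=> x z z' [ax [[n0 cn0 f0] _]] [n f g] [n' f' g'].
have [q gq] := CG _ cn0; have [q' gq'] := CG' _ cn0.
exists (z - q + (q - q')), (q' - z'); split.
- exists (z - q), (q - q'); split=> //; last exact: (h' n0).
  exists (n - n0); last by apply: (grel_B (qgraph_rel G)).
  by apply: FB; have := grel_B (qgraph_rel F) f f0; rewrite subrr.
- exists (n0 - n'); last by apply: (grel_B (qgraph_rel G')).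
  exact: (h x).
- by rewrite [z - q + _]addrA subrK addrA subrK.
Qed.

Definition qequivb M N : rel (qmor M N) := fun F G => `[< qequiv F G >].

Lemma qequivb_equiv M N : equiv_class_of (@qequivb M N).
Proof.
split.
- by move=> F; apply/asboolP; apply: qequiv_refl.
- by move=> F G; apply/asboolP/asboolP; apply: qequiv_sym.
- move=> G F H /asboolP FG /asboolP GH; apply/asboolP.
  exact: qequiv_trans GH.
Qed.

HB.instance Definition _ M N := gen_eqMixin (qmor M N).
HB.instance Definition _ M N := gen_choiceMixin (qmor M N).

Canonical qequivb_rel M N := EquivRelPack (@qequivb_equiv M N).
Canonical qequivb_enc M N := defaultEncModRel (@qequivb M N).

Definition qhom M N := {eq_quot (@qequivb M N)}.
HB.instance Definition _ M N := Choice.on (qhom M N).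

Lemma qhomP M N (F G : qmor M N) :
  qequiv F G -> \pi_(qhom M N) F = \pi_(qhom M N) G.
Proof. by move=> e; apply/eqquotP/asboolP. Qed.

Lemma qhom_repr M N (F : qmor M N) : qequiv (repr (\pi_(qhom M N) F)) F.
Proof.
have /eqquotP/asboolP := reprK (\pi_(qhom M N) F); exact.
Qed.

Definition hzero M N : qhom M N := \pi_(qhom M N) (qzero M N).
Definition hopp M N (f : qhom M N) : qhom M N := \pi_(qhom M N) (qopp (repr f)).
Definition hadd M N (f g : qhom M N) : qhom M N := \pi_(qhom M N) (qadd (repr f) (repr g)).
Definition hid M : qhom M M := \pi_(qhom M M) (qid M).
Definition hcomp M N Q (g : qhom N Q) (f : qhom M N) : qhom M Q :=
  \pi_(qhom M Q) (qcomp (repr g) (repr f)).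

Lemma pi_hopp M N (F : qmor M N) : hopp (\pi_(qhom M N) F) = \pi_(qhom M N) (qopp F).
Proof. by apply: qhomP; apply: qequiv_opp; apply: qhom_repr. Qed.

Lemma pi_hadd M N (F G : qmor M N) : hadd (\pi_(qhom M N) F) (\pi_(qhom M N) G) = \pi_(qhom M N) (qadd F G).
Proof. by apply: qhomP; apply: qequiv_add; apply: qhom_repr. Qed.

Lemma pi_hcomp M N Q (G : qmor N Q) (F : qmor M N) :
  hcomp (\pi_(qhom N Q) G) (\pi_(qhom M N) F) = \pi_(qhom M Q) (qcomp G F).
Proof. by apply: qhomP; apply: qequiv_comp; apply: qhom_repr. Qed.

Lemma qhomW M N (P : qhom M N -> Prop) : (forall F, P (\pi_(qhom M N) F)) -> forall f, P f.
Proof. by move=> h f; rewrite -[f]reprK. Qed.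

Lemma haddA M N : associative (@hadd M N).
Proof.
elim/qhomW => F; elim/qhomW => G; elim/qhomW => H; rewrite !pi_hadd.
apply/qhomP/qequiv_subset => x _ [y [_ [f [z [t [g h ->]]] ->]]].
by exists (y + z), t; rewrite addrA; split=> //; exists y, z.
Qed.

Lemma haddC M N : commutative (@hadd M N).
Proof.
elim/qhomW => F; elim/qhomW => G; rewrite !pi_hadd.
apply/qhomP/qequiv_subset => x _ [y [z [f g ->]]].
by exists z, y; rewrite addrC.
Qed.

Lemma hadd0 M N : left_id (@hzero M N) (@hadd M N).
Proof.
elim/qhomW => F; rewrite pi_hadd.
by apply/qhomP/qequiv_subset => x _ [_ [z [-> f ->]]]; rewrite add0r.
Qed.

Lemma haddN M N : left_inverse (@hzero M N) (@hopp M N) (@hadd M N).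
Proof.
elim/qhomW => F; rewrite pi_hopp pi_hadd; apply: qhomP.
have [hF _] := finsub_indet F.
have h0 x y y' : qopp F x y -> F x y' -> rindet F (y + y').
  move=> f f'; rewrite -(opprK (y + y')) opprD; apply: gsub_N => //.
  by have := grel_B (qgraph_rel F) f f'; rewrite subrr.
exists (rdom F), (rindet F); split; split=> //.
- exact: cofinsub_dom.
- by move=> x [y f]; exists (- y + y), (- y), y; split=> //; rewrite /= /ropp opprK.
- by move=> x _; exists 0.
- exact: finsub_indet.
- by move=> _ [y [z [f g ->]]]; apply: h0 f g.
- by move=> y ->; apply: gsub_0.
- by move=> x _ _ _ [y [z [f g ->]]] ->; rewrite subr0; apply: h0 f g.
Qed.

HB.instance Definition _ M N :=
  GRing.isZmodule.Build (qhom M N) (@haddA M N) (@haddC M N) (@hadd0 M N) (@haddN M N).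

Lemma hcompA M N Q R (h : qhom Q R) (g : qhom N Q) (f : qhom M N) :
  hcomp h (hcomp g f) = hcomp (hcomp h g) f.
Proof.
elim/qhomW: h => H; elim/qhomW: g => G; elim/qhomW: f => F; rewrite !pi_hcomp.
apply/qhomP/qequiv_subset => x t [z [y f g] h].
by exists y => //; exists z.
Qed.

Lemma hcompf1 M N (f : qhom M N) : hcomp f (hid M) = f.
Proof.
elim/qhomW: f => F; rewrite pi_hcomp.
by apply/qhomP/qequiv_subset => x y [_ <-].
Qed.

Lemma hcomp1f M N (f : qhom M N) : hcomp (hid N) f = f.
Proof.
elim/qhomW: f => F; rewrite pi_hcomp.
by apply/qhomP/qequiv_subset => x y [? ? <-].
Qed.

Lemma hcompDr M N Q (g : qhom N Q) (f f' : qhom M N) :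
  hcomp g (f + f') = hcomp g f + hcomp g f'.
Proof.
elim/qhomW: g => G; elim/qhomW: f => F; elim/qhomW: f' => F'.
rewrite [LHS](congr1 (hcomp _) (pi_hadd F F')) !pi_hcomp.
rewrite [RHS]pi_hadd; apply/esym/qhomP/qequiv_subset.
move=> x _ [z [z' [[y f g] [y' f' g'] ->]]].
by exists (y + y'); [exists y, y'|apply: grel_D => //; exact: qgraph_rel].
Qed.

Lemma hcompDl M N Q (g g' : qhom N Q) (f : qhom M N) :
  hcomp (g + g') f = hcomp g f + hcomp g' f.
Proof.
elim/qhomW: g => G; elim/qhomW: g' => G'; elim/qhomW: f => F.
rewrite [X in hcomp X]pi_hadd !pi_hcomp.
rewrite [RHS]pi_hadd; apply/qhomP/qequiv_subset.
move=> x _ [y f [z [z' [g g' ->]]]].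
by exists z, z'; split=> //; exists y.
Qed.

End Equiv.

End GradedModules.

Record preadd_cat := PreaddCat {
  ob :> Type;
  hom : ob -> ob -> zmodType;
  idm : forall A, hom A A;
  comp : forall A B C, hom B C -> hom A B -> hom A C;
  compA : forall A B C D (h : hom C D) (g : hom B C) (f : hom A B),
    comp h (comp g f) = comp (comp h g) f;
  compf1 : forall A B (f : hom A B), comp f (idm A) = f;
  comp1f : forall A B (f : hom A B), comp (idm B) f = f;
  compDr : forall A B C (g : hom B C) (f f' : hom A B),
    comp g (f + f') = comp g f + comp g f';
  compDl : forall A B C (g g' : hom B C) (f : hom A B),
    comp (g + g') f = comp g f + comp g' f }.

Arguments idm {p} A.
Arguments comp {p A B C} g f.

(* The quotient of the category of finitely generated L-graded S-modules by the
   Serre subcategory of modules of finite length. *)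
Section Coh.
Variables (k : fieldType) (X : weighted_line k).

Record fgmod := FGMod { fgmod_gmod :> gmod X; fgmod_fg : fin_gen fgmod_gmod }.

Definition coh : preadd_cat := {|
  ob := fgmod;
  hom := fun M N => qhom M N;
  idm := fun M => hid M;
  comp := fun M N Q => @hcomp k X M N Q;
  compA := fun M N Q R => @hcompA k X M N Q R;
  compf1 := fun M N => @hcompf1 k X M N;
  comp1f := fun M N => @hcomp1f k X M N;
  compDr := fun M N Q => @hcompDr k X M N Q;
  compDl := fun M N Q => @hcompDl k X M N Q |}.

End Coh.

(* The index set of a stability data is a plain type with a Prop-valued order
   rather than an [orderType]: the carriers of the latter are confined to the
   universe of [choiceType], below that of the objects of [coh X]. *)
Record linear_order := LinearOrder {
  lo_sort :> Type;
  lo_le : lo_sort -> lo_sort -> Prop;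
  lo_refl : forall x, lo_le x x;
  lo_anti : forall x y, lo_le x y -> lo_le y x -> x = y;
  lo_trans : forall x y z, lo_le x y -> lo_le y z -> lo_le x z;
  lo_total : forall x y, lo_le x y \/ lo_le y x }.

Definition lo_lt (T : linear_order) (x y : T) : Prop := lo_le x y /\ x <> y.

Section Stability.
Variable C : preadd_cat.
Implicit Types (A B E : C) (P : C -> Prop).

Definition is_zero A : Prop := idm A = 0.

Definition is_iso A B (f : hom A B) : Prop :=
  exists g : hom B A, comp g f = idm A /\ comp f g = idm B.

Definition is_kernel A E B (i : hom A E) (p : hom E B) : Prop :=
  comp p i = 0 /\
  forall D (f : hom D E), comp p f = 0 -> exists! g : hom D A, comp i g = f.

Definition is_cokernel A E B (i : hom A E) (p : hom E B) : Prop :=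
  comp p i = 0 /\
  forall D (f : hom E D), comp f i = 0 -> exists! g : hom B D, comp g p = f.

Definition short_exact A E B (i : hom A E) (p : hom E B) : Prop :=
  is_kernel i p /\ is_cokernel i p.

Definition is_summand A E : Prop :=
  exists B (i : hom A E) (p : hom E A) (j : hom B E) (q : hom E B),
    [/\ comp p i = idm A, comp q j = idm B & comp i p + comp j q = idm E].

Definition iso_closed P : Prop := forall A B (f : hom A B), is_iso f -> P A -> P B.

(* An extension-closed subcategory contains the zero objects (the empty
   iterated extensions). *)
Definition ext_closed P : Prop :=
  [/\ iso_closed P, forall A, is_zero A -> P A
    & forall A E B (i : hom A E) (p : hom E B),
        short_exact i p -> P A -> P B -> P E].

Definition summand_closed P : Prop := forall A E, is_summand A E -> P E -> P A.

Definition generated P : C -> Prop := fun A =>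
  forall Q : C -> Prop, ext_closed Q -> summand_closed Q ->
    (forall B, P B -> Q B) -> Q A.

Record stability_data := StabilityData {
  sd_index : linear_order;
  sd_part : sd_index -> C -> Prop;
  sd_ext : forall phi, ext_closed (sd_part phi);
  sd_nonzero : forall phi, exists2 A, sd_part phi A & ~ is_zero A;
  sd_hom : forall phi' phi'' : sd_index, lo_lt phi'' phi' ->
    forall A B, sd_part phi' A -> sd_part phi'' B -> forall f : hom A B, f = 0;
  sd_filtration : forall A, ~ is_zero A ->
    exists (n : nat) (F G : nat -> C) (phi : nat -> sd_index),
      [/\ is_zero (F 0%N), F n = A,
          forall m, (m < n)%N ->
            [/\ sd_part (phi m) (G m), ~ is_zero (G m)
              & exists (i : hom (F m) (F m.+1)) (p : hom (F m.+1) (G m)),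
                  short_exact i p]
        & forall l m, (l < m)%N -> (m < n)%N -> lo_lt (phi m) (phi l)] }.

Definition sd_equiv (S T : stability_data) : Prop :=
  exists r : sd_index S -> sd_index T,
    [/\ bijective r, forall x y, lo_le x y -> lo_le (r x) (r y)
      & forall phi A, sd_part (r phi) A <-> sd_part phi A].

(* T is finer than S *)
Definition finer (T S : stability_data) : Prop :=
  exists r : sd_index T -> sd_index S,
    [/\ forall phi, exists psi, r psi = phi,
        forall psi' psi'', lo_lt psi'' psi' -> lo_le (r psi'') (r psi')
      & forall phi A, sd_part phi A <->
          generated (fun B => exists2 psi, r psi = phi & sd_part psi B) A].

Definition finest (T : stability_data) : Prop :=
  forall T', finer T' T -> sd_equiv T' T.

End Stability.

(* Main.v *)
From Pilot Require Import Defs.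
From mathcomp Require Import all_boot all_order all_algebra.
From HB Require Import structures.
From mathcomp Require Import boolp mpoly ring.
Import Pilot.Defs.

(* A stability data is the same thing as a chain of torsion classes T such that the
   torsion subobjects t_T(X), T in the chain, are finite in number for every object X:
   the parts are cut out by the classes of the chain. Refining the stability data
   amounts to enlarging the chain, so that finest stability data correspond to maximal
   chains, and Zorn's lemma gives the theorem once we know that the finiteness
   condition is automatic in coh X.

   Ascending chains of subobjects terminate as coh X is noetherian. Let X_0 > X_1 > ...
   be a descending chain of torsion subobjects. The ranks over k[u, v] stabilise, so
   we may assume that X_0 / X_n is torsion for all n. If X_n is not torsion then
   Hom(X_n, X_0 / X_n) = 0, and since X_n is locally free modulo torsion this forces
   X_0 / X_n to be supported at the exceptional points and killed by the product g of
   the corresponding linear forms: locally at a point with uniformizer s and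
   ramification index p, the elements x, s x, ..., s^(p-1) x have all possible degrees,
   so one of them would be the image of a local generator of X_n. Hence X_n contains
   g X_0, and X_0 / g X_0 has finite length in coh X. *)

(** The obstacle is the descending condition: a line bundle has infinite descending chains of
    subobjects, so the vanishing of Hom(X_n, X_0 / X_n) must be exploited. The overview deals with
    the case where no X_n is torsion. If some X_n is torsion, then so is X_0, because X_0 / X_n is;
    a single form t then kills X_0 and takes over the part of g. In both cases every X_n contains t
    X_0 for one fixed t. To see that X_0 / t X_0 has finite length, choose a linear form f that
    vanishes at no zero of t. The quotient is finitely generated over k[f], so its rank drops only
    finitely often, and a step of rank zero is killed by t and by a power of f, hence by an ideal of
    finite colength in S. Subobjects in coh X are handled as saturated submodules and morphisms as
    relations, so that lifts and descents of morphisms are composites with converse relations.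
    Localisation at a point is replaced by multiplication with explicitly factored elements that do
    not vanish there. *)

Set Implicit Arguments.
Unset Strict Implicit.
Unset Printing Implicit Defensive.

Import Order.TTheory GRing.Theory Num.Theory.
Local Open Scope ring_scope.
Local Open Scope quotient_scope.

(** * Maximal chains *)

(* Zorn's lemma in MathComp is confined to carriers in the universe of [eqType],
   which lies strictly below that of the objects of [coh X]. *)
Section MaximalChain.
Variables (T : Type) (R : T -> T -> Prop).
Local Notation "c <s d" := (subset c d) (at level 70).

Definition chain (c : T -> Prop) : Prop := forall x y, c x -> c y -> R x y \/ R y x.

Definition extend (c : T -> Prop) (x : T) : T -> Prop := fun y => c y \/ y = x.

Variable c0 : T -> Prop.
Hypothesis c0_chain : chain c0.

Lemma grow_ex (c : T -> Prop) : exists d : T -> Prop,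
  (exists x, ~ c x /\ chain (extend c x)) ->
  exists x, [/\ ~ c x, chain (extend c x) & d = extend c x].
Proof.
have [[x [nx cx]]|n] := pselect (exists x, ~ c x /\ chain (extend c x)); last by exists c.
by exists (extend c x) => _; exists x.
Qed.

Definition grow (c : T -> Prop) : T -> Prop :=
  if pselect (exists x, ~ c x /\ chain (extend c x)) is left _
  then sval (cid (grow_ex c)) else c.

Lemma grow_sub c : c <s grow c.
Proof.
rewrite /grow; case: pselect => [h x cx|_ x //].
by case: (cid _) => d /= /(_ h)[y [_ _ ->]]; left.
Qed.

(** [grow] adds at most one element, which leaves no room strictly in between. This is what makes
    the tower linearly ordered. *)
Lemma grow_between c d : c <s d -> d <s grow c -> d = c \/ d = grow c.
Proof.
rewrite /grow; case: pselect => [h|_] cd; last by move=> dc; left; apply/funext => x; apply/propext; split; [exact: dc|exact: cd].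
case: (cid _) => e /= /(_ h)[x [nx _ ->]] de.
have [dx|ndx] := pselect (d x); [right|left]; apply/funext => y; apply/propext; split.
- exact: de.
- by move=> [/cd //|->].
- by move=> dy; case: (de y dy) => // eyx; rewrite eyx in dy.
- exact: cd.
Qed.

Lemma grow_chain c : chain c -> chain (grow c).
Proof.
rewrite /grow; case: pselect => // h _.
by case: (cid _) => d /= /(_ h)[x [_ hx ->]].
Qed.

(** The Bourbaki-Witt tower over [c0]. The clause [c0 x] in the union makes the empty union equal to
    [c0], so no separate base case occurs. *)
Inductive tower : (T -> Prop) -> Prop :=
| tower_grow c : tower c -> tower (grow c)
| tower_sup (F : (T -> Prop) -> Prop) : (forall c, F c -> tower c) ->
    tower (fun x => c0 x \/ exists2 c, F c & c x).

Lemma tower_c0 c : tower c -> c0 <s c.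
Proof.
elim=> [d _ h x /h|F _ _ x]; [exact: grow_sub|by left].
Qed.

(** Zermelo's comparison, by induction on c and then on d. With [grow d] instead of d in the second
    alternative, the successor step squeezes a set between c and [grow c], where [grow_between]
    leaves only two values. *)
Lemma tower_total c : tower c -> forall d, tower d -> c <s d \/ grow d <s c.
Proof.
elim=> {c} [c tc IHc|F tF IHF] d td; last first.
  have [h|/existsNP[c /not_implyP[Fc nc]]] := pselect (forall c, F c -> c <s d).
    by left=> x [/(tower_c0 td) //|[c Fc cx]]; apply: (h c).
  have [//|h] := IHF c Fc d td.
  by right=> x /h cx; right; exists c.
have cc := @grow_sub c.
elim: td => {d} [d td IHd|G tG IHG].
  have [h|dc] := IHd; first by left=> x /h; apply: grow_sub.
  have [h|h] := IHc (grow d) (tower_grow td); last by right=> x /h /cc.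
  by have [->|->] := grow_between h dc; [right|left].
set d := (fun x => _); have td : tower d by apply: tower_sup.
have [h|h] := IHc d td; last by right=> x /h /cc.
have [dc|] := pselect (d <s c).
  suff -> : d = c by right.
  by apply/funext => x; apply/propext; split; [exact: dc|exact: h].
move=> /existsNP[x /not_implyP[[/(tower_c0 tc) //|[d' Gd' d'x]] ncx]].
have dd : d' <s d by move=> y d'y; right; exists d'.
have [h'|h'] := IHc d' (tG _ Gd'); last by case: ncx; apply: h'; apply: grow_sub.
have [k|k] := IHG d' Gd'; first by left=> y /k/dd.
have [e|<-] := grow_between h' (fun y d'y => k y (grow_sub d'y)); last by left.
by case: ncx; rewrite -e.
Qed.

Lemma tower_chain c : tower c -> chain c.
Proof.
elim=> {c} [d _ /grow_chain //|F tF IHF] x y.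
have h c d : F c -> F d -> c <s d \/ d <s c.
  move=> Fc Fd; have [|k] := tower_total (tF _ Fc) (tF _ Fd); first by left.
  by right=> z /grow_sub/k.
move=> [cx|[c Fc cx]] [cy|[d Fd dy]]; first exact: c0_chain.
- by apply: (IHF d) => //; apply: tower_c0 cx; apply: tF.
- by apply: (IHF c) => //; apply: tower_c0 cy; apply: tF.
- have [cd|dc] := h c d Fc Fd; first by apply: (IHF d) => //; apply: cd.
  by apply: (IHF c) => //; apply: dc.
Qed.

(** The union m of the whole tower belongs to the tower, hence so does [grow m]; thus m contains its
    own growth and cannot be extended. *)
Lemma maximal_chain : exists m, [/\ c0 <s m, chain m
  & forall x, chain (extend m x) -> m x].
Proof.
set m := fun x => c0 x \/ exists2 c, tower c & c x.
have tm : tower m by apply: tower_sup.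
exists m; split; [exact: tower_c0|exact: tower_chain|move=> x cx].
have [//|nmx] := pselect (m x).
have : grow m <s m by move=> y my; right; exists (grow m) => //; apply: tower_grow.
rewrite /grow; case: pselect => [h|[]]; last by exists x.
case: (cid _) => d /= /(_ h)[y [ny _ ->]] /(_ y) my.
by case: ny; apply: my; right.
Qed.

End MaximalChain.

(** * Short exact sequences and torsion classes *)

Section Category.
Variable C : preadd_cat.
Implicit Types A B D E : C.

Lemma comp0f A B E (f : hom A B) : comp (0 : hom B E) f = 0.
Proof. by apply: (addrI (comp 0 f)); rewrite -compDl !addr0. Qed.

Lemma compf0 A B E (f : hom B E) : comp f (0 : hom A B) = 0.
Proof. by apply: (addrI (comp f 0)); rewrite -compDr !addr0. Qed.

Lemma compNf A B E (f : hom A B) (g : hom B E) : comp (- g) f = - comp g f.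
Proof. by apply/eqP; rewrite -addr_eq0 -compDl addNr comp0f. Qed.

Lemma compfN A B E (f : hom A B) (g : hom B E) : comp g (- f) = - comp g f.
Proof. by apply/eqP; rewrite -addr_eq0 -compDr addNr compf0. Qed.

Definition mono A B (f : hom A B) : Prop :=
  forall D (g : hom D A), comp f g = 0 -> g = 0.
Definition epi A B (f : hom A B) : Prop :=
  forall D (g : hom B D), comp g f = 0 -> g = 0.

Lemma mono_inj A B D (f : hom A B) (g h : hom D A) :
  mono f -> comp f g = comp f h -> g = h.
Proof.
move=> mf e; apply/eqP; rewrite -subr_eq0; apply/eqP/mf.
by rewrite compDr compfN e subrr.
Qed.

Lemma epi_inj A B D (f : hom A B) (g h : hom B D) :
  epi f -> comp g f = comp h f -> g = h.
Proof.
move=> mf e; apply/eqP; rewrite -subr_eq0; apply/eqP/mf.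
by rewrite compDl compNf e subrr.
Qed.

Lemma mono_comp A B D (f : hom A B) (g : hom B D) :
  mono f -> mono g -> mono (comp g f).
Proof. by move=> mf mg E h; rewrite -compA => /mg/mf. Qed.

Section ShortExact.
Variables (A E B : C) (i : hom A E) (p : hom E B).
Hypothesis ip : short_exact i p.

Lemma ses_comp0 : comp p i = 0. Proof. by case: ip => -[]. Qed.

Lemma ses_lift D (f : hom D E) : comp p f = 0 -> exists g, comp i g = f.
Proof. by case: ip => -[_ h] _ /h[g [e _]]; exists g. Qed.

Lemma ses_desc D (f : hom E D) : comp f i = 0 -> exists g, comp g p = f.
Proof. by case: ip => _ [_ h] /h[g [e _]]; exists g. Qed.

Lemma ses_mono : mono i.
Proof.
case: ip => -[_ h] _ D g e; have [|x [_ u]] := h D 0; first exact: compf0.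
by rewrite -(u g e) (u 0) // compf0.
Qed.

Lemma ses_epi : epi p.
Proof.
case: ip => _ [_ h] D g e; have [|x [_ u]] := h D 0; first exact: comp0f.
by rewrite -(u g e) (u 0) // comp0f.
Qed.

End ShortExact.

Lemma short_exactI A E B (i : hom A E) (p : hom E B) :
  comp p i = 0 -> mono i -> epi p ->
  (forall D (f : hom D E), comp p f = 0 -> exists g, comp i g = f) ->
  (forall D (f : hom E D), comp f i = 0 -> exists g, comp g p = f) ->
  short_exact i p.
Proof.
move=> pi0 mi ep hi hp; split; split=> // D f.
  by move=> /hi[g <-]; exists g; split=> // g' /(mono_inj mi).
by move=> /hp[g <-]; exists g; split=> // g' /(epi_inj ep).
Qed.

Lemma iso_mono A B (f : hom A B) : is_iso f -> mono f.
Proof. by move=> [g [gf _]] D h e; rewrite -[h]comp1f -gf -compA e compf0. Qed.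

Lemma iso_epi A B (f : hom A B) : is_iso f -> epi f.
Proof. by move=> [g [_ fg]] D h e; rewrite -[h]compf1 -fg compA e comp0f. Qed.

Lemma ses_iso_l A A' E B (i : hom A E) (p : hom E B) (f : hom A' A) :
  is_iso f -> short_exact i p -> short_exact (comp i f) p.
Proof.
move=> fi ip; have [g [gf fg]] := fi; apply: short_exactI.
- by rewrite compA (ses_comp0 ip) comp0f.
- by apply: mono_comp (ses_mono ip); apply: iso_mono.
- exact: ses_epi ip.
- move=> D h /(ses_lift ip)[h' <-]; exists (comp g h').
  by rewrite -compA (compA f) fg comp1f.
- by move=> D h; rewrite compA => /(iso_epi fi)/(ses_desc ip).
Qed.

Lemma hom_from_zero A B (f : hom A B) : is_zero A -> f = 0.
Proof. by move=> z; rewrite -[f]compf1 z compf0. Qed.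

Lemma hom_to_zero A B (f : hom A B) : is_zero B -> f = 0.
Proof. by move=> z; rewrite -[f]comp1f z comp0f. Qed.

Lemma mono0 A B (f : hom A B) : mono f -> f = 0 -> is_zero A.
Proof. by move=> mf f0; apply: mf; rewrite f0 comp0f. Qed.

Lemma epi0 A B (f : hom A B) : epi f -> f = 0 -> is_zero B.
Proof. by move=> mf f0; apply: mf; rewrite f0 compf0. Qed.

Lemma ses_id_l Z A : is_zero Z -> short_exact (0 : hom Z A) (idm A).
Proof.
move=> zZ; apply: short_exactI.
- exact: compf0.
- by move=> D g _; apply: hom_to_zero.
- by move=> D g; rewrite compf1.
- by move=> D f; rewrite comp1f => ->; exists 0; rewrite comp0f.
- by move=> D f _; exists f; rewrite compf1.
Qed.

Lemma ses_id_r A Z : is_zero Z -> short_exact (idm A) (0 : hom A Z).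
Proof.
move=> zZ; apply: short_exactI.
- exact: comp0f.
- by move=> D g; rewrite comp1f.
- by move=> D g _; apply: hom_from_zero.
- by move=> D f _; exists f; rewrite comp1f.
- by move=> D f; rewrite compf1 => ->; exists 0; rewrite compf0.
Qed.

Lemma ses_zero_iso_l A E B (i : hom A E) (p : hom E B) :
  short_exact i p -> is_zero A -> is_iso p.
Proof.
move=> ip zA; have [|g gp] := ses_desc ip (f := idm E).
  by rewrite comp1f; apply: hom_from_zero.
exists g; split=> //; apply: (epi_inj (ses_epi ip)).
by rewrite -compA gp compf1 comp1f.
Qed.

Lemma ses_zero_iso_r A E B (i : hom A E) (p : hom E B) :
  short_exact i p -> is_zero B -> is_iso i.
Proof.
move=> ip zA; have [|g gp] := ses_lift ip (f := idm E).
  by rewrite compf1; apply: hom_to_zero.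
exists g; split=> //; apply: (mono_inj (ses_mono ip)).
by rewrite compA gp compf1 comp1f.
Qed.

(** The form in which abelianness enters: kernel, image and cokernel of f with the two short exact
    sequences that meet in the image. That monos are kernels and that a zero object exists
    follows. *)
Definition has_images : Prop := forall A B (f : hom A B),
  exists K I Q (k : hom K A) (e : hom A I) (m : hom I B) (c : hom B Q),
    [/\ short_exact k e, short_exact m c & comp m e = f].

Hypothesis images : has_images.

Lemma mono_ses A B (f : hom A B) : mono f -> exists Q (c : hom B Q), short_exact f c.
Proof.
move=> mf; have [K [I [Q [k [e [m [c [ke mc fE]]]]]]]] := images f.
exists Q, c; rewrite -fE; apply: ses_iso_l mc; apply: (ses_zero_iso_l ke).
apply: (mono0 (ses_mono ke)); apply: mf.
by rewrite -fE -compA (ses_comp0 ke) compf0.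
Qed.

Lemma zero_object A : exists Z : C, is_zero Z.
Proof.
have [K [I [Q [k [e [m [c [ke mc fE]]]]]]]] := images (idm A).
exists K; apply: (mono0 (ses_mono ke)).
by rewrite -[k]comp1f -fE -compA (ses_comp0 ke) compf0.
Qed.

(** For subobjects A of X of Y this is the sequence of X / A, Y / A and Y / X. *)
Lemma third_iso A X B Y G (i : hom A X) (p : hom X B) (j : hom X Y) (q : hom Y G) :
  short_exact i p -> short_exact j q ->
  exists B' (r : hom Y B') (j' : hom B B') (q' : hom B' G),
    short_exact (comp j i) r /\ short_exact j' q'.
Proof.
move=> ip jq; have [|B' [r jir]] := @mono_ses _ _ (comp j i).
  by apply: mono_comp; [apply: ses_mono ip|apply: ses_mono jq].
have [|q' q'r] := ses_desc jir (f := q).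
  by rewrite compA (ses_comp0 jq) comp0f.
have [|j' j'p] := ses_desc ip (f := comp r j).
  by rewrite -compA (ses_comp0 jir).
exists B', r, j', q'; split=> //.
(* The image of [comp j' p] has the same kernel as p, so it is isomorphic to B, and j' is this
   isomorphism followed by a mono. *)
have mj' : mono j'.
  have [K [I [Q [k [e [m [c [ke mc meE]]]]]]]] := images (comp j' p).
  have [p' p'e] : exists g, comp g e = p.
    apply: (ses_desc ke).
    have [|g gE] := ses_lift jir (f := comp j k).
      by rewrite compA -j'p -meE -compA (ses_comp0 ke) compf0.
    have -> : k = comp i g by apply: (mono_inj (ses_mono jq)); rewrite -gE compA.
    by rewrite compA (ses_comp0 ip) comp0f.
  have [|e' e'p] := ses_desc ip (f := e).
    apply: (ses_mono mc); rewrite compA meE.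
    by rewrite -compA (ses_comp0 ip) compf0.
  have -> : j' = comp m e'.
    by apply: (epi_inj (ses_epi ip)); rewrite -compA e'p meE.
  apply: mono_comp (ses_mono mc); apply: iso_mono; exists p'; split.
    by apply: (epi_inj (ses_epi ip)); rewrite -compA e'p p'e comp1f.
  by apply: (epi_inj (ses_epi ke)); rewrite -compA p'e e'p comp1f.
have q'j' : comp q' j' = 0.
  apply: (ses_epi ip); rewrite -compA j'p compA q'r; exact: ses_comp0 jq.
have eq' : epi q'.
  move=> D g e; apply: (ses_epi jq); rewrite -q'r compA e comp0f //.
have dq' D (f : hom B' D) : comp f j' = 0 -> exists g, comp g q' = f.
  move=> e; have [|g gq] := ses_desc jq (f := comp f r).
    by rewrite -compA -j'p compA e comp0f.
  by exists g; apply: (epi_inj (ses_epi jir)); rewrite -compA q'r.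
have [Q [c j'c]] := mono_ses mj'.
apply: short_exactI => // D f e; apply: (ses_lift j'c).
have [g <-] := dq' _ c (ses_comp0 j'c).
by rewrite -compA e compf0.
Qed.

Definition right_orth (T : C -> Prop) : C -> Prop :=
  fun Y => forall A, T A -> forall f : hom A Y, f = 0.
Definition left_orth (F : C -> Prop) : C -> Prop :=
  fun Y => forall B, F B -> forall f : hom Y B, f = 0.

Lemma right_orth_mono T A B (f : hom A B) :
  mono f -> right_orth T B -> right_orth T A.
Proof. by move=> mf oB D tD g; apply: mf; apply: oB. Qed.

Lemma left_orth_epi F A B (f : hom A B) :
  epi f -> left_orth F A -> left_orth F B.
Proof. by move=> mf oB D tD g; apply: mf; apply: oB. Qed.

Lemma right_orth_zero T A : is_zero A -> right_orth T A.
Proof. by move=> zA D _ f; apply: hom_to_zero. Qed.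

Lemma left_orth_zero F A : is_zero A -> left_orth F A.
Proof. by move=> zA D _ f; apply: hom_from_zero. Qed.

Lemma right_orth_ses T A E B (i : hom A E) (p : hom E B) :
  short_exact i p -> right_orth T A -> right_orth T B -> right_orth T E.
Proof.
move=> ip oA oB D tD f; have [|g <-] := ses_lift ip (f := f); first exact: oB.
by rewrite (oA _ tD g) compf0.
Qed.

Lemma left_orth_ses F A E B (i : hom A E) (p : hom E B) :
  short_exact i p -> left_orth F A -> left_orth F B -> left_orth F E.
Proof.
move=> ip oA oB D tD f; have [|g <-] := ses_desc ip (f := f); first exact: oA.
by rewrite (oB _ tD g) comp0f.
Qed.

Lemma summand_split A E : is_summand A E ->
  exists (i : hom A E) (p : hom E A), comp p i = idm A.
Proof. by case=> B [i [p [j [q [e _ _]]]]]; exists i, p. Qed.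

Lemma ext_closed_right_orth T : ext_closed (right_orth T).
Proof.
split.
- move=> A B f [g [gf fg]]; apply: (@right_orth_mono _ _ _ g).
  by apply: iso_mono; exists f.
- exact: right_orth_zero.
- by move=> A E B i p; apply: right_orth_ses.
Qed.

Lemma ext_closed_left_orth F : ext_closed (left_orth F).
Proof.
split.
- by move=> A B f fi; apply: left_orth_epi (iso_epi fi).
- exact: left_orth_zero.
- by move=> A E B i p; apply: left_orth_ses.
Qed.

Lemma summand_closed_right_orth T : summand_closed (right_orth T).
Proof.
move=> A E /summand_split[i [p pi1]]; apply: (@right_orth_mono _ _ _ i).
by move=> D g e; rewrite -[g]comp1f -pi1 -compA e compf0.
Qed.

Lemma summand_closed_left_orth T : summand_closed (left_orth T).
Proof.
move=> A E /summand_split[i [p pi1]]; apply: (@left_orth_epi _ _ _ p).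
by move=> D g e; rewrite -[g]compf1 -pi1 compA e comp0f.
Qed.

Lemma summand_closedI (P Q : C -> Prop) :
  summand_closed P -> summand_closed Q -> summand_closed (fun A => P A /\ Q A).
Proof. by move=> hP hQ A E s [pE qE]; split; [apply: hP pE|apply: hQ qE]. Qed.

Lemma orth_zero T A : T A -> right_orth T A -> is_zero A.
Proof. by move=> tA /(_ _ tA (idm A)). Qed.

(** The torsion half of a torsion pair. The first clause recovers T from its torsion-free class, so
    that closure under quotients and extensions is inherited from [left_orth]. *)
Definition torsion_class (T : C -> Prop) : Prop :=
  (forall X, left_orth (right_orth T) X -> T X) /\
  forall X, exists A B (a : hom A X) (b : hom X B),
    [/\ T A, right_orth T B & short_exact a b].

Section TorsionClass.
Variable T : C -> Prop.
Hypothesis hT : torsion_class T.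

Lemma torsion_left_orth X : T X -> left_orth (right_orth T) X.
Proof. by move=> tX B oB f; apply: oB. Qed.

Lemma torsion_classE : T = left_orth (right_orth T).
Proof.
apply/funext => X; apply/propext; split; first exact: torsion_left_orth.
by case: hT => + _; apply.
Qed.

Lemma ext_closed_torsion : ext_closed T.
Proof. rewrite torsion_classE; exact: ext_closed_left_orth. Qed.

Lemma torsion_epi A B (f : hom A B) : epi f -> T A -> T B.
Proof. rewrite torsion_classE; exact: left_orth_epi. Qed.

End TorsionClass.

(** Enlarging a torsion class shrinks its right orthogonal, so two inclusions in the same direction
    force equality. *)
Lemma torsion_class_eq T T' : torsion_class T -> torsion_class T' ->
  subset T T' -> subset (right_orth T) (right_orth T') -> T = T'.
Proof.
move=> hT hT' s s'; apply/funext => X; apply/propext; split; first exact: s.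
rewrite (torsion_classE hT) (torsion_classE hT') => o B /s'; exact: o.
Qed.

Lemma right_orth_sub (T T' : C -> Prop) :
  subset T T' -> subset (right_orth T') (right_orth T).
Proof. by move=> s Y oY A /s; apply: oY. Qed.

Lemma torsion_class_zero : torsion_class (@is_zero C).
Proof.
split.
  move=> X oX; have /(_ _ (idm X)) := oX X; apply.
  by move=> B zB f; apply: hom_from_zero.
move=> X; have [Z zZ] := zero_object X; exists Z, X, 0, (idm X); split=> //; last exact: ses_id_l.
by move=> B zB f; apply: hom_from_zero.
Qed.

Lemma torsion_class_full : torsion_class (fun _ : C => True).
Proof.
split=> // X; have [Z zZ] := zero_object X.
exists X, Z, (idm X), 0; split=> //; last exact: ses_id_r.
exact: right_orth_zero.
Qed.

End Category.

(** * Torsion classes of a stability data *)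

Section UpperClasses.
Variables (C : preadd_cat) (S : stability_data C).
Hypothesis images : has_images C.
Implicit Types (A B X Y : C) (I : sd_index S -> Prop).

Definition upper (T : linear_order) (I : T -> Prop) : Prop :=
  forall x y, lo_le x y -> I x -> I y.

Lemma upper_lt (T : linear_order) (I : T -> Prop) x y :
  upper I -> I x -> ~ I y -> lo_lt y x.
Proof.
move=> uI ix ny; have [/uI/(_ ix)//|yx] := lo_total x y.
by split=> // e; apply: ny; rewrite e.
Qed.

Lemma upper_total (T : linear_order) (I J : T -> Prop) :
  upper I -> upper J -> subset I J \/ subset J I.
Proof.
move=> uI uJ; have [|/existsNP[x /not_implyP[ix njx]]] := pselect (subset I J); [by left|right].
by move=> y jy; apply: uI ix; have [] := upper_lt uJ jy njx.
Qed.

Definition above (T : linear_order) (x : T) : T -> Prop := lo_le x.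
Definition strictly_above (T : linear_order) (x : T) : T -> Prop := lo_lt x.

Lemma upper_above (T : linear_order) (x : T) : upper (above x).
Proof. by move=> y z yz xy; apply: lo_trans yz. Qed.

Lemma upper_strictly_above (T : linear_order) (x : T) : upper (strictly_above x).
Proof.
move=> y z yz [xy nxy]; split; first exact: lo_trans yz.
by move=> e; apply: nxy; apply: lo_anti => //; rewrite e.
Qed.

Lemma lt_not_le (T : linear_order) (x y : T) : lo_lt x y -> ~ lo_le y x.
Proof. by move=> [xy n] yx; apply/n/lo_anti. Qed.

Lemma not_le_lt (T : linear_order) (x y : T) : ~ lo_le x y -> lo_lt y x.
Proof.
by move=> n; have [//|h] := lo_total x y; split=> // e; apply: n; rewrite e; apply: lo_refl.
Qed.

Definition parts I : C -> Prop := fun A => exists2 phi, I phi & sd_part phi A.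

(** For an upper set I these are the objects whose Harder-Narasimhan phases all lie in I; the
    orthogonality form avoids any choice of filtration. *)
Definition upper_class I : C -> Prop := left_orth (parts (fun phi => ~ I phi)).

Section Upper.
Variable I : sd_index S -> Prop.
Hypothesis uI : upper I.

Lemma part_upper_class phi A : I phi -> sd_part phi A -> upper_class I A.
Proof.
move=> iphi pA B [psi npsi pB]; apply: (sd_hom _ pA pB); exact: upper_lt iphi npsi.
Qed.

Lemma part_right_orth_upper phi A :
  ~ I phi -> sd_part phi A -> right_orth (upper_class I) A.
Proof. by move=> nphi pA B /(_ A); apply; exists phi. Qed.

Lemma part_left_orth phi A : I phi -> sd_part phi A -> left_orth (right_orth (parts I)) A.
Proof. by move=> iphi pA B /(_ A); apply; exists phi. Qed.

(** The torsion part is the step of the filtration at which the phases leave I. The induction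
    carries the fact that [F m] itself is torsion as long as all phases so far lie in I; a later
    factor is moved into the torsion-free quotient by [third_iso]. *)
Lemma truncation X : exists A B (a : hom A X) (b : hom X B),
  [/\ left_orth (right_orth (parts I)) A, right_orth (upper_class I) B & short_exact a b].
Proof.
have [zX|/(@sd_filtration _ S)[n [F [G [phi [zF <- step dec]]]]]] := pselect (is_zero X).
  exists X, X, (idm X), 0; split; [exact: left_orth_zero|exact: right_orth_zero|].
  exact: ses_id_r.
have [Z zZ] := zero_object images X.
suff: forall m, (m <= n)%N ->
  ((forall l, (l < m)%N -> I (phi l)) -> left_orth (right_orth (parts I)) (F m)) /\
  exists A B (a : hom A (F m)) (b : hom (F m) B),
  [/\ left_orth (right_orth (parts I)) A, right_orth (upper_class I) B & short_exact a b].
  by case/(_ n (leqnn n)).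
elim=> [_|m IHm lt_mn].
  split=> [_|]; first exact: left_orth_zero.
  exists (F 0%N), (F 0%N), (idm _), 0; split; [exact: left_orth_zero|exact: right_orth_zero|].
  exact: ses_id_r.
have [in_m [A [B [a [b [tA fB ab]]]]]] := IHm (ltnW lt_mn).
have [pG nG [i [p ip]]] := step m lt_mn.
have inS : (forall l, (l < m.+1)%N -> I (phi l)) -> left_orth (right_orth (parts I)) (F m.+1).
  move=> h; apply: (left_orth_ses ip); last by apply: part_left_orth pG; apply: h.
  by apply: in_m => l lm; apply: h; apply: ltnW.
split=> //.
have [iphi|nphi] := pselect (I (phi m)).
  exists (F m.+1), Z, (idm _), 0; split; last exact: ses_id_r.
    apply: inS => l; rewrite ltnS leq_eqVlt => /orP[/eqP -> //|lm].
    by have [h _] := dec l m lm lt_mn; apply: uI h iphi.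
  exact: right_orth_zero.
have [B' [r [j' [q' [s1 s2]]]]] := third_iso images ab ip.
exists A, B', (comp i a), r; split=> //.
apply: (right_orth_ses s2) => //; exact: part_right_orth_upper pG.
Qed.

Lemma upper_classE : upper_class I = left_orth (right_orth (parts I)).
Proof.
apply/funext => X; apply/propext; split=> h; last first.
  move=> B [psi npsi pB]; apply: h => A [phi iphi pA].
  by apply: (sd_hom _ pA pB); exact: upper_lt iphi npsi.
have [A [B [a [b [tA fB ab]]]]] := truncation X.
move=> Y oY f; have [|g <-] := ses_desc ab (f := f); first exact: tA.
by rewrite (fB _ h b) compf0.
Qed.

Lemma torsion_upper_class : torsion_class (upper_class I).
Proof.
split=> [X h B [psi npsi pB]|X].
  by apply: h; apply: part_right_orth_upper pB.
by have := truncation X; rewrite -upper_classE.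
Qed.

End Upper.

Lemma upper_class_mono I J : subset I J -> subset (upper_class I) (upper_class J).
Proof. by move=> IJ X h B [psi npsi pB]; apply: h; exists psi => // /IJ. Qed.

Lemma filtration_ends (n : nat) (F G : nat -> C) : is_zero (F 0%N) ->
  (forall m, (m < n.+1)%N -> ~ is_zero (G m) /\
     exists (i : hom (F m) (F m.+1)) (p : hom (F m.+1) (G m)), short_exact i p) ->
  (exists f : hom (G 0%N) (F n.+1), f <> 0) /\ (exists g : hom (F n.+1) (G n), g <> 0).
Proof.
move=> zF step; split; last first.
  by have [nG [i [p /ses_epi ep]]] := step n (leqnn _); exists p => /(epi0 ep).
have [nG [i [p ip]]] := step 0%N isT.
have [g [gp pg]] := ses_zero_iso_l ip zF.
have [f mf] : exists f : hom (F 1%N) (F n.+1), mono f.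
  suff: forall m, (m < n.+1)%N -> exists f : hom (F 1%N) (F m.+1), mono f by apply.
  elim=> [_|m IHm lt_m]; first by exists (idm _) => D h; rewrite comp1f.
  have [f mf] := IHm (ltnW lt_m); have [_ [j [q jq]]] := step m.+1 lt_m.
  by exists (comp j f); apply: mono_comp mf (ses_mono jq).
have mg : mono (comp f g) by apply: mono_comp mf; apply: iso_mono; exists p.
by exists (comp f g) => /(mono0 mg).
Qed.

(** What later arguments need of the filtration: its first factor embeds into X, its last one is a
    quotient of X, and equal phases at both ends mean that there is only one step. *)
Lemma hn_ends X : ~ is_zero X -> exists phi psi : sd_index S, [/\ lo_le psi phi,
  exists A (f : hom A X), sd_part phi A /\ f <> 0,
  exists B (g : hom X B), sd_part psi B /\ g <> 0
  & phi = psi -> sd_part phi X].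
Proof.
move=> nX; have [n [F [G [phi [zF FX step dec]]]]] := @sd_filtration _ S _ nX.
case: n => [|n] in FX step dec *; first by rewrite -FX in nX.
have [|[f nf] [g ng]] := @filtration_ends n F G zF.
  by move=> m /step[_ nG h].
rewrite FX in f nf g ng; have [p0 _ _] := step 0%N isT; have [pn _ _] := step n (leqnn _).
exists (phi 0%N), (phi n); split; [|by exists (G 0%N), f|by exists (G n), g|].
  have [->|n0] := posnP n; first exact: lo_refl.
  by have [] := dec 0%N n n0 (leqnn _).
have [n0 _|n0 e] := posnP n; last by have [_ []] := dec 0%N n n0 (leqnn _).
rewrite n0 in FX; have [pG nG [i [p ip]]] := step 0%N isT.
have [h [hp ph]] := ses_zero_iso_l ip zF.
rewrite -FX; have [iso _ _] := sd_ext (phi 0%N); apply: (iso _ _ h) pG.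
by exists p.
Qed.

(** Orthogonality to the strictly higher phases bounds the top phase of X by phi, membership in the
    class above phi bounds the bottom phase from below; so X has the single phase phi. *)
Lemma upper_class_slice (phi : sd_index S) X :
  upper_class (above phi) X -> right_orth (upper_class (strictly_above phi)) X ->
  sd_part phi X.
Proof.
move=> tX fX; have [zX|nX] := pselect (is_zero X).
  by have [_ + _] := sd_ext phi; apply.
have [p [q [qp [A [f [pA nf]]] [B [g [pB ng]]] h]]] := hn_ends nX.
have ple : lo_le p phi.
  apply: contrapT => /not_le_lt lt; apply: nf; apply: fX.
  by apply: part_upper_class pA => //; apply: upper_strictly_above.
have qge : lo_le phi q.
  by apply: contrapT => nle; apply: ng; apply: tX; exists q.
have e : p = phi by apply: lo_anti => //; apply: lo_trans qp.
by rewrite -e; apply: h; apply: lo_anti => //; rewrite e.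
Qed.

Lemma part_slice (phi : sd_index S) X : sd_part phi X ->
  upper_class (above phi) X /\ right_orth (upper_class (strictly_above phi)) X.
Proof.
move=> pX; split; last by apply: part_right_orth_upper pX => -[].
by apply: part_upper_class pX; [exact: upper_above|exact: lo_refl].
Qed.

Lemma sd_partE (phi : sd_index S) : sd_part phi = fun X =>
  upper_class (above phi) X /\ right_orth (upper_class (strictly_above phi)) X.
Proof.
apply/funext => X; apply/propext; split; first exact: part_slice.
by case; apply: upper_class_slice.
Qed.

Lemma summand_closed_part (phi : sd_index S) : summand_closed (sd_part phi).
Proof.
rewrite sd_partE; apply: summand_closedI; first exact: summand_closed_left_orth.
exact: summand_closed_right_orth.
Qed.

Lemma part_index_le (phi psi : sd_index S) A B (f : hom A B) :
  sd_part phi A -> sd_part psi B -> f <> 0 -> lo_le phi psi.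
Proof.
move=> pA pB nf; apply: contrapT => /not_le_lt lt; apply: nf; exact: sd_hom pA pB _.
Qed.

(** Test with the class above the top phase p: X is not orthogonal to it, as it receives a nonzero
    map from the part p. So X lies in it, and the bottom phase is at least p. *)
Lemma semistable_part X : ~ is_zero X ->
  (forall I, upper I -> upper_class I X \/ right_orth (upper_class I) X) ->
  exists phi : sd_index S, sd_part phi X.
Proof.
move=> nX ss; have [p [q [qp [A [f [pA nf]]] [B [g [pB ng]]] h]]] := hn_ends nX.
exists p; apply: h; apply: lo_anti => //.
have [tX|fX] := ss _ (@upper_above _ p).
  by apply: contrapT => nle; apply: ng; apply: tX; exists q.
case: nf; apply: fX; apply: part_upper_class pA; [exact: upper_above|exact: lo_refl].
Qed.

End UpperClasses.

(** * The stability data of a chain of torsion classes *)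

Section ChainStability.
Variable C : preadd_cat.
Hypothesis images : has_images C.
Implicit Types (A B X Y : C) (T : C -> Prop).

(** The equation [comp (b n.+1) (a n) = 0] says that [A n] is contained in [A n.+1] as a subobject
    of X. *)
Definition sub_acc : Prop := forall X (A B : nat -> C)
  (a : forall n, hom (A n) X) (b : forall n, hom X (B n)),
  (forall n, short_exact (a n) (b n)) ->
  (forall n, comp (b n.+1) (a n) = 0) -> exists n, comp (b n) (a n.+1) = 0.

(* Descending chains of arbitrary subobjects need not terminate in [coh X]; the
   last hypothesis holds when the A_n are torsion subobjects of X. *)
Definition torsion_dcc : Prop := forall X (A B : nat -> C)
  (a : forall n, hom (A n) X) (b : forall n, hom X (B n)),
  (forall n, short_exact (a n) (b n)) ->
  (forall n, comp (b n) (a n.+1) = 0) ->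
  (forall n (h : hom (A n) (B n)), h = 0) -> exists n, comp (b n.+1) (a n) = 0.

Hypothesis acc : sub_acc.
Hypothesis dcc : torsion_dcc.

Variable TT : (C -> Prop) -> Prop.
Hypothesis TT_torsion : forall T, TT T -> torsion_class T.
Hypothesis TT_total : forall T T', TT T -> TT T' -> subset T T' \/ subset T' T.
Hypothesis TT_zero : TT (@is_zero C).
Hypothesis TT_full : TT (fun=> True).

Definition semistable X : Prop := forall T, TT T -> T X \/ right_orth T X.

(** A candidate for the last factor of a filtration of Y: the quotient by a proper torsion
    subobject. A semistable one is found by enlarging the subobject. *)
Record quotient_step Y := QuotientStep {
  qs_class : C -> Prop;
  qs_sub : C;
  qs_quo : C;
  qs_mono : hom qs_sub Y;
  qs_epi : hom Y qs_quo;
  qs_TT : TT qs_class;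
  qs_torsion : qs_class qs_sub;
  qs_free : right_orth qs_class qs_quo;
  qs_exact : short_exact qs_mono qs_epi;
  qs_proper : ~ qs_class Y }.

(** A class T of the chain that cuts the quotient must contain [qs_class]. Its torsion part of Y is
    strictly larger, yet proper, since otherwise T would contain the whole quotient. *)
Lemma quotient_step_next Y (s : quotient_step Y) : ~ semistable (qs_quo s) ->
  exists s' : quotient_step Y,
    comp (qs_epi s') (qs_mono s) = 0 /\ comp (qs_epi s) (qs_mono s') <> 0.
Proof.
move=> /existsNP[T /not_implyP[hT /not_orP[nT nF]]].
have [A [B [a [b [tA fB ab]]]]] := (TT_torsion hT).2 Y.
have tor := TT_torsion hT.
have nY : ~ T Y by move=> tY; apply: nT; apply: (torsion_epi tor) (ses_epi (qs_exact s)) tY.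
have sT : subset (qs_class s) T.
  have [//|/right_orth_sub h] := TT_total (qs_TT s) hT.
  by case: nF; apply: h; apply: qs_free.
exists (QuotientStep hT tA fB ab nY); split=> /=.
  by apply: fB; apply: sT; apply: qs_torsion.
move=> ba0; apply: nF => W tW f.
have [g gE] := ses_desc ab ba0.
have [|h hE] := ses_desc (qs_exact s) (f := b).
  by apply: fB; apply: sT; apply: qs_torsion.
have gh : comp g h = idm _.
  by apply: (epi_inj (ses_epi (qs_exact s))); rewrite -compA hE gE comp1f.
by rewrite -[f]comp1f -gh -compA (fB _ tW (comp h f)) compf0.
Qed.

Lemma quotient_step_zero Y : ~ is_zero Y -> exists s : quotient_step Y, True.
Proof.
move=> nY; have [Z zZ] := zero_object images Y.
unshelve eexists; last by [].
apply: (@QuotientStep Y (@is_zero C) Z Y 0 (idm Y)) => //; last exact: ses_id_l.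
by move=> A zA f; apply: hom_from_zero.
Qed.

Lemma iterate_choice (D : Type) (P : D -> D -> Prop) (x : D) :
  (forall y, exists z, P y z) -> exists f : nat -> D, f 0%N = x /\ forall n, P (f n) (f n.+1).
Proof.
by move=> /choice[g gP]; exists (fun n => iter n g x); split.
Qed.

Lemma semistable_quotient Y : ~ is_zero Y ->
  exists s : quotient_step Y, semistable (qs_quo s).
Proof.
move=> nY; apply: contrapT => /forallNP ns.
have [s _] := quotient_step_zero nY.
have [f [_ fP]] := iterate_choice s (fun s => quotient_step_next (ns s)).
have [|n h] := acc (fun n => qs_exact (f n)); first by move=> n; case: (fP n).
by case: (fP n) => _; apply.
Qed.

(** Decreasing phases are expressed by separating classes. The bound T on the factors serves the
    induction: when a factor B outside T' is put on top of a filtration inside T', the class T'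
    separates B from all earlier factors. *)
Definition hn_filtered T Y : Prop := exists (n : nat) (F G : nat -> C),
  [/\ is_zero (F 0%N), F n = Y,
      forall m, (m < n)%N -> [/\ semistable (G m), ~ is_zero (G m), T (G m)
        & exists (i : hom (F m) (F m.+1)) (p : hom (F m.+1) (G m)), short_exact i p]
    & forall l m, (l < m)%N -> (m < n)%N ->
        exists T', [/\ TT T', T' (G l) & ~ T' (G m)]].

Lemma hn_filtered_zero T Y : is_zero Y -> hn_filtered T Y.
Proof. by move=> zY; exists 0%N, (fun=> Y), (fun=> Y); split. Qed.

Lemma hn_filtered_extend T T' A Y B (a : hom A Y) (b : hom Y B) :
  TT T' -> subset T' T -> short_exact a b -> hn_filtered T' A ->
  semistable B -> ~ is_zero B -> T B -> ~ T' B -> hn_filtered T Y.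
Proof.
move=> hT' sT ab [n [F [G [zF FA step dec]]]] ssB nB tB nT'B.
exists n.+1, (fun m => if (m <= n)%N then F m else Y), (fun m => if (m < n)%N then G m else B).
split=> //; first by rewrite ltnn.
- move=> m; rewrite ltnS => le_mn; rewrite le_mn; case: ltnP => [lt_mn|le_nm].
    by have [h1 h2 h3 h4] := step m lt_mn; split=> //; apply: sT.
  have -> : m = n by apply/eqP; rewrite eqn_leq le_mn.
  by split=> //; rewrite FA; exists a, b.
- move=> l m lt_lm; rewrite ltnS => le_mn; have lt_ln := leq_trans lt_lm le_mn.
  rewrite lt_ln; case: ltnP => [lt_mn|_]; first exact: dec.
  by exists T'; have [_ _ ? _] := step l lt_ln.
Qed.

Record sub_state X := SubState {
  ss_class : C -> Prop;
  ss_sub : C;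
  ss_quo : C;
  ss_mono : hom ss_sub X;
  ss_epi : hom X ss_quo;
  ss_TT : TT ss_class;
  ss_torsion : ss_class ss_sub;
  ss_free : right_orth ss_class ss_quo;
  ss_exact : short_exact ss_mono ss_epi;
  ss_bad : ~ hn_filtered ss_class ss_sub }.

(** Peel off a semistable quotient. The kernel stays bad, and by [third_iso] it is again a torsion
    subobject of the fixed object X, for a smaller class, so that [torsion_dcc] applies to the
    iteration. *)
Lemma sub_state_next X (s : sub_state X) : exists s' : sub_state X,
  comp (ss_epi s) (ss_mono s') = 0 /\ comp (ss_epi s') (ss_mono s) <> 0.
Proof.
have nY : ~ is_zero (ss_sub s).
  by move=> zY; apply: (@ss_bad _ s); apply: hn_filtered_zero.
have [q ssq] := semistable_quotient nY.
have sT : subset (qs_class q) (ss_class s).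
  have [//|h] := TT_total (qs_TT q) (ss_TT s).
  by case: (@qs_proper _ q); apply: h; apply: ss_torsion.
have tB : ss_class s (qs_quo q).
  apply: (torsion_epi (TT_torsion (ss_TT s))) (ses_epi (qs_exact q)) _; exact: ss_torsion.
have nB : ~ is_zero (qs_quo q).
  move=> zB; apply: (@qs_proper _ q).
  have [h _ _] := ext_closed_torsion (TT_torsion (qs_TT q)).
  by apply: h (qs_torsion q); apply: (ses_zero_iso_r (qs_exact q)).
have nT : ~ qs_class q (qs_quo q) by move=> tq; apply: nB; apply: (orth_zero tq); apply: qs_free.
have [B' [r [j' [q' [s1 s2]]]]] := third_iso images (qs_exact q) (ss_exact s).
have fB' : right_orth (qs_class q) B'.
  apply: (right_orth_ses s2); first exact: qs_free.
  by apply: right_orth_sub sT _ _; apply: ss_free.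
have bad : ~ hn_filtered (qs_class q) (qs_sub q).
  move=> h; apply: (@ss_bad _ s).
  exact: hn_filtered_extend (qs_TT q) sT (qs_exact q) h ssq nB tB nT.
exists (SubState (qs_TT q) (qs_torsion q) fB' s1 bad); split=> /=.
  by rewrite compA (ses_comp0 (ss_exact s)) comp0f.
move=> e; have [h hE] := ses_lift s1 e.
have ah : comp (qs_mono q) h = idm (ss_sub s).
  by apply: (mono_inj (ses_mono (ss_exact s))); rewrite compA hE compf1.
apply: nB; apply: (epi0 (ses_epi (qs_exact q))).
by rewrite -[qs_epi q]compf1 -ah compA (ses_comp0 (qs_exact q)) comp0f.
Qed.

Lemma hn_filtered_all X : hn_filtered (fun=> True) X.
Proof.
apply: contrapT => bad; have [Z zZ] := zero_object images X.
have s : sub_state X.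
  apply: (@SubState X (fun=> True) X Z (idm X) 0) => //; last exact: ses_id_r.
  exact: right_orth_zero.
have [f [_ fP]] := iterate_choice s (@sub_state_next X).
have [||n h] := dcc (fun n => ss_exact (f n)).
- by move=> n; case: (fP n).
- by move=> n h; apply: (@ss_free _ (f n)); apply: ss_torsion.
- by case: (fP n) => _; apply.
Qed.

Definition phase_of X : (C -> Prop) -> Prop := fun T => TT T /\ T X.

(* A semistable object cuts the chain TT into the classes that contain it and
   those to which it is right orthogonal; this cut is its phase. *)
Definition phase : Type := {p : (C -> Prop) -> Prop |
  exists X, [/\ ~ is_zero X, semistable X & p = phase_of X]}.

Definition mk_phase X (nX : ~ is_zero X) (sX : semistable X) : phase :=
  exist _ (phase_of X) (ex_intro _ X (And3 nX sX erefl)).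

Lemma phase_eq (p q : phase) : sval p = sval q -> p = q.
Proof.
case: p q => [p hp] [q hq] /= e; case: q / e hq => hq.
by rewrite (Prop_irrelevance hp hq).
Qed.

(** Objects of higher phase lie in more classes of the chain. *)
Definition phase_le (p q : phase) : Prop := subset (sval p) (sval q).

Lemma phase_up (p : phase) T T' : sval p T -> TT T' -> subset T T' -> sval p T'.
Proof. by have [X [_ _ ->]] := svalP p => -[_ TX] hT' /(_ _ TX). Qed.

Lemma phase_TT (p : phase) T : sval p T -> TT T.
Proof. by have [X [_ _ ->]] := svalP p => -[]. Qed.

Lemma phase_total (p q : phase) : phase_le p q \/ phase_le q p.
Proof.
have [|/existsNP[T /not_implyP[pT nqT]]] := pselect (phase_le p q); [by left|right].
move=> T' qT'; apply: (phase_up pT (phase_TT qT')).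
have [//|h] := TT_total (phase_TT pT) (phase_TT qT').
by case: nqT; apply: phase_up qT' (phase_TT pT) h.
Qed.

Definition phase_order : linear_order.
Proof.
refine (@LinearOrder phase phase_le _ _ _ phase_total) => [p //|p q pq qp|p q r pq qr T /pq/qr//].
by apply/phase_eq/funext => T; apply/propext; split; [exact: pq|exact: qp].
Defined.

(* Zero objects have no phase but belong to every part, hence this formulation
   instead of [phase_of X = sval p]. *)
Definition phase_part (p : phase) : C -> Prop :=
  fun X => forall T, TT T -> (sval p T -> T X) /\ (~ sval p T -> right_orth T X).

Lemma phase_part_semistable p X : phase_part p X -> semistable X.
Proof.
move=> pX T hT; have [h1 h2] := pX T hT.
by have [/h1|/h2] := pselect (sval p T); [left|right].
Qed.

Lemma mk_phase_part X (nX : ~ is_zero X) (sX : semistable X) : phase_part (mk_phase nX sX) X.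
Proof.
move=> T hT; split=> [[]//|n]; have [tX|//] := sX T hT.
by case: n.
Qed.

Lemma phase_partE p X : phase_part p X -> ~ is_zero X -> sval p = phase_of X.
Proof.
move=> pX nX; apply/funext => T; apply/propext; split.
  by move=> pT; have hT := phase_TT pT; split=> //; have [+ _] := pX T hT; apply.
move=> [hT tX]; have [_ h] := pX T hT; apply: contrapT => /h oX.
exact/nX/(orth_zero tX).
Qed.

Lemma phase_part_ext p : ext_closed (phase_part p).
Proof.
split.
- move=> A B f fi pA T hT; have [h1 h2] := pA T hT.
  have [t _ _] := ext_closed_torsion (TT_torsion hT).
  have [o _ _] := ext_closed_right_orth T.
  by split=> [/h1|/h2]; [apply: t fi|apply: o fi].
- move=> A zA T hT; have [_ t _] := ext_closed_torsion (TT_torsion hT).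
  by split=> _; [apply: t|apply: right_orth_zero].
- move=> A E B i p' ip pA pB T hT; have [h1 h2] := pA T hT; have [k1 k2] := pB T hT.
  have [_ _ t] := ext_closed_torsion (TT_torsion hT).
  split=> h; first by apply: t ip (h1 h) (k1 h).
  by apply: right_orth_ses ip (h2 h) (k2 h).
Qed.

Lemma phase_part_nonzero (p : phase) : exists2 X, phase_part p X & ~ is_zero X.
Proof.
have [X [nX sX e]] := svalP p; exists X => // T hT; rewrite e.
split=> [[]//|n]; have [tX|//] := sX T hT.
by case: n.
Qed.

Lemma phase_part_hom (p' p'' : phase_order) : lo_lt p'' p' ->
  forall A B, phase_part p' A -> phase_part p'' B -> forall f : hom A B, f = 0.
Proof.
move=> [le ne] A B pA pB f.
have [T [p'T np''T]] : exists T, sval p' T /\ ~ sval p'' T.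
  apply: contrapT => /forallNP n; apply: ne; apply: (lo_anti le) => T p'T.
  by have /not_andP[//|/contrapT] := n T.
have hT := phase_TT p'T; have [tA _] := pA T hT; have [_ fB] := pB T hT.
exact: fB np''T _ (tA p'T) f.
Qed.

Lemma phase_filtration X : ~ is_zero X ->
  exists (n : nat) (F G : nat -> C) (phi : nat -> phase_order),
    [/\ is_zero (F 0%N), F n = X,
        forall m, (m < n)%N ->
          [/\ phase_part (phi m) (G m), ~ is_zero (G m)
            & exists (i : hom (F m) (F m.+1)) (p : hom (F m.+1) (G m)),
                short_exact i p]
      & forall l m, (l < m)%N -> (m < n)%N -> lo_lt (phi m) (phi l)].
Proof.
move=> nX; have [n [F [G [zF FX step dec]]]] := hn_filtered_all X.
case: n => [|n] in FX step dec *; first by rewrite -FX in nX.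
have [ss0 nG0 _ _] := step 0%N isT.
have [phi phiP] : exists phi : nat -> phase, forall m, (m < n.+1)%N -> sval (phi m) = phase_of (G m).
  have /choice[phi phiP] : forall m, exists p : phase, (m < n.+1)%N -> sval p = phase_of (G m).
    (* Beyond the end of the filtration the phase of [G 0] is a default value. *)
    move=> m; have [lt_m|_] := boolP (m < n.+1)%N; last by exists (mk_phase nG0 ss0).
    by have [ss nG _ _] := step m lt_m; exists (mk_phase nG ss).
  by exists phi.
exists n.+1, F, G, phi; split=> // [m lt_m|l m lt_lm lt_m].
  have [ss nG _ ex] := step m lt_m; split=> //.
  have -> : phi m = mk_phase nG ss by apply: phase_eq; rewrite phiP.
  exact: mk_phase_part.
have [T' [hT' tl ntm]] := dec l m lt_lm lt_m.
have lt_l := ltn_trans lt_lm lt_m.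
have pl : sval (phi l) T' by rewrite phiP.
have pm : ~ sval (phi m) T' by rewrite phiP // => -[].
have [h|h] := phase_total (phi l) (phi m); first by case: pm; apply: h.
by split=> // e; apply: pm; rewrite e.
Qed.

Definition chain_stability : stability_data C :=
  @StabilityData C phase_order phase_part phase_part_ext phase_part_nonzero
    phase_part_hom phase_filtration.

End ChainStability.

(** * Finest refinements *)

Section FinestRefinement.
Variable C : preadd_cat.
Hypothesis images : has_images C.
Hypothesis acc : sub_acc C.
Hypothesis dcc : torsion_dcc C.

(** Being a torsion class is built into the relation, so that every member of a chain, compared with
    itself, is one. *)
Definition torsion_le (T T' : C -> Prop) : Prop :=
  [/\ torsion_class T, torsion_class T' & subset T T'].

Definition base_chain (S : stability_data C) : (C -> Prop) -> Prop := fun T =>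
  [\/ T = @is_zero C, T = (fun=> True) | exists2 I, upper I & T = @upper_class C S I].

Lemma base_chain_torsion S T : base_chain S T -> torsion_class T.
Proof.
case=> [->|->|[I uI ->]]; [exact: torsion_class_zero|exact: torsion_class_full|].
exact: torsion_upper_class.
Qed.

Lemma torsion_zero_sub T : torsion_class T -> subset (@is_zero C) T.
Proof. by move=> /ext_closed_torsion[_ h _] A /h. Qed.

Lemma base_chain_chain S : chain torsion_le (base_chain S).
Proof.
move=> T T' bT bT'; have hT := base_chain_torsion bT; have hT' := base_chain_torsion bT'.
case: bT => [eT|eT|[I uI eT]].
- by left; split=> //; rewrite eT; apply: torsion_zero_sub.
- by right; split=> //; rewrite eT.
case: bT' => [eT'|eT'|[J uJ eT']].
- by right; split=> //; rewrite eT'; apply: torsion_zero_sub.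
- by left; split=> //; rewrite eT'.
have [IJ|JI] := upper_total uI uJ; [left|right]; split=> //; rewrite eT eT'; exact: upper_class_mono.
Qed.

Section Maximal.
Variables (S : stability_data C) (TT : (C -> Prop) -> Prop).
Hypothesis base_TT : subset (base_chain S) TT.
Hypothesis chain_TT : chain torsion_le TT.
Hypothesis max_TT : forall T, chain torsion_le (extend TT T) -> TT T.

Lemma TT_torsion T : TT T -> torsion_class T.
Proof. by move=> hT; case: (chain_TT hT hT) => -[]. Qed.

Lemma TT_total T T' : TT T -> TT T' -> subset T T' \/ subset T' T.
Proof. by move=> hT hT'; case: (chain_TT hT hT') => -[]; [left|right]. Qed.

Lemma TT_zero : TT (@is_zero C). Proof. by apply: base_TT; apply: Or31. Qed.
Lemma TT_full : TT (fun=> True). Proof. by apply: base_TT; apply: Or32. Qed.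

Lemma TT_upper (I : sd_index S -> Prop) : upper I -> TT (upper_class I).
Proof. by move=> uI; apply: base_TT; apply: Or33; exists I. Qed.

Definition maximal_stability : stability_data C :=
  chain_stability images acc dcc TT_torsion TT_total TT_zero TT_full.

(** The class above phi contains X, hence Y because p is below q; but if psi were not above phi, Y
    would be right orthogonal to that class. *)
Lemma phase_part_le (p q : phase TT) X Y (phi psi : sd_index S) :
  phase_le p q -> phase_part p X -> phase_part q Y -> ~ is_zero X -> ~ is_zero Y ->
  sd_part phi X -> sd_part psi Y -> lo_le phi psi.
Proof.
move=> pq pX qY nX nY sX sY; apply: contrapT => nle.
have hT := TT_upper (@upper_above _ phi).
have tX : upper_class (above phi) X by have [] := part_slice sX.
have qT : sval q (upper_class (above phi)).
  apply: pq; rewrite (phase_partE pX nX); split=> //.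
have tY : upper_class (above phi) Y by have [+ _] := qY _ hT; apply.
by apply: nY; apply: (orth_zero tY); apply: part_right_orth_upper sY.
Qed.

Lemma phase_part_ex (p : phase TT) X : phase_part p X -> ~ is_zero X ->
  exists phi : sd_index S, sd_part phi X.
Proof.
move=> pX nX; apply: semistable_part => // I uI.
by apply: (phase_part_semistable pX); apply: TT_upper.
Qed.

Lemma phase_part_sub (p : phase TT) : exists phi : sd_index S,
  subset (phase_part p) (sd_part phi).
Proof.
have [X pX nX] := phase_part_nonzero p; have [phi sX] := phase_part_ex pX nX.
exists phi => Y pY; have [zY|nY] := pselect (is_zero Y).
  by have [_ h _] := sd_ext phi; apply: h.
have [psi sY] := phase_part_ex pY nY.
suff -> : phi = psi by [].
by apply: lo_anti; [apply: (phase_part_le _ pX pY)|apply: (phase_part_le _ pY pX)].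
Qed.

Lemma maximal_finer : finer maximal_stability S.
Proof.
have [r rP] := choice phase_part_sub.
have r_le (p q : phase TT) : phase_le p q -> lo_le (r p) (r q).
  move=> pq; have [X pX nX] := phase_part_nonzero p; have [Y qY nY] := phase_part_nonzero q.
  exact: (phase_part_le pq pX qY nX nY (rP _ _ pX) (rP _ _ qY)).
(* The maps from A to X and from X to B give [r p] <= phi <= [r q], while q <= p gives the reverse
   inequality. *)
have r_eq (phi : sd_index S) X : sd_part phi X ->
    forall (p q : phase TT) A B (f : hom A X) (g : hom X B),
    phase_part p A -> phase_part q B -> f <> 0 -> g <> 0 -> phase_le q p ->
    r p = phi /\ r q = phi.
  move=> sX p q A B f g pA qB nf ng qp.
  have h1 := part_index_le (rP _ _ pA) sX nf.
  have h2 := part_index_le sX (rP _ _ qB) ng.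
  have h3 := r_le _ _ qp.
  by split; apply: lo_anti => //; [apply: lo_trans h3|apply: lo_trans h1].
exists r; split=> [phi|p q [le _]|phi X].
- have [X sX nX] := sd_nonzero phi.
  have [p [q [qp [A [f [pA nf]]] [B [g [qB ng]]] _]]] := hn_ends maximal_stability nX.
  by exists p; have [] := r_eq phi X sX p q A B f g pA qB nf ng qp.
- exact: r_le.
split=> [sX|]; last first.
  move=> /(_ (sd_part phi)); apply; first exact: sd_ext.
    exact: summand_closed_part.
  by move=> B [p <-]; apply: rP.
move=> Q eQ sQ hQ; have [Q1 Q2 Q3] := eQ.
have [zX|nX] := pselect (is_zero X); first exact: Q2.
have [n [F [G [f [zF FX step dec]]]]] := @sd_filtration _ maximal_stability _ nX.
case: n => [|n] in FX step dec *; first by rewrite -FX in nX.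
have [|[a na] [b nb]] := @filtration_ends _ n F G zF.
  by move=> m /step[_ nG h].
rewrite FX in a na b nb; have [p0 _ _] := step 0%N isT; have [pn _ _] := step n (leqnn _).
have f_le l m : (l <= m)%N -> (m < n.+1)%N -> phase_le (f m) (f l).
  rewrite leq_eqVlt => /orP[/eqP -> _ //|lm lt_m]; by have [] := dec l m lm lt_m.
have [e0 en] := r_eq phi X sX _ _ _ _ _ _ p0 pn na nb (f_le 0%N n (leq0n n) (leqnn _)).
have fE m : (m < n.+1)%N -> r (f m) = phi.
  move=> lt_m; apply: lo_anti.
    by rewrite -e0; apply/r_le/f_le.
  by rewrite -en; apply/r_le/f_le.
rewrite -FX; have: (n.+1 <= n.+1)%N by [].
elim: {1 3}(n.+1) => [_|m IHm lt_m]; first exact: Q2.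
have [pG nG [i [p ip]]] := step m lt_m.
apply: Q3 ip (IHm (ltnW lt_m)) _; apply: hQ; exists (f m) => //; exact: fE.
Qed.

(** Every class of TT is an upper class of the finer data S', so every upper class of S' is
    comparable with all of TT and belongs to TT by maximality. Hence TT already separates the parts
    of S', and r is injective. *)
Lemma maximal_finest : finest maximal_stability.
Proof.
move=> S' [r [r_surj r_mono r_gen]].
have r_le psi psi' : lo_le psi psi' -> phase_le (r psi) (r psi').
  move=> le; have [->|ne] := pselect (psi = psi'); first by [].
  exact: r_mono.
have part_sub psi : subset (sd_part psi) (phase_part (r psi)).
  move=> A pA; apply/(r_gen (r psi) A) => Q _ _; apply; by exists psi.
(* The phases of S' whose parts lie in T; the remaining parts are right orthogonal to T. *)
pose J T : sd_index S' -> Prop := fun psi => sval (r psi) T.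
have upJ T : upper (J T) by move=> psi psi' /r_le; apply.
have TT_J T : TT T -> T = upper_class (J T).
  move=> hT; apply: torsion_class_eq; first exact: TT_torsion.
  - exact: torsion_upper_class.
  - move=> X tX B [psi nJ pB] f.
    by have [_ /(_ nJ)] := part_sub _ _ pB T hT; apply.
  - move=> Y fY; rewrite upper_classE //; move=> A tA f; apply: tA => B [psi jpsi pB] g.
    by apply: fY; have [+ _] := part_sub _ _ pB T hT; apply.
have TT_upper' (I : sd_index S' -> Prop) : upper I -> TT (upper_class I).
  move=> uI; apply: max_TT => T T'.
  have tI := torsion_upper_class images uI.
  have cmp T1 : TT T1 -> torsion_le T1 (upper_class I) \/ torsion_le (upper_class I) T1.
    move=> hT1; have t1 := TT_torsion hT1; rewrite (TT_J T1 hT1) in t1 *.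
    have [h|h] := upper_total (upJ T1) uI; [left|right]; split=> //; exact: upper_class_mono.
  move=> [hT|->] [hT'|->]; [exact: chain_TT|exact: cmp| |by left; split].
  by have [] := cmp T' hT'; [right|left].
(* The class above psi' is in TT, contains the part psi' and is orthogonal to the part psi, so the
   two cannot share a phase of TT. *)
have r_inj_lt psi psi' : lo_lt psi psi' -> r psi <> r psi'.
  move=> lt e; have hT := TT_upper' _ (@upper_above _ psi').
  have [A pA nA] := sd_nonzero psi'; have [B pB nB] := sd_nonzero psi.
  have [tA _] := part_slice pA.
  have rT : sval (r psi') (upper_class (above psi')).
    by rewrite (phase_partE (part_sub _ _ pA) nA); split.
  have [/(_ _)tB _] := part_sub _ _ pB _ hT; apply: nB; apply: (@orth_zero _ (upper_class (above psi'))).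
    by apply: tB; rewrite e.
  by apply: part_right_orth_upper pB; apply: lt_not_le.
have r_inj : injective r.
  move=> psi psi' e; apply: contrapT => ne.
  have [le|le] := lo_total psi psi'; first exact: (r_inj_lt psi psi').
  by apply: (r_inj_lt psi' psi) => //; split=> // /esym.
have [s sK] := choice r_surj.
exists r; split.
- by exists s => // psi; apply: r_inj; rewrite sK.
- exact: r_le.
move=> psi A; split; last exact: part_sub.
move=> /r_gen; apply; [exact: sd_ext|exact: summand_closed_part|].
by move=> B [psi' /r_inj ->].
Qed.

End Maximal.

Theorem finest_refinement (S : stability_data C) :
  exists T : stability_data C, finest T /\ finer T S.
Proof.
have [TT [base cTT maxTT]] := maximal_chain (@base_chain_chain S).
exists (maximal_stability base cTT); split; first exact: maximal_finest.
exact: maximal_finer.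
Qed.

End FinestRefinement.

(** * The graded algebra S *)

Section Degrees.
Variables (k : fieldType) (X : weighted_line k).
Local Notation I := 'I_(npts X).
Local Notation L := (Lgrp X).

Definition cdeg : L := Lgen (ord0 : I) *+ wt (ord0 : I).

Lemma pi_quot_sum (z : I -> int) :
  \sum_i Lgen i *~ z i = \pi_(Quotient.quot (@Lrel k X)) (\sum_i free_gen i *~ z i).
Proof.
rewrite raddf_sum; apply: eq_bigr => i _.
by rewrite raddfMz.
Qed.

Lemma free_gen_coord (z : I -> int) (i : I) : (\sum_j free_gen j *~ z j) 0 i = z i.
Proof.
rewrite summxE (bigD1 i) //= big1 ?addr0 => [|j ne].
  by rewrite -scaler_int !mxE !eqxx mulr1 intz.
by rewrite -scaler_int !mxE eq_sym (negbTE ne) mulr0.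
Qed.

Lemma Lgen_sum_eq0 (z : I -> int) : \sum_i Lgen i *~ z i = 0 ->
  exists a : I -> int, (forall i, z i = (wt i)%:Z * a i) /\ \sum_i a i = 0.
Proof.
rewrite pi_quot_sum -(raddf0 \pi_(Quotient.quot (@Lrel k X))) => /eqP.
rewrite -Quotient.idealrBE subr0 => /asboolP[a e].
(* Every relation subtracts p_1 x_1; the first coefficient collects these contributions, which makes
   the total vanish. *)
exists (fun i => a i - (if i == ord0 then \sum_j a j else 0)); split; last first.
  by rewrite sumrB -big_mkcond /= big_pred1_eq subrr.
move=> i; have := congr1 (fun r : 'rV[int]_(npts X) => r 0 i) e.
rewrite /= free_gen_coord => ->.
rewrite summxE (eq_bigr (fun j => (if j == i then (wt i)%:Z * a i else 0) -
   (if i == ord0 then (wt i)%:Z * a j else 0))) => [|j _].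
  rewrite sumrB -big_mkcond /= big_pred1_eq mulrBr; congr (_ - _).
  by case: (i == ord0); rewrite ?mulr_sumr // big1 ?mulr0.
rewrite -scaler_int -!scaler_nat !mxE !eqxx /= intz !natz mulrBr [j == i]eq_sym.
case: eqP => [->|_]; case: eqP => [->|_];
  by rewrite ?mulr1 ?mulr0 ?subr0 // mulrC.
Qed.

Lemma Lgen_wt (i : I) : Lgen i *+ wt i = cdeg.
Proof.
apply/eqP; rewrite /cdeg /Lgen -!raddfMn -Quotient.idealrBE.
apply/asboolP; exists (fun j => (j == i)%:Z).
rewrite (bigD1 i) //= eqxx mulr1z big1 ?addr0 // => j /negbTE ->.
by rewrite mulr0z.
Qed.

Lemma Lgrp_gen (d : L) : exists z : I -> int, d = \sum_i Lgen i *~ z i.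
Proof.
exists (fun i => (repr d) 0 i); rewrite pi_quot_sum -[LHS]reprK; congr (\pi _).
by apply/rowP => i; rewrite free_gen_coord.
Qed.

Lemma Lgrp_normal (d : L) : exists (a : I -> nat) (z : int),
  (forall i, a i < wt i)%N /\ d = \sum_i Lgen i *+ a i + cdeg *~ z.
Proof.
have [z ->] := Lgrp_gen d.
exists (fun i => `|(z i %% (wt i)%:Z)%Z|%N), (\sum_i (z i %/ (wt i)%:Z)%Z).
have w0 i : (wt i)%:Z != 0 by rewrite eqz_nat -lt0n wt_gt0.
split=> [i|].
  by rewrite -ltz_nat gez0_abs ?modz_ge0 // ltz_pmod // ltz_nat wt_gt0.
rewrite mulrz_sumr -big_split; apply: eq_bigr => i _ /=.
rewrite -(Lgen_wt i) [_ *+ `|_|%N]pmulrn gez0_abs ?modz_ge0 // pmulrn -mulrzA -mulrzDr.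
by rewrite addrC mulrC -divz_eq.
Qed.

Lemma cdeg_eq0 (z : int) : cdeg *~ z = 0 -> z = 0.
Proof.
move=> e; have [|a [aE sa]] := @Lgen_sum_eq0 (fun i => if i == ord0 then (wt (ord0 : I))%:Z * z else 0).
  rewrite (bigD1 ord0) //= big1 ?addr0 => [|i /negbTE ->]; last by rewrite mulr0z.
  by rewrite mulrzA -pmulrn.
have a0 i : i != ord0 -> a i = 0.
  move=> ne; have := aE i; rewrite (negbTE ne) => /esym/eqP.
  by rewrite mulf_eq0 eqz_nat gtn_eqF ?wt_gt0 //= => /eqP.
move: sa; rewrite (bigD1 ord0) //= big1 ?addr0 => [a00|i /a0 //].
have := aE ord0; rewrite eqxx a00 mulr0 => /eqP.
by rewrite mulf_eq0 eqz_nat gtn_eqF ?wt_gt0 //= => /eqP.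
Qed.

Lemma cdeg_inj (m n : nat) : cdeg *+ m = cdeg *+ n -> m = n.
Proof.
move=> e; have /cdeg_eq0/eqP : cdeg *~ (m%:Z - n%:Z) = 0 by rewrite mulrzBr -!pmulrn e subrr.
by rewrite subr_eq0 eqz_nat => /eqP.
Qed.

(** Monomials of equal degree differ by trading factors x_i^p_i for x_j^p_j. This is the source of
    the normal form of homogeneous elements. *)
Lemma mdegL_eq (m m' : 'X_{1..npts X}) : mdegL m = mdegL m' ->
  (forall i : I, m i = m' i %[mod wt i])%N /\
  (\sum_(i : I) m i %/ wt i = \sum_(i : I) m' i %/ wt i)%N.
Proof.
move=> e; have [|a [aE sa]] := @Lgen_sum_eq0 (fun i => (m i)%:Z - (m' i)%:Z).
  rewrite (eq_bigr (fun i => Lgen i *+ m i - Lgen i *+ m' i)) => [|i _].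
    by rewrite sumrB; apply/eqP; rewrite subr_eq0; apply/eqP.
  by rewrite mulrzBr !pmulrn.
have mE i : (m i)%:Z = (m' i)%:Z + a i * (wt i)%:Z.
  by rewrite [a i * _]mulrC -aE addrC subrK.
have w0 i : (wt i)%:Z != 0 by rewrite eqz_nat -lt0n wt_gt0.
split=> [i|]; first by apply/eqP; rewrite -eqz_nat -!modz_nat mE addrC modzMDl.
apply/eqP; rewrite -eqz_nat -!natz !natr_sum -subr_eq0 -sumrB -{2}sa; apply/eqP.
apply: eq_bigr => i _; rewrite !natz -!divz_nat mE [X in (X %/ _)%Z]addrC divzMDl // addrK //.
Qed.

(** Adding c would give a vanishing combination with nonnegative coefficients, the first one
    positive, against the sum condition of [Lgen_sum_eq0]. Thus S is zero in degree -c. *)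
Lemma mdegL_negc (m : 'X_{1..npts X}) : mdegL m <> - cdeg.
Proof.
move=> e; have [|a [aE sa]] := @Lgen_sum_eq0 (fun i => (m i + (i == ord0) * wt i)%N%:Z).
  rewrite (eq_bigr (fun i => Lgen i *+ m i + (if i == ord0 then cdeg else 0))) => [|i _].
    by rewrite big_split /= -big_mkcond big_pred1_eq -/(mdegL m) e addNr.
  rewrite -pmulrn mulrnDr; congr (_ + _).
  by case: eqP => [->|_]; rewrite ?mul1n ?mul0n.
have w0 (i : I) : 0 < (wt i)%:Z :> int by rewrite ltz_nat wt_gt0.
have a_ge0 i : 0 <= a i by rewrite -(pmulr_rge0 _ (w0 i)) -aE.
have: 0 < \sum_i a i.
  rewrite (bigD1 ord0) //= ltr_pwDl ?sumr_ge0 //.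
  by rewrite -(pmulr_rgt0 _ (w0 ord0)) -aE eqxx mul1n ltz_nat addn_gt0 wt_gt0 orbT.
by rewrite sa ltxx.
Qed.

End Degrees.

(** * Homogeneous elements as monomials times binary forms in u and v *)

Section Elements.
Variables (k : fieldType) (X : weighted_line k).
Local Notation I := 'I_(npts X).
Local Notation S := (Salg X).
Local Notation P := {mpoly k[npts X]}.
Local Notation cdeg := (cdeg X).

Definition sproj : P -> S := fun p => \pi_({ideal_quot @wl_ideal k X}) p.

Fact sproj_zmod : zmod_morphism sproj.
Proof. by move=> p q; rewrite /sproj raddfB. Qed.
Fact sproj_monoid : monoid_morphism sproj.
Proof. by split=> [|p q]; rewrite /sproj ?rmorph1 ?rmorphM. Qed.
HB.instance Definition _ := GRing.isZmodMorphism.Build P S sproj sproj_zmod.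
HB.instance Definition _ := GRing.isMonoidMorphism.Build P S sproj sproj_monoid.

Definition scal : k -> S := fun c => sproj c%:MP.
Fact scal_zmod : zmod_morphism scal.
Proof. by move=> p q; rewrite /scal mpolyCB rmorphB. Qed.
Fact scal_monoid : monoid_morphism scal.
Proof. by split=> [|p q]; rewrite /scal ?rmorph1 // mpolyCM rmorphM. Qed.
HB.instance Definition _ := GRing.isZmodMorphism.Build k S scal scal_zmod.
HB.instance Definition _ := GRing.isMonoidMorphism.Build k S scal scal_monoid.

Definition xg (i : I) : S := sproj 'X_i.
Definition i1 : I := Ordinal (isT : (1 < npts X)%N).
Definition u : S := xg ord0 ^+ wt (ord0 : I).
Definition v : S := xg i1 ^+ wt i1.
Definition lin (a b : k) : S := scal a * u + scal b * v.

(* Coordinates of the linear form that vanishes at the i-th exceptional point: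
   u at infinity, and v - lambda u at lambda. *)
Definition xu (i : I) : k := if pt i is Some l then - l else 1.
Definition xv (i : I) : k := if pt i is Some _ then 1 else 0.

Lemma sproj_wl_eq (i : I) : (2 <= i)%N -> sproj (wl_eq i) = 0.
Proof.
move=> i2; apply/eqP; rewrite -[0](raddf0 sproj) /sproj -Quotient.idealrBE subr0.
apply/asboolP; exists (fun j => (j == i)%:R).
rewrite (bigD1 i) //= eqxx mul1r big1 ?addr0 // => j /andP[_ /negbTE ->].
by rewrite mul0r.
Qed.

Lemma xg_wt (i : I) : xg i ^+ wt i = lin (xu i) (xv i).
Proof.
rewrite /lin /xu /xv.
have [i2|] := leqP 2 i; last first.
  case: i => -[|[|//]] lt_i _.
    rewrite pt_first // rmorph1 rmorph0 mul1r mul0r addr0 /u.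
    by congr (xg _ ^+ wt _); apply: val_inj.
  rewrite pt_second // oppr0 rmorph1 rmorph0 mul1r mul0r add0r /v.
  by congr (xg _ ^+ wt _); apply: val_inj.
have := sproj_wl_eq i2; rewrite /wl_eq rmorphD rmorphB /= -mul_mpolyC rmorphM /= !rmorphXn /=.
rewrite -/(xg i) -/(xg ord0) -/(xg i1) -/u -/v.
case E : (pt i) => [l|] /=.
  rewrite rmorphN rmorph1 mul1r => /eqP; rewrite -addrA addr_eq0 opprD opprK => /eqP ->.
  by rewrite mulNr addrC.
have : pt i = pt (ord0 : I) by rewrite E pt_first.
by move/pt_inj => e; move: i2; rewrite e.
Qed.

Lemma sproj_monomial (m : 'X_{1..npts X}) : sproj 'X_[m] = \prod_i xg i ^+ m i.
Proof.
rewrite mpolyXE_id rmorph_prod; apply: eq_bigr => i _.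
by rewrite rmorphXn.
Qed.

Lemma sproj_sum (q : P) :
  sproj q = \sum_(m <- msupp q) scal q@_m * \prod_i xg i ^+ m i.
Proof.
rewrite {1}[q]mpolyE rmorph_sum; apply: eq_bigr => m _.
by rewrite -mul_mpolyC rmorphM /= sproj_monomial.
Qed.

Lemma S_repr (a : S) : exists q : P, a = sproj q.
Proof. by exists (repr a); rewrite /sproj reprK. Qed.

Lemma ShomogP d (q : P) : (forall m, m \in msupp q -> mdegL m = d) -> Shomog d (sproj q).
Proof. by move=> h; exists q. Qed.

Lemma mdegLD (m m' : 'X_{1..npts X}) : mdegL (m + m')%MM = mdegL m + mdegL m'.
Proof. by rewrite -big_split; apply: eq_bigr => i _; rewrite mnmDE mulrnDr. Qed.

Lemma Shomog_mul d d' (a b : S) : Shomog d a -> Shomog d' b -> Shomog (d + d') (a * b).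
Proof.
move=> [p -> hp] [q -> hq]; rewrite -(rmorphM sproj); apply: ShomogP => m.
move=> /msuppM_le /allpairsP[[m1 m2] /= [/hp <- /hq <- ->]].
exact: mdegLD.
Qed.

Lemma Shomog_add d (a b : S) : Shomog d a -> Shomog d b -> Shomog d (a + b).
Proof.
move=> [p -> hp] [q -> hq]; rewrite -(rmorphD sproj); apply: ShomogP => m.
by move=> /msuppD_le; rewrite mem_cat => /orP[/hp|/hq].
Qed.

Lemma Shomog0 d : Shomog d (0 : S).
Proof. by rewrite -(rmorph0 sproj); apply: ShomogP => m; rewrite msupp0. Qed.

Lemma Shomog_scal c : Shomog 0 (scal c).
Proof.
apply: ShomogP => m; rewrite msuppC; case: (c == 0) => //.
rewrite inE => /eqP ->; rewrite /mdegL big1 // => i _; by rewrite mnm0E mulr0n.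
Qed.

Lemma Shomog_scalM c d (a : S) : Shomog d a -> Shomog d (scal c * a).
Proof. by move=> h; rewrite -(add0r d); apply: Shomog_mul => //; apply: Shomog_scal. Qed.

Lemma Shomog_sum (T : Type) (s : seq T) (R : pred T) d (F : T -> S) :
  (forall i, R i -> Shomog d (F i)) -> Shomog d (\sum_(i <- s | R i) F i).
Proof. by move=> h; elim/big_ind: _ => //; [exact: Shomog0|exact: Shomog_add]. Qed.

Lemma Shomog_monomial (m : 'X_{1..npts X}) : Shomog (mdegL m) (\prod_i xg i ^+ m i).
Proof. by rewrite -sproj_monomial; apply: ShomogP => m'; rewrite msuppX inE => /eqP ->. Qed.

Lemma Shomog_xg i : Shomog (Lgen i) (xg i).
Proof.
apply: ShomogP => m; rewrite msuppX inE => /eqP ->; rewrite /mdegL (bigD1 i) //=.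
rewrite mnm1E eqxx mulr1n big1 ?addr0 // => j ne.
by rewrite mnm1E eq_sym (negbTE ne).
Qed.

Lemma Shomog_exp d (a : S) n : Shomog d a -> Shomog (d *+ n) (a ^+ n).
Proof.
move=> h; elim: n => [|n IHn]; last by rewrite exprS mulrS; apply: Shomog_mul.
by rewrite expr0 -(rmorph1 scal); apply: Shomog_scal.
Qed.

Lemma Shomog_lin a b : Shomog cdeg (lin a b).
Proof.
apply: Shomog_add; apply: Shomog_scalM.
  by apply: Shomog_exp; apply: Shomog_xg.
by rewrite -(Lgen_wt i1); apply: Shomog_exp; apply: Shomog_xg.
Qed.

Lemma Shomog_negc (a : S) : Shomog (- cdeg) a -> a = 0.
Proof.
move=> [q -> h]; rewrite -/(sproj q) sproj_sum big_seq big1 // => m /h.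
by move/mdegL_negc.
Qed.

Lemma linE a b c d x y : lin (x * a + y * c) (x * b + y * d) = scal x * lin a b + scal y * lin c d.
Proof. rewrite /lin !rmorphD !rmorphM /=; ring. Qed.

Lemma uE : u = lin 1 0. Proof. by rewrite /lin rmorph1 rmorph0 mul1r mul0r addr0. Qed.
Lemma vE : v = lin 0 1. Proof. by rewrite /lin rmorph1 rmorph0 mul1r mul0r add0r. Qed.

Lemma linZ x a b : lin (x * a) (x * b) = scal x * lin a b.
Proof. by rewrite /lin !rmorphM /= mulrDr !mulrA. Qed.

(** The determinant of two linear forms in u and v; for nonzero forms it vanishes exactly when they
    have the same zero on the projective line. *)
Definition dt (a b c d : k) : k := a * d - b * c.

Lemma dtC a b c d : dt a b c d = - dt c d a b.
Proof. by rewrite /dt; ring. Qed.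

Lemma lin_span a b c d e f : dt a b c d != 0 ->
  exists x y, lin e f = scal x * lin a b + scal y * lin c d.
Proof.
move=> nz; exists ((e * d - f * c) / dt a b c d), ((f * a - e * b) / dt a b c d).
rewrite -linE; congr lin; rewrite /dt in nz *; field; exact: nz.
Qed.

(* The homogenization of p in degree n; meaningful only when [size p <= n.+1]. *)
Definition hform (n : nat) (p : {poly k}) : S :=
  \sum_(j < n.+1) scal p`_j * (v ^+ j * u ^+ (n - j)).

Lemma hformD n p q : hform n (p + q) = hform n p + hform n q.
Proof. by rewrite -big_split; apply: eq_bigr => j _; rewrite coefD rmorphD mulrDl. Qed.

Lemma hform0 n : hform n 0 = 0.
Proof. by rewrite /hform big1 // => j _; rewrite coef0 rmorph0 mul0r. Qed.

Lemma hformZ n c p : hform n (c *: p) = scal c * hform n p.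
Proof.
by rewrite /hform mulr_sumr; apply: eq_bigr => j _; rewrite coefZ rmorphM -mulrA.
Qed.

Lemma lin_hform a b n (p : {poly k}) : (size p <= n.+1)%N ->
  lin a b * hform n p = hform n.+1 ((b *: 'X + a%:P) * p).
Proof.
move=> sp; have -> : (b *: 'X + a%:P) * p = b *: ('X * p) + a *: p.
  by rewrite mulrDl -scalerAl mul_polyC.
rewrite hformD !hformZ /lin mulrDl addrC -!mulrA.
congr (_ * _ + _ * _).
  rewrite /hform [RHS]big_ord_recl coefXM /= rmorph0 mul0r add0r mulr_sumr.
  apply: eq_bigr => j _; rewrite coefXM /= subSS exprS.
  by rewrite mulrCA !mulrA.
rewrite /hform [RHS]big_ord_recr /= nth_default // rmorph0 mul0r addr0 mulr_sumr.
apply: eq_bigr => j _; rewrite subSn -1?ltnS // exprS.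
by rewrite mulrCA; congr (_ * _); rewrite mulrCA.
Qed.

Lemma prod_lin_hform (al be : I -> k) (b : I -> nat) (s : seq I) :
  exists2 p : {poly k}, (size p <= (\sum_(i <- s) b i).+1)%N &
  \prod_(i <- s) lin (al i) (be i) ^+ b i = hform (\sum_(i <- s) b i) p.
Proof.
elim: s => [|i s [p sp e]].
  exists 1; rewrite ?big_nil ?size_poly1 // /hform big_ord1 coef1 /= rmorph1.
  by rewrite mul1r mulr1.
rewrite !big_cons {}e; elim: (b i) => [|n [q sq e]]; first by exists p; rewrite ?mul1r.
exists ((be i *: 'X + (al i)%:P) * q).
  rewrite addSn (leq_trans (size_polyMleq _ _)) //.
  have s2 : (size (be i *: 'X + (al i)%:P)%R <= 2)%N.
    rewrite (leq_trans (size_polyD _ _)) // geq_max (leq_trans (size_scale_leq _ _)) ?size_polyX //.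
    by rewrite (leq_trans (size_polyC_leq1 _)).
  by rewrite -subn1 leq_subLR (leq_trans (leq_add s2 sq)).
by rewrite exprS -mulrA e addSn lin_hform.
Qed.

(** By [mdegL_eq] all monomials of a share their exponents modulo the weights. After this common
    monomial is split off, each term is a product of n powers x_i^p_i, that is, of n linear forms in
    u and v. *)
Lemma Shomog_hform d (a : S) : Shomog d a ->
  exists (r : I -> nat) n (p : {poly k}), (size p <= n.+1)%N /\ a = (\prod_i xg i ^+ r i) * hform n p.
Proof.
move=> [q -> hq]; rewrite -/(sproj q).
have [->|nq] := eqVneq q 0.
  by exists (fun=> 0%N), 0%N, 0; rewrite size_poly0 hform0 mulr0 rmorph0.
have [m0 hm0] : exists m, m \in msupp q.
  case E : (msupp q) => [|m s]; last by exists m; rewrite mem_head.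
  by move/eqP: E; rewrite msupp_eq0 (negbTE nq).
set n := (\sum_(i : I) m0 i %/ wt i)%N.
exists (fun i => m0 i %% wt i)%N, n; rewrite sproj_sum.
suff: exists2 p : {poly k}, (size p <= n.+1)%N & \sum_(m <- msupp q) scal q@_m * \prod_i xg i ^+ m i =
   \prod_i xg i ^+ (m0 i %% wt i) * hform n p by move=> [p ? ?]; exists p.
have : {subset msupp q <= msupp q} by [].
elim: {1 3}(msupp q) => [_|m s IHs hs].
  by exists 0; rewrite ?size_poly0 // big_nil hform0 mulr0.
have [|p sp ep] := IHs; first by move=> m' hm'; apply: hs; rewrite inE hm' orbT.
have hm := hs m (mem_head _ _); have [e1 e2] := mdegL_eq (etrans (hq m hm) (esym (hq m0 hm0))).
have [p' sp' ep'] := prod_lin_hform xu xv (fun i => m i %/ wt i)%N (index_enum I).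
rewrite e2 -/n in sp' ep'.
exists (q@_m *: p' + p).
  rewrite (leq_trans (size_polyD _ _)) // geq_max sp andbT.
  by rewrite (leq_trans (size_scale_leq _ _)).
rewrite big_cons ep hformD hformZ mulrDr -ep'; congr (_ + _).
rewrite [RHS]mulrCA -big_split /=; congr (_ * _); apply: eq_bigr => i _.
by rewrite -xg_wt -exprM -exprD -e1 addnC mulnC -divn_eq.
Qed.

(** Elements with an explicit factorization. Different choices of admissible factors give the forms
    in u and v, a supply of all nonzero homogeneous elements, and the elements that do not vanish at
    a given point. *)
Inductive atoms_prod (okx : I -> Prop) (okl : k -> k -> Prop) : S -> Prop :=
| atoms_scal c : c != 0 -> atoms_prod okx okl (scal c)
| atoms_x i a : okx i -> atoms_prod okx okl a -> atoms_prod okx okl (xg i * a)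
| atoms_lin al be a : okl al be -> atoms_prod okx okl a ->
    atoms_prod okx okl (lin al be * a).

Lemma atoms_prod_mul okx okl a b :
  atoms_prod okx okl a -> atoms_prod okx okl b -> atoms_prod okx okl (a * b).
Proof.
move=> ha hb; elim: ha => [c c0|i a' ox _ IH|al be a' ol _ IH].
- elim: hb => [c' c0'|i a' ox _ IH|al be a' ol _ IH].
  + by rewrite -rmorphM; apply: atoms_scal; rewrite mulf_neq0.
  + by rewrite mulrCA; apply: atoms_x.
  + by rewrite mulrCA; apply: atoms_lin.
- by rewrite -mulrA; apply: atoms_x.
- by rewrite -mulrA; apply: atoms_lin.
Qed.

Lemma atoms_prod1 okx okl : atoms_prod okx okl 1.
Proof. by rewrite -(rmorph1 scal); apply: atoms_scal; apply: oner_neq0. Qed.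

Lemma atoms_prod_exp okx okl a n : atoms_prod okx okl a -> atoms_prod okx okl (a ^+ n).
Proof.
move=> h; elim: n => [|n IHn]; first exact: atoms_prod1.
by rewrite exprS; apply: atoms_prod_mul.
Qed.

Lemma atoms_prod_lin (okx : I -> Prop) (okl : k -> k -> Prop) al be :
  okl al be -> atoms_prod okx okl (lin al be).
Proof. by move=> h; rewrite -[lin _ _]mulr1; apply: atoms_lin => //; apply: atoms_prod1. Qed.

Lemma atoms_prod_x (okx : I -> Prop) (okl : k -> k -> Prop) i :
  okx i -> atoms_prod okx okl (xg i).
Proof. by move=> h; rewrite -[xg _]mulr1; apply: atoms_x => //; apply: atoms_prod1. Qed.

Lemma atoms_prod_homog okx okl a : atoms_prod okx okl a -> exists d, Shomog d a.
Proof.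
elim=> [c _|i b _ _ [d h]|al be b _ _ [d h]]; first by exists 0; apply: Shomog_scal.
  by exists (Lgen i + d); apply: Shomog_mul => //; apply: Shomog_xg.
by exists (cdeg + d); apply: Shomog_mul => //; apply: Shomog_lin.
Qed.

Definition nz2 (a b : k) : Prop := (a != 0) || (b != 0).
(* Over an algebraically closed field, these are the nonzero forms in u and v. *)
Definition Theta : S -> Prop := atoms_prod (fun=> False) nz2.

End Elements.

(** * Factorization over an algebraically closed field *)

Section ClosedField.
Variables (k : closedFieldType) (X : weighted_line k).
Local Notation I := 'I_(npts X).
Local Notation L := (Lgrp X).
Local Notation S := (Salg X).
Local Notation cdeg := (cdeg X).
Local Notation lin := (lin X).
Local Notation scal := (scal X).

(** A vanishing top coefficient splits off u, the zero at infinity; otherwise a root a of p splits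
    off v - a u. *)
Lemma hform_atoms n (p : {poly k}) : p != 0 -> (size p <= n.+1)%N -> Theta (hform X n p).
Proof.
elim: n p => [|n IHn] p p0 sp.
  move: sp p0 => /size1_polyC ->; rewrite polyC_eq0 => c0.
  by rewrite /hform big_ord1 coefC /= mulr1 mulr1; apply: atoms_scal.
have [pn0|pn] := eqVneq p`_n.+1 0.
  have sp' : (size p <= n.+1)%N.
    by apply/leq_sizeP => j; rewrite leq_eqVlt => /orP[/eqP <- //|]; apply/leq_sizeP.
  have := lin_hform X 1 0 sp'; rewrite scale0r add0r mul1r => <-.
  by apply: atoms_lin; [rewrite /nz2 oner_neq0|apply: IHn].
have sp2 : size p = n.+2.
  apply/eqP; rewrite eqn_leq sp /= ltnNge; apply/negP => h.
  by move: pn; rewrite nth_default ?eqxx.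
have [a ra] : exists a, root p a.
  by apply/closed_rootP; rewrite sp2.
have [q e] := factor_theorem p a ra.
have q0 : q != 0 by apply: contraNneq p0 => q0; rewrite e q0 mul0r.
have sq : (size q <= n.+1)%N.
  by move: sp2; rewrite e size_Mmonic ?monicXsubC // size_XsubC addn2 => -[->].
have := lin_hform X (- a) 1 sq; rewrite scale1r polyCN [_ * q]mulrC -e => <-.
by apply: atoms_lin; [rewrite /nz2 oner_neq0 orbT|apply: IHn].
Qed.

Lemma atoms_prod_sub (okx okx' : I -> Prop) (okl okl' : k -> k -> Prop) (a : S) :
  (forall i, okx i -> okx' i) -> (forall x y, okl x y -> okl' x y) ->
  atoms_prod okx okl a -> atoms_prod okx' okl' a.
Proof.
move=> hx hl; elim=> [c|i b /hx|x y b /hl] *; [exact: atoms_scal|exact: atoms_x|exact: atoms_lin].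
Qed.

Lemma Shomog_atoms d (a : S) : Shomog d a ->
  a = 0 \/ atoms_prod (fun=> True) (@nz2 k) a.
Proof.
move=> /Shomog_hform[r [n [p [sp ->]]]].
have [->|p0] := eqVneq p 0; first by left; rewrite hform0 mulr0.
right; apply: atoms_prod_mul; last by apply: atoms_prod_sub (hform_atoms p0 sp).
elim/big_ind: _ => [|*|i _]; [exact: atoms_prod1|exact: atoms_prod_mul|].
by apply: atoms_prod_exp; apply: atoms_prod_x.
Qed.

(** Each factor x_i is completed to x_i^p_i, which is a linear form. *)
Lemma atoms_dvd_Theta (a : S) : atoms_prod (fun=> True) (@nz2 k) a ->
  exists b, Theta (b * a).
Proof.
elim=> [c c0|i b _ _ [b' h]|x y b nz _ [b' h]].
- by exists 1; rewrite mul1r; apply: atoms_scal.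
- exists (b' * xg i ^+ (wt i).-1); rewrite [xg i * b]mulrC mulrACA -exprSr prednK ?wt_gt0 // xg_wt.
  apply: atoms_prod_mul => //; apply: atoms_prod_lin; rewrite /nz2 /xu /xv.
  by case: (pt i) => [l|]; rewrite oner_neq0 ?orbT.
- by exists b'; rewrite mulrCA; apply: atoms_lin.
Qed.

Lemma Theta_homog (a : S) : Theta a -> exists n, Shomog (cdeg *+ n) a.
Proof.
elim=> [c _|i b []|x y b _ _ [n h]]; first by exists 0%N; apply: Shomog_scal.
by exists n.+1; rewrite mulrS; apply: Shomog_mul => //; apply: Shomog_lin.
Qed.

(** * Local parameters at a point *)

Section Local.
(* The point [al : be] of P^1 at which we localise is the zero of [lin al be];
   [ga, de] is a complementary linear form, invertible there. *)
Variables al be ga de : k.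
Hypothesis dt_nz : dt al be ga de != 0.
Local Notation ell := (lin al be).
Local Notation f := (lin ga de).

(** The elements to be inverted when localising at the point. *)
Definition away : S -> Prop :=
  atoms_prod (fun i => dt al be (xu i) (xv i) != 0) (fun x y => dt al be x y != 0).

(** Each linear form that does not vanish at the point spans, together with [ell], all linear forms.
    So it divides f modulo [ell], and a product of K such factors divides f^K. *)
Lemma away_power (e : S) : away e -> exists K a b, f ^+ K = a * e + b * ell.
Proof.
have h x y : dt al be x y != 0 -> exists c d, f = c * lin x y + d * ell.
  by move=> /lin_span-/(_ X ga de)[c [d ->]]; exists (scal d), (scal c); rewrite addrC.
elim=> [c c0|i b hi _ [K [a [d e1]]]|x y b hxy _ [K [a [d e1]]]].
- by exists 0%N, (scal c^-1), 0; rewrite mul0r addr0 -rmorphM mulVf // rmorph1.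
- have [c [d' e2]] := h _ _ hi.
  exists K.+1, (a * c * xg i ^+ (wt i).-1), (a * b * d' + d * f).
  rewrite exprS e1 mulrDr {1}e2 -xg_wt -[X in _ ^+ X](prednK (wt_gt0 i)) exprSr.
  ring.
- have [c [d' e2]] := h _ _ hxy.
  exists K.+1, (a * c), (a * b * d' + d * f).
  rewrite exprS e1 mulrDr {1}e2; ring.
Qed.

Lemma power_comb (K n : nat) (e a b : S) : f ^+ K = a * e + b * ell ->
  exists a' b', f ^+ (K * n) = a' * e + b' * ell ^+ n.
Proof.
move=> h; elim: n => [|n [a' [b' h']]]; first by exists 0, 1; rewrite muln0 !expr0 mul0r add0r mulr1.
exists (a' * f ^+ K + b' * ell ^+ n * a), (b' * b).
by rewrite mulnS addnC exprD h' mulrDl h exprSr; ring.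
Qed.

Lemma away_power_n (e : S) n : away e -> exists K a b, f ^+ K = a * e + b * ell ^+ n.
Proof.
move=> /away_power[K [a [b h]]]; have [a' [b' h']] := power_comb n h.
by exists (K * n)%N, a', b'.
Qed.

Lemma away_lin : away f.
Proof. exact: atoms_prod_lin. Qed.

Lemma nz_ell : nz2 al be.
Proof.
apply: contraNT dt_nz; rewrite /dt negb_or !negbK => /andP[/eqP -> /eqP ->].
by rewrite !mul0r subrr.
Qed.

(* [s] is a local parameter at the point, of ramification index [p]. *)
Record uniformizer (s : S) (p : nat) (sigma : L) : Prop := Uniformizer {
  unif_gt0 : (0 < p)%N;
  unif_homog : Shomog sigma s;
  unif_atoms : atoms_prod (fun=> True) (@nz2 k) s;
  unif_ell : exists2 c, c != 0 & ell = scal c * s ^+ p;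
  unif_x i : dt al be (xu i) (xv i) = 0 -> xg i = s;
  unif_ordinary : (forall i : I, dt al be (xu i) (xv i) <> 0) -> p = 1%N;
  unif_degree d : exists j a z,
    [/\ (j < p)%N, away a & exists2 d', Shomog d' a & d = sigma *+ j + d' + cdeg *~ z] }.

Lemma prop_lin_ell x y : nz2 x y -> dt al be x y = 0 -> exists2 c, c != 0 & lin x y = scal c * ell.
Proof.
move=> nz d0.
have [a0|a0] := eqVneq al 0.
  have b0 : be != 0 by have := nz_ell; rewrite /nz2 a0 eqxx.
  have x0 : x = 0.
    move/eqP: d0; rewrite /dt a0 mul0r sub0r oppr_eq0 mulf_eq0 (negbTE b0) => /eqP //.
  have y0 : y != 0 by move: nz; rewrite /nz2 x0 eqxx.
  exists (y / be); first by rewrite mulf_neq0 ?invr_eq0.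
  by rewrite -linZ a0 x0 mulr0 divfK.
have ye : y = x / al * be.
  by apply: (mulfI a0); move/eqP: d0; rewrite /dt subr_eq0 => /eqP ->; field.
have x0 : x != 0.
  by apply/negP => /eqP x0; move: nz; rewrite /nz2 ye x0 !mul0r eqxx.
exists (x / al); first by rewrite mulf_neq0 ?invr_eq0.
by rewrite -linZ divfK // -ye.
Qed.

Lemma away_prod_x (J : pred I) (a : I -> nat) :
  (forall i, J i -> dt al be (xu i) (xv i) != 0) ->
  away (\prod_(i | J i) xg i ^+ a i) /\
  Shomog (\sum_(i | J i) Lgen i *+ a i) (\prod_(i | J i) xg i ^+ a i).
Proof.
move=> h; split.
  elim/big_ind: _ => [|*|i /h]; [exact: atoms_prod1|exact: atoms_prod_mul|].
  by move=> hi; apply: atoms_prod_exp; apply: atoms_prod_x.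
elim/big_ind2: _ => [|* |i _]; last by apply: Shomog_exp; apply: Shomog_xg.
  by rewrite -(rmorph1 scal); apply: Shomog_scal.
exact: Shomog_mul.
Qed.

Lemma point_inj (i j : I) :
  dt al be (xu i) (xv i) = 0 -> dt al be (xu j) (xv j) = 0 -> i = j.
Proof.
move=> hi hj; apply: (@pt_inj _ X); move: hi hj nz_ell; rewrite /dt /xu /xv /nz2.
have e0 l : al * 1 - be * - l = 0 -> al = - be * l.
  by rewrite mulr1 mulrN opprK mulNr => /eqP; rewrite addr_eq0 => /eqP.
have e1 : al * 0 - be * 1 = 0 -> be = 0.
  by rewrite mulr0 mulr1 sub0r => /eqP; rewrite oppr_eq0 => /eqP.
case: (pt i) (pt j) => [li|] [lj|] //.
- move=> /e0 -> /eqP; rewrite mulr1 mulrN opprK mulNr addrC -mulrBr mulf_eq0.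
  have [->|b0] := eqVneq be 0; first by rewrite mul0r oppr0 eqxx.
  by rewrite subr_eq0 => /eqP ->.
- by move=> /e0 ha /e1 hb; rewrite ha hb oppr0 mul0r eqxx.
- by move=> /e1 hb /e0 ha; rewrite ha hb oppr0 mul0r eqxx.
Qed.

(** At an exceptional point the variable x_i is the parameter, and the number j in [unif_degree] is
    the i-th exponent in the normal form of the degree. At an ordinary point [ell] is the parameter
    and no variable vanishes. *)
Lemma uniformizer_ex : exists s p sigma, uniformizer s p sigma.
Proof.
have [[i0 h0]|/forallNP h] := pselect (exists i : I, dt al be (xu i) (xv i) = 0).
  exists (xg i0), (wt i0), (Lgen i0); split.
  - exact: wt_gt0.
  - exact: Shomog_xg.
  - exact: atoms_prod_x.
  - have nzi : nz2 (xu i0) (xv i0) by rewrite /nz2 /xu /xv; case: (pt i0) => [l|]; rewrite oner_neq0 ?orbT.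
    have [c c0 e] := prop_lin_ell nzi h0; exists c^-1; first by rewrite invr_eq0.
    by rewrite xg_wt e mulrA -rmorphM mulVf // rmorph1 mul1r.
  - by move=> i hi; rewrite (point_inj hi h0).
  - by move=> /(_ i0).
  - move=> d; have [a [z [ha ->]]] := Lgrp_normal d.
    have [|aw ho] := @away_prod_x (fun i => i != i0) a.
      by move=> i; apply: contraNneq => /point_inj/(_ h0) ->.
    exists (a i0), (\prod_(i | i != i0) xg i ^+ a i), z; split=> //.
    by exists (\sum_(i | i != i0) Lgen i *+ a i) => //; rewrite (bigD1 i0).
exists ell, 1%N, cdeg; split=> //.
- exact: Shomog_lin.
- by apply: atoms_prod_lin; apply: nz_ell.
- by exists 1; rewrite ?oner_neq0 // rmorph1 mul1r.
- by move=> i /h.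
- move=> d; have [a [z [ha ->]]] := Lgrp_normal d.
  have [|aw ho] := @away_prod_x predT a; first by move=> i _; apply/eqP/h.
  exists 0%N, (\prod_(i : I) xg i ^+ a i), z; split=> //.
  by exists (\sum_i Lgen i *+ a i) => //; rewrite mulr0n add0r.
Qed.

(** The exponent j is the valuation of a at the point, and e is a local unit. *)
Lemma unif_factor s p sigma (a : S) : uniformizer s p sigma ->
  atoms_prod (fun=> True) (@nz2 k) a -> exists j e, away e /\ a = s ^+ j * e.
Proof.
move=> hs; elim=> [c c0|i b _ _ [j [e [he ->]]]|x y b nz _ [j [e [he ->]]]].
- by exists 0%N, (scal c); rewrite mul1r; split=> //; apply: atoms_scal.
- have [d0|d0] := eqVneq (dt al be (xu i) (xv i)) 0.
    by exists j.+1, e; rewrite (unif_x hs d0) exprS mulrA.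
  by exists j, (xg i * e); rewrite mulrCA; split=> //; apply: atoms_x.
- have [d0|d0] := eqVneq (dt al be x y) 0.
    have [c c0 ->] := prop_lin_ell nz d0; have [c' c0' ->] := unif_ell hs.
    exists (p + j)%N, (scal (c * c') * e); split.
      by apply: atoms_prod_mul => //; apply: atoms_scal; rewrite mulf_neq0.
    by rewrite rmorphM exprD; ring.
  by exists j, (lin x y * e); rewrite mulrCA; split=> //; apply: atoms_lin.
Qed.

End Local.

(* The product of the linear forms that vanish at the exceptional points. *)
Definition excep : S := \prod_(i : I) lin (xu i) (xv i).

Lemma Theta_excep : Theta excep.
Proof.
apply: big_ind => [|*|i _]; [exact: atoms_prod1|exact: atoms_prod_mul|].
by apply: atoms_prod_lin; rewrite /nz2 /xu /xv; case: (pt i) => [l|]; rewrite oner_neq0 ?orbT.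
Qed.

End ClosedField.

(** * Chain conditions for modules *)

Section StableSubgroups.
Variables (A : comNzRingType) (M : lmodType A).
Implicit Types (O : A -> Prop) (N W : M -> Prop).

(** The set O of operators is a parameter so that submodules over S, over k, over k[u, v] and over
    k[f] are treated alike. *)
Definition stable O W : Prop :=
  [/\ W 0, forall x y, W x -> W y -> W (x - y) & forall o x, O o -> W x -> W (o *: x)].

Section Stable.
Variables (O : A -> Prop) (W : M -> Prop).
Hypothesis sW : stable O W.
Lemma stable0 : W 0. Proof. by case: sW. Qed.
Lemma stableB x y : W x -> W y -> W (x - y). Proof. by case: sW => _ h _; apply: h. Qed.
Lemma stableN x : W x -> W (- x).
Proof. by rewrite -sub0r; apply: stableB; apply: stable0. Qed.
Lemma stableD x y : W x -> W y -> W (x + y).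
Proof. by move=> wx wy; rewrite -[y]opprK; apply: stableB => //; apply: stableN. Qed.
Lemma stableZ o x : O o -> W x -> W (o *: x). Proof. by case: sW => _ _; apply. Qed.
Lemma stable_sum (T : Type) (s : seq T) (P : pred T) (F : T -> M) :
  (forall i, P i -> W (F i)) -> W (\sum_(i <- s | P i) F i).
Proof. by move=> h; elim/big_ind: _ => //; [exact: stable0|exact: stableD]. Qed.
End Stable.

Lemma stable_sub O O' W : (forall o, O' o -> O o) -> stable O W -> stable O' W.
Proof. by move=> s [h1 h2 h3]; split=> // o x /s; apply: h3. Qed.

Definition acc_on O N : Prop := forall W : nat -> M -> Prop,
  (forall n, stable O (W n)) -> (forall n, subset (W n) N) ->
  (forall n, subset (W n) (W n.+1)) -> exists m, forall n, (m <= n)%N -> subset (W n) (W m).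

Lemma seq_incr (W : nat -> M -> Prop) : (forall n, subset (W n) (W n.+1)) ->
  forall m n, (m <= n)%N -> subset (W m) (W n).
Proof.
move=> h m n /subnK <-; elim: (n - m)%N => [//|d IH] x /IH; rewrite addSn; exact: h.
Qed.

Definition add_sub N1 N2 : M -> Prop := fun x => exists a b, [/\ N1 a, N2 b & x = a + b].

(** Both the intersection of W with N1 and the image of W in N2 modulo N1 stabilise, and together
    they determine W. *)
Lemma acc_add O N1 N2 : stable O N1 -> stable O N2 ->
  acc_on O N1 -> acc_on O N2 -> acc_on O (add_sub N1 N2).
Proof.
move=> s1 s2 c1 c2 W sW WN incW; have leW := seq_incr incW.
have [||n x [wx nx]|m1 h1] := c1 (fun n x => W n x /\ N1 x).
- move=> n; split; first by split; [apply: stable0 (sW n)|apply: stable0 s1].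
    by move=> x y [wx nx] [wy ny]; split; [apply: (stableB (sW n))|apply: (stableB s1)].
  by move=> o x ho [wx nx]; split; [apply: (stableZ (sW n))|apply: (stableZ s1)].
- by move=> n x [].
- by split=> //; apply: incW.
have [||n x [nx [a na wx]]|m2 h2] := c2 (fun n b => N2 b /\ exists2 a, N1 a & W n (a + b)).
- move=> n; split.
  + by split; [apply: stable0 s2|exists 0; [apply: stable0 s1|rewrite addr0; apply: stable0 (sW n)]].
  + move=> x y [nx [a na wx]] [ny [b nb wy]]; split; first exact: (stableB s2).
    by exists (a - b); [apply: (stableB s1)|rewrite addrACA -opprD; apply: (stableB (sW n))].
  + move=> o x ho [nx [a na wx]]; split; first exact: (stableZ s2).
    by exists (o *: a); [apply: (stableZ s1)|rewrite -scalerDr; apply: (stableZ (sW n))].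
- by move=> n x [].
- by split=> //; exists a => //; apply: incW.
exists (maxn m1 m2) => n; rewrite geq_max => /andP[l1 l2] x wx.
have [a [b [na nb e]]] := WN n x wx.
have [|_ [a' na' wb]] := h2 n l2 b; first by split=> //; exists a => //; rewrite -e.
have wm := leW m2 (maxn m1 m2) (leq_maxr _ _) _ wb.
rewrite -(subrK (a' + b) x); apply: (stableD (sW _)) => //.
apply: (leW m1); first exact: leq_maxl.
have [|//] := h1 n l1 (x - (a' + b)); split.
  by apply: (stableB (sW n)) => //; apply: (leW m2).
by rewrite e opprD addrACA subrr addr0; apply: (stableB s1).
Qed.

Definition polyspan (v : A) N : M -> Prop := fun y => exists d (c : nat -> M),
  [/\ forall i, N (c i), forall i, (d <= i)%N -> c i = 0 & y = \sum_(i < d) v ^+ i *: c i].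

Lemma poly_sum_widen (v : A) d d' (c : nat -> M) :
  (forall i, (d <= i)%N -> c i = 0) -> (d <= d')%N ->
  \sum_(i < d) v ^+ i *: c i = \sum_(i < d') v ^+ i *: c i.
Proof.
move=> h le; rewrite (big_ord_widen _ (fun i => v ^+ i *: c i) le) big_mkcond.
by apply: eq_bigr => i _; case: ltnP => // /h ->; rewrite scaler0.
Qed.

Lemma stable_poly O v N : stable O N -> stable (fun a => O a \/ a = v) (polyspan v N).
Proof.
move=> sN; have N0 := stable0 sN; split.
- by exists 0%N, (fun=> 0); rewrite big_ord0.
- move=> _ _ [d [c [nc zc ->]]] [d' [c' [nc' zc' ->]]].
  exists (maxn d d'), (fun i => c i - c' i); split.
  + by move=> i; apply: (stableB sN).
  + by move=> i; rewrite geq_max => /andP[/zc -> /zc' ->]; rewrite subrr.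
  rewrite (poly_sum_widen _ zc (leq_maxl d d')) (poly_sum_widen _ zc' (leq_maxr d d')).
  by rewrite -sumrB; apply: eq_bigr => i _; rewrite scalerBr.
- move=> o _ [ho|->] [d [c [nc zc ->]]].
    exists d, (fun i => o *: c i); split.
    + by move=> i; apply: (stableZ sN).
    + by move=> i /zc ->; rewrite scaler0.
    by rewrite scaler_sumr; apply: eq_bigr => i _; rewrite !scalerA mulrC.
  exists d.+1, (fun i => if i is j.+1 then c j else 0); split.
  + by case.
  + by case=> // i /zc.
  rewrite big_ord_recl scaler0 add0r scaler_sumr; apply: eq_bigr => i _.
  by rewrite scalerA -exprS.
Qed.

(** * Hilbert's basis theorem *)

Section AccPoly.
Variables (O : A -> Prop) (N : M -> Prop) (v : A).
Hypothesis sN : stable O N.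
Hypothesis accN : acc_on O N.
Local Notation O' := (fun a => O a \/ a = v).

(* Leading coefficients in degree i, as in Hilbert's basis theorem. *)
Definition lead_sub (i : nat) (W : M -> Prop) : M -> Prop := fun m => N m /\
  exists2 c : nat -> M, (forall j, N (c j)) & W (v ^+ i *: m + \sum_(j < i) v ^+ j *: c j).

Lemma lead_stable i W : stable O' W -> stable O (lead_sub i W).
Proof.
move=> sW; have N0 := stable0 sN; split.
- split=> //; exists (fun=> 0) => //; rewrite scaler0 big1 ?addr0; last by move=> j _; rewrite scaler0.
  exact: stable0 sW.
- move=> x y [nx [c nc wx]] [ny [c' nc' wy]]; split; first exact: (stableB sN).
  exists (fun j => c j - c' j); first by move=> j; apply: (stableB sN).
  have := stableB sW wx wy; rewrite opprD addrACA -scalerBr -sumrB; congr W.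
  by congr (_ + _); apply: eq_bigr => j _; rewrite scalerBr.
- move=> o x ho [nx [c nc wx]]; split; first exact: (stableZ sN).
  exists (fun j => o *: c j); first by move=> j; apply: (stableZ sN).
  have /(stableZ sW (o := o)) := wx; move/(_ (or_introl ho)); congr W.
  rewrite scalerDr scaler_sumr !scalerA mulrC; congr (_ + _).
  by apply: eq_bigr => j _; rewrite !scalerA mulrC.
Qed.

Lemma lead_incr i W : stable O' W -> subset (lead_sub i W) (lead_sub i.+1 W).
Proof.
move=> sW x [nx [c nc wx]]; split=> //.
exists (fun j => if j is j'.+1 then c j' else 0); first by case=> //; apply: stable0 sN.
have /(stableZ sW (o := v)) := wx; move/(_ (or_intror erefl)); congr W.
rewrite scalerDr scalerA -exprS; congr (_ + _); rewrite big_ord_recl scaler0 add0r scaler_sumr.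
by apply: eq_bigr => j _; rewrite scalerA -exprS.
Qed.

Lemma lead_mono i (W W' : M -> Prop) : subset W W' -> subset (lead_sub i W) (lead_sub i W').
Proof. by move=> s x [nx [c nc /s wx]]; split=> //; exists c. Qed.

Lemma acc_poly : acc_on O' (polyspan v N).
Proof.
move=> W sW WN incW; have leW := seq_incr incW.
have leI n i j : (i <= j)%N -> subset (lead_sub i (W n)) (lead_sub j (W n)).
  by apply: (@seq_incr (fun i => lead_sub i (W n))) => l; apply: lead_incr.
(* The diagonal chain settles all degrees from m0 on at once; the finitely many lower degrees are
   then treated one by one. *)
have [||n x lx|m0 h0] := accN (W := fun n => lead_sub n (W n)).
- by move=> n; apply: lead_stable.
- by move=> n x [].
- by apply: (lead_mono (incW n)); apply: leI lx.
have /choice[s hs] : forall i, exists m, forall n, (m <= n)%N ->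
    subset (lead_sub i (W n)) (lead_sub i (W m)).
  move=> i; apply: (accN (W := fun n => lead_sub i (W n))) => n.
  - exact: lead_stable.
  - by move=> x [].
  - by apply: lead_mono; apply: incW.
set m := maxn m0 (\max_(i < m0) s i).
have key n i : (m <= n)%N -> subset (lead_sub i (W n)) (lead_sub i (W m)).
  move=> le_mn x lx; have [lt_i|le_i] := ltnP i m0.
    have le_s : (s i <= m)%N.
      by rewrite leq_max (leq_bigmax (Ordinal lt_i)) orbT.
    by apply: (lead_mono (leW _ _ le_s)); apply: (hs i n) => //; apply: leq_trans le_mn.
  apply: (leI m _ _ le_i); apply: (lead_mono (leW _ _ (leq_maxl _ _))).
  apply: (h0 (maxn i n)); first by rewrite leq_max le_i.
  by apply: (leI _ i); [apply: leq_maxl|apply: lead_mono lx; apply: leW; apply: leq_maxr].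
exists m => n le_mn x wx; have [d [c [nc _ e]]] := WN n x wx.
(* Induction on the length of x: an element of [W m] with the same leading coefficient is
   subtracted. *)
elim: d => [|d IHd] in x c nc e wx *; first by rewrite e big_ord0; apply: stable0 (sW m).
have [|_ [c' nc' wc]] := key n d le_mn (c d).
  by split=> //; exists c => //; move: wx; rewrite e big_ord_recr addrC.
rewrite -(subrK (v ^+ d *: c d + \sum_(j < d) v ^+ j *: c' j) x).
apply: (stableD (sW m)) => //; apply: (IHd _ (fun j => c j - c' j)).
- by move=> j; apply: (stableB sN).
- rewrite e big_ord_recr /= opprD addrA addrK -sumrB.
  by apply: eq_bigr => j _; rewrite scalerBr.
- by apply: (stableB (sW n)) => //; apply: (leW m).
Qed.

End AccPoly.

Section Span.
Variables (D : nzRingType) (iota : {rmorphism D -> A}).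
Definition coefs : A -> Prop := fun a => exists c, a = iota c.

Fixpoint rspan (Z : M -> Prop) (s : seq M) : M -> Prop :=
  if s is g :: s' then fun x => exists c y, rspan Z s' y /\ x = iota c *: g + y else Z.

Lemma stable_rspan Z s : stable coefs Z -> stable coefs (rspan Z s).
Proof.
move=> sZ; elim: s => //= g s sS; split.
- by exists 0, 0; split; [apply: stable0 sS|rewrite rmorph0 scale0r addr0].
- move=> _ _ [c [y [hy ->]]] [c' [y' [hy' ->]]]; exists (c - c'), (y - y').
  by split; [apply: (stableB sS)|rewrite rmorphB scalerBl opprD addrACA].
- move=> _ _ [a ->] [c [y [hy ->]]]; exists (a * c), (iota a *: y).
  by split; [apply: (stableZ sS) => //; exists a|rewrite scalerDr scalerA rmorphM].
Qed.

Lemma rspan_base Z s : subset Z (rspan Z s).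
Proof.
elim: s => //= g s IHs x /IHs h; exists 0, x; split=> //.
by rewrite rmorph0 scale0r add0r.
Qed.

Lemma rspan_mem Z s g : Z 0 -> g \in s -> rspan Z s g.
Proof.
move=> Z0; elim: s => //= y s IHs; rewrite inE => /orP[/eqP ->|/IHs h].
  by exists 1, 0; rewrite rmorph1 scale1r addr0; split=> //; apply: rspan_base.
by exists 0, g; rewrite rmorph0 scale0r add0r.
Qed.

Lemma rspan_cat Z s t : rspan Z (s ++ t) = rspan (rspan Z t) s.
Proof. by elim: s => //= g s ->. Qed.

Lemma rspan_mono Z Z' s : subset Z Z' -> subset (rspan Z s) (rspan Z' s).
Proof.
move=> h; elim: s => //= g s IHs x [c [y [/IHs hy ->]]]; by exists c, y.
Qed.

Definition dilate (a : A) Z : M -> Prop := fun x => exists2 y, Z y & x = a *: y.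

Lemma rspan_dilate a Z s x :
  rspan Z s x -> rspan (dilate a Z) [seq a *: g | g <- s] (a *: x).
Proof.
elim: s x => [|g s IHs] x /=; first by exists x.
move=> [c [y [/IHs hy ->]]]; exists c, (a *: y).
by rewrite scalerDr !scalerA mulrC.
Qed.

Lemma rspanP s x : rspan (eq 0) s x ->
  exists c : nat -> D, x = \sum_(i < size s) iota (c i) *: s`_i.
Proof.
elim: s x => [|g s IHs] x /=; first by move=> <-; exists (fun=> 0); rewrite big_ord0.
move=> [c [y [/IHs[c' ->] ->]]]; exists (fun i => if i is j.+1 then c' j else c).
by rewrite big_ord_recl.
Qed.

End Span.

Lemma stable_zero O : stable O (eq 0).
Proof.
by split=> // [x y <- <-|o x _ <-]; rewrite ?subrr ?scaler0.
Qed.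

Lemma acc_zero O : acc_on O (eq 0).
Proof. by move=> W sW WN incW; exists 0%N => n _ x /WN <-; apply: stable0 (sW _). Qed.

Lemma acc_line (D : fieldType) (iota : {rmorphism D -> A}) g :
  acc_on (coefs iota) (fun x => exists c, x = iota c *: g).
Proof.
move=> W sW WN incW.
have [[m [x [wx nx]]]|h] := pselect (exists m x, W m x /\ x <> 0).
  exists m => n _ y /WN[c ->]; apply: (stableZ (sW m)); first by exists c.
  have [c' e] := WN _ _ wx; have c0 : c' != 0 by apply/eqP => c0; apply: nx; rewrite e c0 rmorph0 scale0r.
  rewrite -[g]scale1r -(rmorph1 iota) -(mulVf c0) rmorphM -scalerA -e.
  by apply: (stableZ (sW m)) => //; exists c'^-1.
exists 0%N => n _ x wx; have -> : x = 0 by apply: contrapT => nx; apply: h; exists n, x.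
exact: stable0 (sW _).
Qed.

Lemma acc_span (D : fieldType) (iota : {rmorphism D -> A}) s :
  acc_on (coefs iota) (rspan iota (eq 0) s).
Proof.
elim: s => [|g s IHs]; first exact: acc_zero.
have := @acc_add (coefs iota) (fun x => exists c, x = iota c *: g) (rspan iota (eq 0) s).
move=> h W sW WN; apply: h => //.
- split; first by exists 0; rewrite rmorph0 scale0r.
    by move=> _ _ [c ->] [c' ->]; exists (c - c'); rewrite rmorphB scalerBl.
  by move=> _ _ [a ->] [c ->]; exists (a * c); rewrite rmorphM scalerA.
- by apply: stable_rspan; apply: stable_zero.
- exact: acc_line.
- by move=> n x /WN[c [y [hy ->]]]; exists (iota c *: g), y; split=> //; exists c.
Qed.

Fixpoint polyspans N (xs : seq A) : M -> Prop :=
  if xs is x :: xs' then polyspan x (polyspans N xs') else N.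

Fixpoint ops O (xs : seq A) : A -> Prop :=
  if xs is x :: xs' then fun a => ops O xs' a \/ a = x else O.

Lemma polyspans_acc O N xs : stable O N -> acc_on O N ->
  stable (ops O xs) (polyspans N xs) /\ acc_on (ops O xs) (polyspans N xs).
Proof.
move=> sN cN; elim: xs => [//|x xs [IH1 IH2]] /=.
by split; [apply: stable_poly|apply: acc_poly].
Qed.

Lemma polyspans_monomial (T : Type) (x : T -> A) O N (s : seq T) (e : T -> nat) m :
  stable O N -> N m ->
  polyspans N (map x s) ((\prod_(i <- s) x i ^+ e i) *: m).
Proof.
move=> sN nm; elim: s => [|i s IHs] /=; first by rewrite big_nil scale1r.
have z0 : polyspans N (map x s) 0.
  by elim: (map x s) => [|y ys IH]; [apply: stable0 sN|exists 0%N, (fun=> 0); rewrite big_ord0].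
exists (e i).+1, (fun j => if j == e i then (\prod_(i <- s) x i ^+ e i) *: m else 0); split.
- by move=> j; case: eqP.
- by move=> j; rewrite ltnNge => h; case: eqP => // ej; rewrite ej leqnn in h.
rewrite big_ord_recr /= eqxx [X in X + _]big1 ?add0r; last first.
  move=> j _; case: ifP => [/eqP ej|_]; last exact: scaler0.
  by have := ltn_ord j; rewrite [X in (X < _)%N]ej ltnn.
by rewrite big_cons scalerA.
Qed.

(** * Rank of a finite span over a domain *)

Section Rank.
Variables (D : idomainType) (iota : {rmorphism D -> A}) (Z : M -> Prop).
Hypothesis sZ : stable (coefs iota) Z.

(** Gaussian elimination without division: an element with nonzero coefficient at g serves as pivot,
    and cross multiplication removes g from the others. *)
Lemma rank_dep (s : seq M) (x : nat -> M) :
  (forall i, (i <= size s)%N -> rspan iota Z s (x i)) ->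
  exists d : nat -> D, (exists2 i, (i <= size s)%N & d i != 0) /\
    Z (\sum_(i < (size s).+1) iota (d i) *: x i).
Proof.
elim: s x => [|g s IHs] x hx /=.
  exists (fun=> 1); split; first by exists 0%N => //; apply: oner_neq0.
  by rewrite big_ord1 rmorph1 scale1r; apply: (hx 0%N).
have /choice[a ha] : forall i, exists c, (i <= (size s).+1)%N ->
    rspan iota Z s (x i - iota c *: g).
  move=> i; have [le_i|_] := boolP (i <= (size s).+1)%N; last by exists 0.
  by have [c [y [hy e]]] := hx i le_i; exists c; rewrite e addrC addKr.
have sS := stable_rspan s sZ.
have [[j0 le_j0 aj0]|h] := pselect (exists2 j, (j <= (size s).+1)%N & a j != 0); last first.
  have [|d [[i le_i di] zd]] := IHs x.
    move=> i le_i; have := ha i (leqW le_i).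
    suff -> : a i = 0 by rewrite rmorph0 scale0r subr0.
    by apply/eqP/negP => /negP ai; apply: h; exists i => //; apply: leqW.
  exists (fun i => if (i <= size s)%N then d i else 0); split.
    by exists i; [apply: leqW|rewrite le_i].
  rewrite big_ord_recr /= ltnn rmorph0 scale0r addr0.
  by under eq_bigr => j _ do rewrite -ltnS ltn_ord.
have [|d [[i le_i di] zd]] := IHs (fun i => iota (a j0) *: x (bump j0 i) - iota (a (bump j0 i)) *: x j0).
  move=> i le_i; have le_b : (bump j0 i <= (size s).+1)%N by rewrite -add1n leq_add // leq_b1.
  have h1 := stableZ sS (ex_intro _ (a j0) erefl) (ha _ le_b).
  have h2 := stableZ sS (ex_intro _ (a (bump j0 i)) erefl) (ha _ le_j0).
  have := stableB sS h1 h2; rewrite !scalerBr !scalerA -!rmorphM [a j0 * _]mulrC.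
  by rewrite opprB addrA subrK.
exists (fun i => if i == j0 then - \sum_(l < (size s).+1) d l * a (bump j0 l)
                 else d (unbump j0 i) * a j0); split.
  exists (bump j0 i); first by rewrite -add1n leq_add // leq_b1.
  by rewrite [_ == j0]eq_sym (negbTE (neq_bump _ _)) bumpK mulf_neq0.
have lt_j0 : (j0 < (size s).+2)%N by [].
rewrite (bigD1_ord (Ordinal lt_j0)) //= eqxx.
move: zd; congr Z; rewrite rmorphN rmorph_sum scaleNr scaler_suml.
rewrite -sumrN -big_split; apply: eq_bigr => l _ /=.
rewrite [_ == j0]eq_sym (negbTE (neq_bump _ _)) bumpK scalerBr !scalerA !rmorphM addrC.
by [].
Qed.

(** Otherwise each W_j contains an x_j without nonzero multiples in W_(j+1). In a relation between
    these, let i be the first index with nonzero coefficient: then d_i x_i is a combination of later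
    elements, all in W_(i+1), modulo Z. *)
Lemma rank_chain (s : seq M) (W : nat -> M -> Prop) :
  (forall i, stable (coefs iota) (W i)) -> (forall i, (i <= size s)%N -> subset (W i.+1) (W i)) ->
  (forall i, subset Z (W i)) -> subset (W 0%N) (rspan iota Z s) ->
  exists2 j, (j <= size s)%N & forall w, W j w -> exists2 d, d != 0 & W j.+1 (iota d *: w).
Proof.
move=> sW decW ZW W0; apply: contrapT => h.
have leW i j : (i <= j)%N -> (j <= (size s).+1)%N -> subset (W j) (W i).
  move=> /subnK <-; elim: (j - i)%N => [_ y //|n IH]; rewrite addSn => le_n y wy.
  by apply: IH; [apply: ltnW|apply: decW].
have /choice[x hx] : forall j, exists w, (j <= size s)%N ->
    W j w /\ forall d, d != 0 -> ~ W j.+1 (iota d *: w).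
  move=> j; have [le_j|_] := boolP (j <= size s)%N; last by exists 0.
  apply: contrapT => hj; apply: h; exists j => // w wj; apply: contrapT => hw; apply: hj.
  by exists w => _; split=> // d d0 wd; apply: hw; exists d.
have [|d [[i0 le_i0 di0] zd]] := @rank_dep s x.
  by move=> i le_i; apply: W0; apply: (leW _ i) => //; [apply: leqW|case: (hx i le_i)].
have ex : exists i, (i <= size s)%N && (d i != 0) by exists i0; rewrite le_i0.
have [i /andP[le_i di] mini] := ex_minnP ex.
have [wi ni] := hx i le_i; apply: (ni _ di).
have lt_i : (i < (size s).+1)%N by [].
rewrite (bigD1 (Ordinal lt_i)) //= in zd.
rewrite -[iota _ *: _](addrK (\sum_(l < (size s).+1 | l != Ordinal lt_i) iota (d l) *: x l)).
apply: (stableB (sW _)); first exact: ZW.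
apply: (stable_sum (sW _)) => l; rewrite -val_eqE /= neq_ltn => /orP[lt_l|lt_l].
  have -> : d l = 0.
    apply/eqP/negP => /negP dl; have := mini l; rewrite dl -ltnS ltn_ord => /(_ isT).
    by rewrite leqNgt lt_l.
  by rewrite rmorph0 scale0r; apply: stable0 (sW _).
apply: (stableZ (sW _)); first by exists (d l).
have le_l : (l <= size s)%N by rewrite -ltnS.
by apply: (leW _ l lt_l); [apply: leqW|case: (hx l le_l)].
Qed.

End Rank.

End StableSubgroups.

(** * Graded modules up to finite length *)

Section GradedModules.
Variables (k : fieldType) (X : weighted_line k).
Local Notation I := 'I_(npts X).
Local Notation L := (Lgrp X).
Local Notation S := (Salg X).
Local Notation cdeg := (cdeg X).
Local Notation u := (u X).
Local Notation v := (v X).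
Local Notation lin := (lin X).
Local Notation scal := (scal X).
Local Notation xg := (@xg k X).
Local Notation full := (fun _ : S => True).

Lemma acc_maximal (M : lmodType S) (O : S -> Prop) (N : M -> Prop) (P : (M -> Prop) -> Prop) :
  acc_on O N -> (forall W, P W -> stable O W /\ subset W N) -> (exists W, P W) ->
  exists2 W, P W & forall W', P W' -> subset W W' -> subset W' W.
Proof.
move=> acc hP [W0 PW0]; apply: contrapT => h.
have step (W : {W | P W}) : exists W' : {W | P W},
    subset (sval W) (sval W') /\ ~ subset (sval W') (sval W).
  apply: contrapT => hn; apply: h; exists (sval W); first exact: svalP.
  move=> W' PW' s; apply: contrapT => ns; apply: hn.
  by exists (exist _ W' PW').
have [W [_ hW]] := iterate_choice (exist _ W0 PW0) step.
have [|||m hm] := acc (fun n => sval (W n)).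
- by move=> n; case: (hP _ (svalP (W n))).
- by move=> n; case: (hP _ (svalP (W n))).
- by move=> n; case: (hW n).
by case: (hW m) => _; apply; apply: hm.
Qed.

(** The homogeneous components of a, read off a polynomial representative. They serve all graded
    modules simultaneously and are characterised only by their action. *)
Lemma S_comp (a : S) : exists b : L -> S, (forall d, Shomog d (b d)) /\
  forall (M : gmod X) (x : M) l0, gproj l0 x = x ->
    forall l, gproj l (a *: x) = b (l - l0) *: x.
Proof.
have [q ->] := S_repr a.
exists (fun d => \sum_(m <- msupp q | mdegL m == d) scal q@_m * \prod_i xg i ^+ m i); split.
  move=> d; apply: Shomog_sum => m /eqP <-; apply: Shomog_scalM; exact: Shomog_monomial.
move=> M x l0 hx l; rewrite sproj_sum !scaler_suml.
have gp0 : gproj l (0 : M) = 0 by rewrite gproj0.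
rewrite (big_morph (gproj l) (gprojD l) gp0) [RHS]big_mkcond; apply: eq_bigr => m _.
have h := gproj_act (Shomog_scalM q@_m (Shomog_monomial m)) hx.
have [e|ne] := eqVneq (mdegL m) (l - l0); first by rewrite -{1}(subrK l0 l) -e h.
rewrite -h gprojK; case: eqP => // e; by rewrite e addrK eqxx in ne.
Qed.

Section OneModule.
Variable M : gmod X.
Implicit Types (x y : M) (U V W : M -> Prop).

Lemma gproj_idem l x : gproj l (gproj l x) = gproj l x.
Proof. by rewrite gprojK eqxx. Qed.

Lemma gproj_sumE (T : Type) (s : seq T) (P : pred T) (F : T -> M) l :
  gproj l (\sum_(i <- s | P i) F i) = \sum_(i <- s | P i) gproj l (F i).
Proof. by apply: big_morph; [apply: gprojD|apply: gproj0]. Qed.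

Lemma gproj_actE d l (a : S) x : Shomog d a -> gproj (d + l) (a *: x) = a *: gproj l x.
Proof.
move=> ha; have [s us e] := gproj_sum x.
rewrite e scaler_sumr !gproj_sumE scaler_sumr; apply: eq_bigr => l' _.
have h := gproj_act ha (gproj_idem l' x).
rewrite -h !gprojK (inj_eq (addrI d)).
by case: eqP => [->|_]; rewrite ?scaler0.
Qed.

Lemma gsub_stable O U : gsub U -> stable O U.
Proof.
move=> hU; split; [exact: gsub_0|exact: gsub_B|].
by move=> o x _; apply: gsub_Z.
Qed.

Lemma stable_full O U : stable full U -> stable O U.
Proof. exact: stable_sub. Qed.

Lemma gsub_homog U V : gsub U -> stable full V ->
  (forall l x, gproj l x = x -> U x -> V x) -> subset U V.
Proof.
move=> hU sV h x ux; have [s _ ->] := gproj_sum x.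
apply: (stable_sum sV) => l _; apply: (h l); first exact: gproj_idem.
exact: gsub_p.
Qed.

(* As u and v generate an ideal of finite colength in S, the graded module
   [near U / U] is the largest submodule of M / U that is locally of finite length. *)
Definition near U : M -> Prop := fun x => exists n, U (u ^+ n *: x) /\ U (v ^+ n *: x).

Lemma near_bigger U x n m : stable full U -> (n <= m)%N ->
  U (u ^+ n *: x) /\ U (v ^+ n *: x) -> U (u ^+ m *: x) /\ U (v ^+ m *: x).
Proof.
move=> sU /subnK <- [h1 h2]; rewrite !exprD -!scalerA.
by split; apply: (stableZ sU).
Qed.

Lemma near_stable U : stable full U -> stable full (near U).
Proof.
move=> sU; split.
- by exists 0%N; rewrite !scaler0; split; apply: stable0 sU.
- move=> x y [n hn] [m hm]; exists (maxn n m).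
  have [h1 h2] := near_bigger sU (leq_maxl n m) hn.
  have [h3 h4] := near_bigger sU (leq_maxr n m) hm.
  by rewrite !scalerBr; split; apply: (stableB sU).
- move=> o x _ [n [h1 h2]]; exists n; rewrite !scalerA ![_ * o]mulrC -!scalerA.
  by split; apply: (stableZ sU).
Qed.

Lemma uE_homog n : Shomog (cdeg *+ n) (u ^+ n).
Proof. by apply: Shomog_exp; rewrite uE; apply: Shomog_lin. Qed.

Lemma vE_homog n : Shomog (cdeg *+ n) (v ^+ n).
Proof. by apply: Shomog_exp; rewrite vE; apply: Shomog_lin. Qed.

Lemma gsub_near U : gsub U -> gsub (near U).
Proof.
move=> hU; have [h0 hB hZ] := near_stable (gsub_stable full hU).
split=> // [a x y nx ny|l x [n [h1 h2]]].
  by apply: (stableD (near_stable (gsub_stable full hU))) => //; apply: hZ.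
exists n; rewrite -(gproj_actE l x (uE_homog n)) -(gproj_actE l x (vE_homog n)).
by split; apply: gsub_p.
Qed.

Lemma near_sub U : subset U (near U).
Proof. by move=> x ux; exists 0%N; rewrite !scale1r. Qed.

Lemma near_near U : stable full U -> subset (near (near U)) (near U).
Proof.
move=> sU x [n [[m [h1 _]] [m' [_ h2]]]]; exists (maxn m m' + n)%N.
rewrite !exprD -!scalerA -(subnK (leq_maxl m m')) exprD -scalerA; split; first exact: (stableZ sU).
by rewrite (subnK (leq_maxl m m')) -(subnK (leq_maxr m m')) exprD -scalerA; apply: (stableZ sU).
Qed.

(** M / U has no nonzero element killed by powers of u and v; such U represent the subobjects of M
    in coh X. *)
Definition saturated U : Prop := subset (near U) U.

Lemma saturated_near U : stable full U -> saturated (near U).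
Proof. exact: near_near. Qed.

End OneModule.

Lemma expr_comb (R : comNzRingType) (a b : R) n m :
  exists p q, (a + b) ^+ (n + m) = p * a ^+ n + q * b ^+ m.
Proof.
elim: n m => [|n IHn] m; first by exists ((a + b) ^+ m), 0; rewrite mul0r addr0 mulr1.
elim: m => [|m [p' [q' h']]]; first by exists 0, ((a + b) ^+ n.+1); rewrite addn0 mul0r add0r mulr1.
have [p [q h]] := IHn m.+1.
exists (p + p' * b), (q * a + q'); rewrite addSn exprS mulrDl {1}h -addSnnS h' !exprS.
ring.
Qed.

Section OneModule2.
Variable M : gmod X.
Implicit Types (x y : M) (U V W : M -> Prop).

Lemma near_lin U x a b c d n m : stable full U -> dt a b c d != 0 ->
  U (lin a b ^+ n *: x) -> U (lin c d ^+ m *: x) -> near U x.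
Proof.
move=> sU nz h1 h2; exists (n + m)%N.
have key e f : U (lin e f ^+ (n + m) *: x).
  have [z [t ->]] := lin_span X e f nz.
  have [p [q ->]] := expr_comb (scal z * lin a b) (scal t * lin c d) n m.
  rewrite scalerDl !exprMn !mulrA -!scalerA.
  by apply: (stableD sU); do 2!apply: (stableZ sU) => //.
by rewrite uE vE.
Qed.

Definition sgen U x : M -> Prop := fun y => exists a : S, U (y - a *: x).

Lemma gsub_sgen U x l : gsub U -> gproj l x = x -> gsub (sgen U x).
Proof.
move=> hU hx; have sU := gsub_stable full hU; split.
- by exists 0; rewrite scale0r subr0; apply: stable0 sU.
- move=> a y y' [b h] [b' h']; exists (a * b + b').
  rewrite scalerDl -scalerA opprD addrACA -scalerBr.
  by apply: (stableD sU) => //; apply: (stableZ sU).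
- move=> l' y [a h]; have [b [_ hb]] := S_comp a; exists (b (l' - l)).
  by rewrite -(hb _ _ _ hx) -gprojB; apply: gsub_p.
Qed.

(* Otherwise the submodules U + S s^i x would form strictly decreasing chains of
   arbitrary length, since S vanishes in degree - d. *)
Lemma fin_length_pow (s : S) d U V l x : Shomog d s ->
  (forall a : S, Shomog (- d) a -> a = 0) -> gsub U -> gsub V -> subset U V ->
  fin_length U V -> V x -> gproj l x = x -> exists n, U (s ^+ n *: x).
Proof.
move=> hs neg hU hV UV [n hn] vx hx; apply: contrapT => h; apply: hn.
have sU := gsub_stable full hU; have sV := gsub_stable full hV.
have hom i : gproj (d *+ i + l) (s ^+ i *: x) = s ^+ i *: x.
  by rewrite (gproj_actE _ _ (Shomog_exp i hs)) hx.
exists (fun i => sgen U (s ^+ (n - i) *: x)); split=> [i le_i|i lt_i].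
  split; first exact: gsub_sgen (hom _).
    by move=> y uy; exists 0; rewrite scale0r subr0.
  move=> y [a /UV vy]; rewrite -(subrK (a *: (s ^+ (n - i) *: x)) y).
  by apply: (stableD sV) => //; do 2!apply: (stableZ sV) => //.
rewrite subnS; set m := (n - i)%N; have m0 : (0 < m)%N by rewrite subn_gt0.
split=> [y [a uy]|sub].
  by exists (a * s); rewrite scalerA -mulrA -exprS prednK // -scalerA.
apply: h; exists m.-1.
have [|a ua] := sub (s ^+ m.-1 *: x).
  by exists 1; rewrite scale1r subrr; apply: stable0 sU.
have [b [bh hb]] := S_comp a.
have := gsub_p hU (d *+ m.-1 + l) ua; rewrite gprojB hom (hb _ _ _ (hom m)).
rewrite (neg (b _)) ?scale0r ?subr0 //.
suff <- : d *+ m.-1 + l - (d *+ m + l) = - d by apply: bh.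
by rewrite -[in d *+ m](prednK m0) mulrS opprD addrACA subrr addr0 opprD addrCA subrr addr0.
Qed.

Lemma fin_length_near U V : gsub U -> gsub V -> subset U V -> fin_length U V ->
  subset V (near U).
Proof.
move=> hU hV UV fl; apply: gsub_homog => //.
  by apply: near_stable; apply: gsub_stable.
move=> l x hx vx.
have hu : Shomog cdeg u by rewrite uE; apply: Shomog_lin.
have hv : Shomog cdeg v by rewrite vE; apply: Shomog_lin.
have [n hn] := fin_length_pow hu (@Shomog_negc _ _) hU hV UV fl vx hx.
have [m hm] := fin_length_pow hv (@Shomog_negc _ _) hU hV UV fl vx hx.
have nz : dt (1 : k) 0 0 1 != 0 by rewrite /dt mulr1 mulr0 subr0 oner_neq0.
rewrite uE in hn; rewrite vE in hm.
exact: (near_lin (gsub_stable full hU) nz hn hm).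
Qed.

Hypothesis fgM : fin_gen M.

(** The basis theorem is applied to one variable after the other, starting from the k-span of the
    generators. *)
Lemma fin_gen_acc : acc_on full (fun _ : M => True).
Proof.
have [n [g hg]] := fgM.
pose N := rspan scal (eq 0) [seq g i | i : 'I_n].
have sN : stable (coefs scal) N by apply: stable_rspan; apply: stable_zero.
have [sP cP] := polyspans_acc [seq xg i | i <- index_enum I] sN (@acc_span _ _ _ scal _).
move=> W sW _ incW; apply: cP => //; first by move=> m; apply: stable_full.
move=> m x _ {m}; have [a ->] := hg x.
apply: (stable_sum sP) => i _; have [q ->] := S_repr (a i).
rewrite sproj_sum scaler_suml; apply: (stable_sum sP) => m _.
rewrite mulrC -scalerA; apply: (polyspans_monomial _ _ _ sN).
apply: (stableZ sN); first by eexists.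
have : g i \in [seq g i | i : 'I_n] by apply: image_f.
rewrite /N; elim: [seq g i | i : 'I_n] => //= y s IHs; rewrite inE => /orP[/eqP ->|/IHs h].
  by exists 1, 0; rewrite rmorph1 scale1r addr0; split=> //; apply: rspan_base.
by exists 0, (g i); rewrite rmorph0 scale0r add0r.
Qed.

Lemma fin_gen_sub U : stable full U -> exists s : seq M,
  (forall x, x \in s -> U x) /\ subset U (rspan (idfun : S -> S) (eq 0) s).
Proof.
move=> sU.
pose P := fun W : M -> Prop => exists2 s, (forall x, x \in s -> U x) & W = rspan (idfun : S -> S) (eq 0) s.
have [W [s hs ->] maxW] : exists2 W, P W & forall W', P W' -> subset W W' -> subset W' W.
  apply: (acc_maximal fin_gen_acc).
    move=> W [s hs ->]; split=> //.
    have := @stable_rspan S M S (idfun : {rmorphism S -> S}) (eq 0) s (stable_zero _ _).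
    by apply: stable_sub => a _; exists a.
  by exists (rspan (idfun : S -> S) (eq 0) [::]), [::].
exists s; split=> // x ux; apply: (maxW (rspan (idfun : S -> S) (eq 0) (x :: s))).
- by exists (x :: s) => // y; rewrite inE => /orP[/eqP ->|/hs].
- by move=> y hy; exists 0, y; rewrite scale0r add0r.
- by exists 1, 0; rewrite scale1r addr0; split=> //; apply: rspan_base.
Qed.

Lemma near_uniform (s : seq M) U : stable full U -> (forall x, x \in s -> near U x) ->
  exists n, forall x, x \in s -> U (u ^+ n *: x) /\ U (v ^+ n *: x).
Proof.
move=> sU; elim: s => [|x s IHs] h; first by exists 0%N.
have [|n hn] := IHs; first by move=> y ys; apply: h; rewrite inE ys orbT.
have [m hm] := h x (mem_head _ _); exists (maxn n m) => y; rewrite inE => /orP[/eqP ->|/hn h'].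
  exact: near_bigger sU (leq_maxr _ _) hm.
exact: near_bigger sU (leq_maxl _ _) h'.
Qed.

(** The power x_i^p_i is a linear form in u and v, and its 2n-th power lies in the ideal (u^n,
    v^n). *)
Lemma pow_xg_near U x n i m : stable full U ->
  U (u ^+ n *: x) /\ U (v ^+ n *: x) -> (wt i * (n + n) <= m)%N -> U (xg i ^+ m *: x).
Proof.
move=> sU [h1 h2] /subnK <-; rewrite exprD exprM xg_wt -scalerA; apply: (stableZ sU) => //.
have [p [q ->]] := expr_comb (scal (xu i) * u) (scal (xv i) * v) n n.
rewrite scalerDl !exprMn !mulrA -!scalerA.
by apply: (stableD sU); do 2!apply: (stableZ sU) => //.
Qed.

(** V / U is finite-dimensional over k, spanned by bounded monomials times generators of V, and its
    dimension bounds the length of chains. *)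
Lemma near_fin_length U V : gsub U -> gsub V -> subset V (near U) -> fin_length U V.
Proof.
move=> hU hV VU; have sU := gsub_stable full hU; have sV := gsub_stable full hV.
have sUk : stable (coefs scal) U by apply: gsub_stable.
have [s [hs Vs]] := fin_gen_sub sV.
have [n hn] := near_uniform sU (fun x xs => VU x (hs x xs)).
(* B is at least 2n p_i for every i, so a monomial with an exponent above B sends the generators of
   V into U. *)
pose B := ((\sum_i @wt k X i) * (n + n))%N.
pose mon (e : {ffun I -> 'I_B.+1}) : S := \prod_i xg i ^+ e i.
pose t := [seq mon e *: g | e <- enum {: {ffun I -> 'I_B.+1}}, g <- s].
have VT : subset V (rspan scal U t).
  have sT := stable_rspan t sUk.
  have key g (a : S) : g \in s -> rspan scal U t (a *: g).
    move=> gs; have [q ->] := S_repr a; rewrite sproj_sum scaler_suml.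
    apply: (stable_sum sT) => m _; rewrite -scalerA; apply: (stableZ sT); first by exists q@_m.
    have [/forallP small|] := boolP [forall i, m i < B.+1]%N.
      have -> : \prod_i xg i ^+ m i = mon [ffun i => inord (m i)].
        by apply: eq_bigr => i _; rewrite ffunE inordK.
      have : mon [ffun i => inord (m i)] *: g \in t.
        by apply: allpairs_f => //; rewrite mem_enum.
      elim: t {sT} => //= y t IHt; rewrite inE => /orP[/eqP ->|/IHt h].
        exists 1, 0; rewrite rmorph1 scale1r addr0; split=> //.
        by apply: rspan_base; apply: stable0 sU.
      by exists 0, (mon [ffun i => inord (m i)] *: g); rewrite rmorph0 scale0r add0r.
    rewrite negb_forall => /existsP[i]; rewrite ltnS -ltnNge => big.
    apply: rspan_base; rewrite (bigD1 i) //= mulrC -scalerA; apply: (stableZ sU) => //.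
    apply: (pow_xg_near sU (hn g gs)); apply: leq_trans (ltnW big).
    by rewrite leq_mul2r (bigD1 i) //= leq_addr orbT.
  move=> x /Vs {Vs}; elim: (s) x hs key => [|g s' IHs] y hs' key /=.
    by move=> <-; apply: stable0 sT.
  move=> [c [z [hz ->]]]; apply: (stableD sT); first by apply: key; apply: mem_head.
  apply: IHs hz => [x' xs|g' a gs']; first by apply: hs'; rewrite inE xs orbT.
  by apply: key; rewrite inE gs' orbT.
exists (size t).+1 => -[W [h1 h2]].
(* The ascending chain is read backwards, because [rank_chain] is about descending ones. *)
have hW i : gsub (W ((size t).+1 - i)%N) /\ subset U (W ((size t).+1 - i)%N).
  by have [] := h1 _ (leq_subr i (size t).+1).
have [||||j le_j hj] := @rank_chain S M k scal U sUk t (fun i => W ((size t).+1 - i)%N).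
- by move=> i; apply: gsub_stable; case: (hW i).
- move=> i le_i; have -> : ((size t).+1 - i)%N = ((size t).+1 - i.+1).+1 by rewrite subnSK.
  by case: (h2 ((size t).+1 - i.+1)%N); rewrite // ltn_subrL.
- by move=> i; case: (hW i).
- by rewrite subn0; have [_ _ h] := h1 _ (leqnn _) => x /h /VT.
have e : ((size t).+1 - j)%N = ((size t).+1 - j.+1).+1 by rewrite subnSK.
have [|_] := h2 ((size t).+1 - j.+1)%N; first by rewrite ltn_subrL.
apply; rewrite -e => x /hj[d d0 wx].
rewrite -[x]scale1r -(rmorph1 scal) -(mulVf d0) rmorphM -scalerA.
by apply: gsub_Z => //; case: (hW j.+1).
Qed.

Lemma cofinsub_near U : gsub U -> cofinsub U <-> forall x, near U x.
Proof.
move=> hU; split=> [[_ fl] x|h]; first by apply: (fin_length_near hU (gsub_T M)).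
by split=> //; apply: near_fin_length.
Qed.

Lemma finsub_near U : gsub U -> finsub U <-> subset U (near (@gsub0 _ _ M)).
Proof.
move=> hU; split=> [[_ fl]|h].
  apply: fin_length_near => //; [exact: gsub_zero|exact: subset0].
by split=> //; apply: near_fin_length => //; apply: gsub_zero.
Qed.

End OneModule2.

End GradedModules.

(** * Graded submodules and quotient modules *)

Section SubQuotient.
Variables (k : fieldType) (X : weighted_line k).
Local Notation S := (Salg X).
Local Notation L := (Lgrp X).
Variables (M : gmod X) (U : M -> Prop) (hU : gsub U).

Definition sub_pred : {pred M} := fun x => `[<U x>].

Fact sub_pred_closed : submod_closed sub_pred.
Proof.
split; first by apply/asboolP; apply: gsub_0.
by move=> a x y /asboolP ux /asboolP uy; apply/asboolP; apply: gsub_D => //; apply: gsub_Z.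
Qed.
HB.instance Definition _ := GRing.isSubmodClosed.Build S M sub_pred sub_pred_closed.

Record subm := Subm { subm_val : M; _ : subm_val \in sub_pred }.
HB.instance Definition _ := [isSub for subm_val].
HB.instance Definition _ := [Choice of subm by <:].
HB.instance Definition _ := [SubChoice_isSubLmodule of subm by <:].

Lemma submP (x : subm) : U (subm_val x).
Proof. by case: x => x /= /asboolP. Qed.

Definition mk_sub x (ux : U x) : subm := Subm (introT (asboolP _) ux).

Lemma subm_val0 : subm_val 0 = 0.
Proof. exact: (raddf0 val). Qed.

Lemma subm_valZ (a : S) (x : subm) : subm_val (a *: x) = a *: subm_val x.
Proof. by rewrite -[LHS]/(val _) linearZ. Qed.

Lemma subm_val_sum (T : Type) (s : seq T) (F : T -> subm) :
  subm_val (\sum_(i <- s) F i) = \sum_(i <- s) subm_val (F i).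
Proof. exact: (raddf_sum (val : subm -> M)). Qed.

Lemma subm_inj (x y : subm) : subm_val x = subm_val y -> x = y.
Proof. exact: val_inj. Qed.

Definition sub_proj (l : L) (x : subm) : subm := mk_sub (gsub_p hU l (submP x)).

Fact sub_projB l : zmod_morphism (sub_proj l).
Proof. by move=> x y; apply: subm_inj; rewrite /= gprojB.
Qed.

Fact sub_projK l l' x : sub_proj l (sub_proj l' x) = if l == l' then sub_proj l x else 0.
Proof. by apply: subm_inj; rewrite /= gprojK; case: (l == l'); rewrite ?subm_val0. Qed.

Fact sub_proj_sum x : exists2 s : seq L, uniq s & x = \sum_(l <- s) sub_proj l x.
Proof.
have [s us e] := gproj_sum (subm_val x); exists s => //.
by apply: subm_inj; rewrite {1}e subm_val_sum.
Qed.

Fact sub_proj_act d l (a : S) x : Shomog d a -> sub_proj l x = x ->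
  sub_proj (d + l) (a *: x) = a *: x.
Proof.
move=> ha /(congr1 subm_val) /= hx; apply: subm_inj => /=.
by apply: gproj_act.
Qed.

Definition sub_gmod : gmod X := GMod sub_projB sub_projK sub_proj_sum sub_proj_act.

Definition quom := Quotient.quot sub_pred.
HB.instance Definition _ := GRing.Zmodule.on quom.
HB.instance Definition _ := EqQuotient.on quom.

Definition qpi (x : M) : quom := \pi_(Quotient.quot sub_pred) x.

Lemma qpi_zmod : zmod_morphism qpi.
Proof. by move=> x y; rewrite /qpi raddfB. Qed.
HB.instance Definition _ := GRing.isZmodMorphism.Build M quom qpi qpi_zmod.

Lemma qpi_eq x y : qpi x = qpi y <-> U (x - y).
Proof.
split=> [/eqP|h]; first by rewrite /qpi -Quotient.idealrBE => /asboolP.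
by apply/eqP; rewrite /qpi -Quotient.idealrBE; apply/asboolP.
Qed.

Lemma qpi_eq0 x : qpi x = 0 <-> U x.
Proof. by rewrite -(raddf0 qpi) qpi_eq subr0. Qed.

Lemma qpi_surj q : exists x, q = qpi x.
Proof. by exists (repr q); rewrite /qpi reprK. Qed.

Definition quo_scale (a : S) (q : quom) : quom := qpi (a *: repr q).

Lemma quo_scaleE a x : quo_scale a (qpi x) = qpi (a *: x).
Proof.
apply/qpi_eq; rewrite -scalerBr; apply: gsub_Z => //; apply/qpi_eq.
by rewrite /qpi reprK.
Qed.

Fact quo_scalerA a b q : quo_scale a (quo_scale b q) = quo_scale (a * b) q.
Proof. by have [x ->] := qpi_surj q; rewrite !quo_scaleE scalerA. Qed.
Fact quo_scale1r : left_id 1 quo_scale.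
Proof. by move=> q; have [x ->] := qpi_surj q; rewrite quo_scaleE scale1r. Qed.
Fact quo_scalerDr : right_distributive quo_scale +%R.
Proof.
move=> a q r; have [x ->] := qpi_surj q; have [y ->] := qpi_surj r.
by rewrite -raddfD !quo_scaleE scalerDr raddfD.
Qed.
Fact quo_scalerDl q : {morph quo_scale^~ q : a b / a + b}.
Proof. by move=> a b; have [x ->] := qpi_surj q; rewrite !quo_scaleE scalerDl raddfD. Qed.

HB.instance Definition _ := GRing.Zmodule_isLmodule.Build S quom
  quo_scalerA quo_scale1r quo_scalerDr quo_scalerDl.

Lemma qpiZ (a : S) x : qpi (a *: x) = a *: qpi x.
Proof. by rewrite -quo_scaleE. Qed.

Definition quo_proj (l : L) (q : quom) : quom := qpi (gproj l (repr q)).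

Lemma quo_projE l x : quo_proj l (qpi x) = qpi (gproj l x).
Proof.
apply/qpi_eq; rewrite -gprojB; apply: gsub_p => //; apply/qpi_eq.
by rewrite /qpi reprK.
Qed.

Fact quo_projB l : zmod_morphism (quo_proj l).
Proof.
move=> q r; have [x ->] := qpi_surj q; have [y ->] := qpi_surj r.
by rewrite -raddfB !quo_projE gprojB raddfB.
Qed.

Fact quo_projK l l' q : quo_proj l (quo_proj l' q) = if l == l' then quo_proj l q else 0.
Proof.
have [x ->] := qpi_surj q; rewrite !quo_projE gprojK.
by case: (l == l'); rewrite ?raddf0.
Qed.

Fact quo_proj_sum q : exists2 s : seq L, uniq s & q = \sum_(l <- s) quo_proj l q.
Proof.
have [x ->] := qpi_surj q; have [s us e] := gproj_sum x; exists s => //.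
rewrite {1}e raddf_sum; apply: eq_bigr => l _.
by rewrite quo_projE.
Qed.

Fact quo_proj_act d l (a : S) q : Shomog d a -> quo_proj l q = q ->
  quo_proj (d + l) (a *: q) = a *: q.
Proof.
move=> ha <-; have [x ->] := qpi_surj q.
by rewrite quo_projE -qpiZ quo_projE (gproj_actE _ _ ha) gproj_idem.
Qed.

Definition quo_gmod : gmod X := GMod quo_projB quo_projK quo_proj_sum quo_proj_act.

Hypothesis fgM : fin_gen M.

Lemma fin_gen_sub_gmod : fin_gen sub_gmod.
Proof.
have [s [hs Us]] := fin_gen_sub fgM (gsub_stable _ hU).
exists (size s), (fun i => mk_sub (hs _ (mem_nth 0 (ltn_ord i)))) => x.
have [c e] := rspanP (Us _ (submP x)); exists (fun i => c i).
by apply: subm_inj; rewrite subm_val_sum e; apply: eq_bigr => i _; rewrite subm_valZ.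
Qed.

Lemma fin_gen_quo_gmod : fin_gen quo_gmod.
Proof.
have [n [g hg]] := fgM; exists n, (fun i => qpi (g i)) => q.
have [x ->] := qpi_surj q; have [a ->] := hg x; exists a.
by rewrite raddf_sum; apply: eq_bigr => i _; apply: qpiZ.
Qed.

End SubQuotient.

(** * Coherent sheaves *)

Section Coherent.
Variables (k : fieldType) (X : weighted_line k).
Local Notation S := (Salg X).
Local Notation full := (fun _ : S => True).

(** The working principle for coh X: a membership up to saturation may be checked after
    multiplication by u^n and v^n, where x can be assumed to satisfy P exactly. *)
Lemma near_imp (M N : gmod X) (P : M -> Prop) (U : N -> Prop) x z : stable full U ->
  near P x -> (forall s : S, P (s *: x) -> near U (s *: z)) -> near U z.
Proof.
move=> sU [n [h1 h2]] h; apply: (near_near sU); exists n.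
by split; apply: h.
Qed.

Definition tors (M : gmod X) : M -> Prop := near (@gsub0 k X M).

Lemma gsub_tors (M : gmod X) : gsub (@tors M).
Proof. by apply: gsub_near; apply: gsub_zero. Qed.

Lemma stable_tors (M : gmod X) : stable full (@tors M).
Proof. by apply: gsub_stable; apply: gsub_tors. Qed.

Lemma stable_gsub0 (M : gmod X) : stable full (@gsub0 k X M).
Proof. by apply: gsub_stable; apply: gsub_zero. Qed.

Lemma tors0 (M : gmod X) : tors (0 : M).
Proof. exact: stable0 (stable_tors M). Qed.

Definition range (M N : Type) (F : M -> N -> Prop) : N -> Prop := fun y => exists x, F x y.
Definition rker (M : Type) (N : zmodType) (F : M -> N -> Prop) : M -> Prop := fun x => F x 0.

Lemma gsub_range (M N : gmod X) (F : M -> N -> Prop) : grel F -> gsub (range F).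
Proof. by move=> hF; apply: (gsub_rdom (grel_conv hF)). Qed.

Lemma gsub_rker (M N : gmod X) (F : M -> N -> Prop) : grel F -> gsub (rker F).
Proof. by move=> hF; apply: (gsub_rindet (grel_conv hF)). Qed.

Lemma grel_comp (M N Q : gmod X) (F : M -> N -> Prop) (G : N -> Q -> Prop) :
  grel F -> grel G -> grel (rcomp G F).
Proof.
move=> [f0 fD fp] [g0 gD gp]; split; first by exists 0.
- move=> a x z x' z' [y fy gz] [y' fy' gz'].
  by exists (a *: y + y'); [exact: fD|exact: gD].
- by move=> l x z [y fy gz]; exists (gproj l y); [exact: fp|exact: gp].
Qed.

Implicit Types M N : fgmod X.

Section Qmor.
Variables (M N : fgmod X) (F : qmor M N).

Lemma qmor_dom x : near (rdom F) x.
Proof.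
have h := cofinsub_dom F; have [hD _] := h.
exact: (iffLR (cofinsub_near (fgmod_fg M) hD) h x).
Qed.

Lemma qmor_indet y : F 0 y -> tors y.
Proof.
have h := finsub_indet F; have [hI _] := h; move=> f.
exact: (iffLR (finsub_near (fgmod_fg N) hI) h).
Qed.

Lemma qmor_tors x y y' : F x y -> F x y' -> tors (y - y').
Proof.
move=> f f'; apply: qmor_indet; rewrite -(subrr x); exact: (grel_B (qgraph_rel F)).
Qed.

End Qmor.

Lemma qmor_build M N (G : M -> N -> Prop) : grel G -> (forall x, near (rdom G) x) ->
  (forall y, G 0 y -> tors y) -> exists F : qmor M N, qgraph F = G.
Proof.
move=> hG hD hI.
have h1 : cofinsub (rdom G) by apply/(cofinsub_near (fgmod_fg M) (gsub_rdom hG)).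
have h2 : finsub (rindet G) by apply/(finsub_near (fgmod_fg N) (gsub_rindet hG)).
by exists (mkqmor hG h1 h2).
Qed.

(** For finitely generated modules the torsion submodule of N is the largest admissible N'', so the
    colimit can be tested there, on the common domain of F and G. *)
Lemma qhom_eq M N (F G : qmor M N) : \pi_(qhom M N) F = \pi_(qhom M N) G <->
  forall x y y', F x y -> G x y' -> tors (y - y').
Proof.
split=> [/eqquotP/asboolP [A [B [[hA AF AG] [hB FB GB h]]]] x y y' f g|h]; last first.
  apply: qhomP; exists (gand (rdom F) (rdom G)), (@tors N).
  have hT : finsub (@tors N).
    by apply/(finsub_near (fgmod_fg N) (gsub_tors N)).
  split; split=> //.
  - by apply: cofinsub_and; apply: cofinsub_dom.
  - by move=> x [].
  - by move=> x [].
  - by move=> y; apply: qmor_indet.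
  - by move=> y; apply: qmor_indet.
  - by move=> x y y' _; apply: h.
have [gA _] := hA; have [gB _] := hB.
have nA := (iffLR (cofinsub_near (fgmod_fg M) gA) hA x).
apply: (near_imp (stable_gsub0 N) nA) => s As; rewrite scalerBr.
apply: (iffLR (finsub_near (fgmod_fg N) gB) hB); apply: (h (s *: x)) => //.
  exact: (grel_Z (qgraph_rel F)).
exact: (grel_Z (qgraph_rel G)).
Qed.

Lemma qhom_eq0 M N (F : qmor M N) :
  \pi_(qhom M N) F = 0 :> @hom (coh X) M N <-> forall x y, F x y -> tors y.
Proof.
split=> [/qhom_eq h x y f|h].
  by rewrite -(subr0 y); apply: (h x).
by apply/qhom_eq => x y y' f ->; rewrite subr0; apply: h f.
Qed.

Lemma coh_compE M N (Q : fgmod X) (G : qmor N Q) (F : qmor M N) :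
  @comp (coh X) M N Q (\pi_(qhom N Q) G) (\pi_(qhom M N) F) =
  \pi_(qhom M Q) (qcomp G F) :> @hom (coh X) M Q.
Proof. exact: pi_hcomp. Qed.

Section Criterion.
Variables (A E B : fgmod X) (i : qmor A E) (p : qmor E B).
Hypothesis ker_i : forall a, i a 0 -> tors a.
Hypothesis surj_p : forall b, near (range p) b.
Hypothesis pi0 : forall a e b, i a e -> p e b -> tors b.
Hypothesis ker_p : forall e, p e 0 -> near (range i) e.

Let hi := qgraph_rel i.
Let hp := qgraph_rel p.

Lemma tors_ker_i a e : i a e -> tors e -> tors a.
Proof.
move=> ia te; apply: (near_imp (stable_gsub0 A) te) => s se.
by apply: ker_i; have := grel_Z hi s ia; rewrite se.
Qed.

Lemma tors_near_range e b : p e b -> tors b -> near (range i) e.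
Proof.
move=> pe tb; apply: (near_imp (gsub_stable _ (gsub_range hi)) tb) => s sb.
by apply: ker_p; have := grel_Z hp s pe; rewrite sb.
Qed.

(** Exactness up to finite length suffices: a morphism is lifted along i, or descended along p, by
    composing with the converse relation. *)
Lemma ses_criterion :
  @short_exact (coh X) A E B (\pi_(qhom A E) i) (\pi_(qhom E B) p).
Proof.
apply: short_exactI.
- by rewrite coh_compE; apply/qhom_eq0 => a b [e]; apply: pi0.
- move=> D; elim/qhomW => h; rewrite coh_compE => /qhom_eq0 h0.
  apply/qhom_eq0 => d a hda.
  apply: (near_imp (stable_gsub0 A) (qmor_dom i a)) => s [e ie].
  apply: (tors_ker_i ie); apply: (h0 (s *: d)); exists (s *: a) => //.
  exact: (grel_Z (qgraph_rel h)).
- move=> D; elim/qhomW => h; rewrite coh_compE => /qhom_eq0 h0.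
  apply/qhom_eq0 => b d hbd.
  apply: (near_imp (stable_gsub0 D) (surj_p b)) => s [e pe].
  by apply: (h0 e); exists (s *: b) => //; apply: (grel_Z (qgraph_rel h)).
- move=> D; elim/qhomW => f; rewrite coh_compE => /qhom_eq0 pf0.
  have hf := qgraph_rel f.
  have [|||g gE] := @qmor_build D A (rcomp (rconv i) f).
  + by apply: grel_comp => //; apply: grel_conv.
  + move=> d; have hg := gsub_rdom (grel_comp hf (grel_conv hi)).
    have sg := gsub_stable full hg.
    apply: (near_imp sg (qmor_dom f d)) => s [e fe].
    apply: (near_imp sg (qmor_dom p e)) => s' [b pb].
    have tb : tors b by apply: (pf0 (s' *: (s *: d))); exists (s' *: e) => //; apply: grel_Z.
    apply: (near_imp sg (tors_near_range pb tb)) => s'' [a ia].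
    by apply: near_sub; exists a; exists (s'' *: (s' *: e)) => //; do 2!apply: grel_Z => //.
  + move=> a [e f0 ia]; apply: (tors_ker_i ia); exact: qmor_indet f0.
  exists (\pi_(qhom D A) g); rewrite coh_compE; apply/qhom_eq => d e' e''.
  move=> [a]; rewrite gE => -[e fe ia ia' fe''].
  rewrite -(subrK e e') -addrA; apply: (stableD (stable_tors E)).
    exact: qmor_tors ia' ia.
  exact: qmor_tors fe fe''.
- move=> D; elim/qhomW => f; rewrite coh_compE => /qhom_eq0 fi0.
  have hf := qgraph_rel f.
  have tf e d : p e 0 -> f e d -> tors d.
    move=> /ker_p ne fd; apply: (near_imp (stable_gsub0 D) ne) => s [a ia].
    by apply: (fi0 a); exists (s *: e) => //; apply: grel_Z.
  have [|||g gE] := @qmor_build B D (rcomp f (rconv p)).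
  + by apply: grel_comp => //; apply: grel_conv.
  + move=> b; have sg := gsub_stable full (gsub_rdom (grel_comp (grel_conv hp) hf)).
    apply: (near_imp sg (surj_p b)) => s [e pe].
    apply: (near_imp sg (qmor_dom f e)) => s' [d fd].
    by apply: near_sub; exists d; exists (s' *: e) => //; apply: (grel_Z hp).
  + by move=> d [e pe fd]; apply: (tf e).
  exists (\pi_(qhom B D) g); rewrite coh_compE; apply/qhom_eq => e d d''.
  move=> [b pb]; rewrite gE => -[e' pe' fd fd''].
  apply: (tf (e' - e)); last exact: (grel_B hf).
  by rewrite -(subrr b); apply: (grel_B hp).
Qed.

End Criterion.

Section SubMaps.
Variables (M : fgmod X) (U : M -> Prop) (hU : gsub U).

Definition sub_fg : fgmod X := FGMod (fin_gen_sub_gmod hU (fgmod_fg M)).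
Definition quo_fg : fgmod X := FGMod (fin_gen_quo_gmod hU (fgmod_fg M)).

Lemma tors_sub (x : sub_fg) : tors (subm_val x : M) -> tors x.
Proof.
by move=> [n [h1 h2]]; exists n; split; apply: subm_inj; rewrite subm_valZ subm_val0.
Qed.

Lemma sub_incl_ex : exists i : qmor sub_fg M, forall x y, i x y <-> subm_val x = y.
Proof.
have [|||i iE] := @qmor_build sub_fg M (fun x y => subm_val x = y).
- split=> [|a x y x' y' <- <-|l x y <-] //.
- by move=> x; apply: near_sub; exists (subm_val x).
- by move=> y <-; apply: tors0.
by exists i => x y; rewrite iE.
Qed.

Lemma quo_proj_ex : exists p : qmor M quo_fg, forall x y, p x y <-> qpi hU x = y.
Proof.
have [|||i iE] := @qmor_build M quo_fg (fun x y => qpi hU x = y).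
- split=> [|a x y x' y' <- <-|l x y <-].
  + exact: raddf0.
  + by rewrite raddfD /= qpiZ.
  + by rewrite -quo_projE.
- by move=> x; apply: near_sub; exists (qpi hU x).
- by move=> y <-; rewrite raddf0; apply: tors0.
by exists i => x y; rewrite iE.
Qed.

Lemma sub_factor (N : fgmod X) (F : qmor N M) : (forall x y, F x y -> U y) ->
  exists e : qmor N sub_fg, forall x y, e x y <-> F x (subm_val y).
Proof.
move=> FU; have hF := qgraph_rel F.
have [|||i iE] := @qmor_build N sub_fg (fun x y => F x (subm_val y)).
- split=> [|a x y x' y' f f'|l x y f].
  + exact: grel_0.
  + by case: hF => _ h _; apply: h.
  + exact: (grel_p hF).
- move=> x; have [n [[y1 f1] [y2 f2]]] := qmor_dom F x; exists n.
  by split; [exists (mk_sub (FU _ _ f1) : sub_fg)|exists (mk_sub (FU _ _ f2) : sub_fg)].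
- by move=> y /qmor_indet/tors_sub.
by exists i => x y; rewrite iE.
Qed.

End SubMaps.

Lemma coh_has_images : has_images (coh X).
Proof.
move=> A B; elim/qhomW => F; have hF := qgraph_rel F.
have gK := gsub_rker hF; have gR := gsub_range hF.
have [i iE] := sub_incl_ex gK; have [m mE] := sub_incl_ex gR; have [c cE] := quo_proj_ex gR.
have [|e eE] := @sub_factor B _ gR A F; first by move=> x y f; exists x.
exists (sub_fg gK), (sub_fg gR), (quo_fg gR).
exists (\pi_(qhom _ _) i), (\pi_(qhom _ _) e), (\pi_(qhom _ _) m), (\pi_(qhom _ _) c); split.
- apply: ses_criterion.
  + by move=> a /iE a0; rewrite (_ : a = 0); [apply: tors0|apply: subm_inj].
  + by move=> b; apply: near_sub; have [x f] := submP b; exists x; apply/eE.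
  + move=> a x b /iE <- /eE f; apply: tors_sub; apply: (@qmor_indet _ _ F).
    by have := grel_B hF f (submP a); rewrite subrr subr0.
  + by move=> x /eE f; apply: near_sub; exists (@mk_sub _ _ _ (rker F) _ f : sub_fg gK); apply/iE.
- apply: ses_criterion.
  + by move=> a /mE a0; rewrite (_ : a = 0); [apply: tors0|apply: subm_inj].
  + by move=> q; apply: near_sub; have [y ->] := qpi_surj q; exists y; apply/cE.
  + move=> a y q /mE <- /cE <-; rewrite (iffRL (qpi_eq0 gR _) (submP a)); exact: tors0.
  + by move=> y /cE/qpi_eq0 h; apply: near_sub; exists (mk_sub h : sub_fg gR); apply/mE.
rewrite coh_compE; apply/qhom_eq => x y y' [s /eE f /mE <-] f'.
exact: qmor_tors f f'.
Qed.

Section ShortExactModules.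
Variables (A E B : fgmod X) (i : qmor A E) (p : qmor E B).
Hypothesis ip : @short_exact (coh X) A E B (\pi_(qhom A E) i) (\pi_(qhom E B) p).

Lemma ses_range_ker e b : near (range i) e -> p e b -> tors b.
Proof.
move=> ni pe; apply: (near_imp (stable_gsub0 B) ni) => s [a ia].
have := ses_comp0 ip; rewrite coh_compE => /qhom_eq0/(_ a); apply.
by exists (s *: e) => //; apply: (grel_Z (qgraph_rel p)).
Qed.

(** The kernel property is tested on the inclusion of the module-theoretic kernel of p; its lift
    through i shows that multiples of e come from A. *)
Lemma ses_ker_range e : p e 0 -> near (range i) e.
Proof.
move=> pe; have gK := gsub_rker (qgraph_rel p).
have [f fE] := sub_incl_ex gK.
have [|g] := ses_lift ip (f := \pi_(qhom _ _) f).
  rewrite coh_compE; apply/qhom_eq0 => x b [y /fE <- h].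
  by apply: (@qmor_indet _ _ p); have := grel_B (qgraph_rel p) h (submP x); rewrite subrr subr0.
elim/qhomW: g => g; rewrite coh_compE => /qhom_eq h.
have sR := gsub_stable full (gsub_range (qgraph_rel i)).
apply: (near_imp sR (qmor_dom g (@mk_sub _ _ _ (rker p) _ pe : sub_fg gK))) => s [z gz].
apply: (near_imp sR (qmor_dom i z)) => s' [y iy].
have t : tors (y - s' *: (s *: e)).
  apply: (h (s' *: (s *: (@mk_sub _ _ _ (rker p) _ pe : sub_fg gK)))); last by apply/fE; rewrite !subm_valZ.
  by exists (s' *: z) => //; apply: (grel_Z (qgraph_rel g)).
apply: (near_imp sR t) => s'' e0; apply: near_sub; exists (s'' *: (s' *: z)).
have -> : s'' *: (s' *: (s *: e)) = s'' *: y.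
  by apply/eqP; rewrite eq_sym -subr_eq0 -scalerBr e0.
exact: (grel_Z (qgraph_rel i)).
Qed.

Lemma ses_near_range e b : p e b -> tors b -> near (range i) e.
Proof.
move=> pe tb; have sR := gsub_stable full (gsub_range (qgraph_rel i)).
apply: (near_imp sR tb) => s sb; apply: ses_ker_range.
by have := grel_Z (qgraph_rel p) s pe; rewrite sb.
Qed.

End ShortExactModules.

(** Inclusion of subobjects of E in coh X becomes inclusion of the saturated images. *)
Lemma coh_comp_eq0 (A A' E B B' : fgmod X) (i : qmor A E) (p : qmor E B) (i' : qmor A' E) (p' : qmor E B') :
  @short_exact (coh X) A E B (\pi_(qhom A E) i) (\pi_(qhom E B) p) ->
  @short_exact (coh X) A' E B' (\pi_(qhom A' E) i') (\pi_(qhom E B') p') ->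
  @comp (coh X) A E B' (\pi_(qhom E B') p') (\pi_(qhom A E) i) = 0 <->
  subset (near (range i)) (near (range i')).
Proof.
move=> s s'; have gR := gsub_range (qgraph_rel i'); have sR := gsub_stable full gR.
split=> [|h]; rewrite coh_compE.
  move=> /qhom_eq0 h e ne; apply: (near_imp sR ne) => t [a ia].
  apply: (near_imp sR (qmor_dom p' (t *: e))) => t' [b pb].
  apply: (ses_near_range s' pb); apply: (h (t' *: a)); exists (t' *: (t *: e)) => //.
  exact: (grel_Z (qgraph_rel i)).
apply/qhom_eq0 => a b [e ia pe]; apply: (ses_range_ker s' _ pe); apply: h.
by apply: near_sub; exists a.
Qed.

Lemma coh_sub_acc : sub_acc (coh X).
Proof.
move=> E A B a b ses le.
pose i n : qmor (A n) E := repr (a n); pose p n : qmor E (B n) := repr (b n).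
have aE n : a n = \pi_(qhom (A n) E) (i n) by rewrite reprK.
have bE n : b n = \pi_(qhom E (B n)) (p n) by rewrite reprK.
have ses' n : @short_exact (coh X) _ _ _ (\pi_(qhom (A n) E) (i n)) (\pi_(qhom E (B n)) (p n)).
  by rewrite -aE -bE.
have [||n x nx|m hm] := fin_gen_acc (fgmod_fg E) (W := fun n => near (range (i n))) _ _.
- by move=> n; apply: near_stable; apply: gsub_stable; apply: gsub_range; apply: qgraph_rel.
- by [].
- by apply: (iffLR (coh_comp_eq0 (ses' n) (ses' n.+1))) nx; rewrite -aE -bE.
exists m; rewrite aE bE; apply/(coh_comp_eq0 (ses' m.+1) (ses' m)); exact: hm.
Qed.

(** In the last hypothesis G stands for a morphism from W_n to M / W_n in coh X: its domain is W_n
    up to saturation and its indeterminacy lies in W_n. The hypothesis says that all these morphisms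
    vanish. *)
Definition module_dcc : Prop := forall (M : fgmod X) (W : nat -> M -> Prop),
  (forall n, gsub (W n)) -> (forall n, saturated (W n)) ->
  (forall n, subset (W n.+1) (W n)) ->
  (forall n (G : M -> M -> Prop), grel G -> subset (W n) (near (rdom G)) ->
     (forall z, G 0 z -> W n z) -> forall y z, W n y -> G y z -> W n z) ->
  exists n, subset (W n) (W n.+1).

Lemma coh_torsion_dcc : module_dcc -> torsion_dcc (coh X).
Proof.
move=> dcc E A B a b ses le hom0.
pose i n : qmor (A n) E := repr (a n); pose p n : qmor E (B n) := repr (b n).
have aE n : a n = \pi_(qhom (A n) E) (i n) by rewrite reprK.
have bE n : b n = \pi_(qhom E (B n)) (p n) by rewrite reprK.
have ses' n : @short_exact (coh X) _ _ _ (\pi_(qhom (A n) E) (i n)) (\pi_(qhom E (B n)) (p n)).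
  by rewrite -aE -bE.
have gR n := gsub_range (qgraph_rel (i n)).
have sR n := gsub_stable full (gR n).
have [|||n G hG hD hI y z wy g|n h] := dcc E (fun n => near (range (i n))).
- by move=> n; apply: gsub_near.
- by move=> n; apply: saturated_near.
- by move=> n; apply/(coh_comp_eq0 (ses' n.+1) (ses' n)); rewrite -aE -bE.
(* Between the inclusion of A_n and the projection to B_n, the relation G becomes a morphism in coh
   X, which is zero by [hom0]. *)
- have [|||F FE] := @qmor_build (A n) (B n) (rcomp (p n) (rcomp G (i n))).
  + by apply: grel_comp; [apply: grel_comp => //|]; apply: qgraph_rel.
  + move=> x; have hg := gsub_rdom (grel_comp (grel_comp (qgraph_rel (i n)) hG) (qgraph_rel (p n))).
    have sg := gsub_stable full hg.
    apply: (near_imp sg (qmor_dom (i n) x)) => s [e ie].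
    have ne : near (rdom G) e by apply: hD; apply: near_sub; exists (s *: x).
    apply: (near_imp sg ne) => s' [e' ge].
    apply: (near_imp sg (qmor_dom (p n) e')) => s'' [c pc].
    apply: near_sub; exists c; exists (s'' *: e') => //; exists (s'' *: (s' *: e)).
      by do 2!apply: (grel_Z (qgraph_rel (i n))).
    exact: (grel_Z hG).
  + move=> c [e' [e i0 ge] pe]; have te := qmor_indet i0.
    apply: (near_imp (stable_gsub0 _) te) => s se.
    apply: (ses_range_ker (ses' n) (e := s *: e')); last exact: (grel_Z (qgraph_rel (p n))).
    by apply: hI; have := grel_Z hG s ge; rewrite se.
  have /qhom_eq0 h0 := hom0 n (\pi_(qhom (A n) (B n)) F).
  have wy' : near (range (i n)) y by [].
  apply: (near_imp (sR n) wy') => s [x ix].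
  apply: (near_imp (sR n) (qmor_dom (p n) (s *: z))) => s' [c pc].
  apply: (ses_near_range (ses' n) pc); apply: (h0 (s' *: x)); rewrite FE.
  exists (s' *: (s *: z)) => //; exists (s' *: (s *: y)).
    exact: (grel_Z (qgraph_rel (i n))).
  by do 2!apply: (grel_Z hG).
by exists n; rewrite aE bE; apply/(coh_comp_eq0 (ses' n) (ses' n.+1)).
Qed.

End Coherent.

(** * Descending chains of torsion subobjects *)

Section TorsionRank.
Variables (k : closedFieldType) (X : weighted_line k).
Local Notation I := 'I_(npts X).
Local Notation S := (Salg X).
Local Notation cdeg := (cdeg X).
Local Notation u := (u X).
Local Notation v := (v X).
Local Notation lin := (lin X).
Local Notation scal := (scal X).
Local Notation hform := (hform X).
Local Notation xg := (@xg k X).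
Local Notation full := (fun _ : S => True).
Local Notation Theta := (@Theta k X).

(** The rings k[u, v] and k[f] act through polynomial rings, which are domains as [rank_chain]
    demands. *)
Definition uv (i : 'I_2) : S := if i == ord0 then u else v.
Definition ev2 : {rmorphism {mpoly k[2]} -> S} := mmap scal uv.
Definition ev1 (f : S) : {rmorphism {poly k} -> S} := horner_eval f \o map_poly scal.

Lemma ev2E d : ev2 d = \sum_(m <- msupp d) scal d@_m * (u ^+ m ord0 * v ^+ m ord_max).
Proof.
rewrite /ev2 /= /mmap; apply: eq_bigr => m _; congr (_ * _).
rewrite /mmap1 big_ord_recl big_ord1 /uv /=; congr (_ * v ^+ m _); exact: val_inj.
Qed.

Lemma ev2_lin a b : exists d, lin a b = ev2 d.
Proof.
exists (a%:MP * 'X_ord0 + b%:MP * 'X_ord_max).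
by rewrite rmorphD !rmorphM /= !mmapC !mmapX !mmap1U /uv.
Qed.

Lemma ev1E f p : ev1 f p = \sum_(i < size p) scal p`_i * f ^+ i.
Proof.
rewrite /ev1 /= /horner_eval (horner_coef_wide _ (size_poly _ _)).
by apply: eq_bigr => i _; rewrite coef_map.
Qed.

Lemma ev1_X f : ev1 f 'X = f.
Proof. by rewrite /ev1 /= /horner_eval map_polyX hornerX. Qed.

Section OneModule.
Variable M : gmod X.
Implicit Types (U V W Y : M -> Prop).

(* Torsion of M / V over k[u, v]. *)
Definition ttors V : M -> Prop := fun x => exists2 t, Theta t & V (t *: x).

Lemma ttors_sub V : subset V (ttors V).
Proof. by move=> x vx; exists 1; rewrite ?scale1r //; apply: atoms_prod1. Qed.

Lemma ttors_stable V : stable full V -> stable full (ttors V).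
Proof.
move=> sV; split.
- by exists 1; [apply: atoms_prod1|rewrite scaler0; apply: stable0 sV].
- move=> x y [t ht tx] [t' ht' ty]; exists (t * t'); first exact: atoms_prod_mul.
  rewrite scalerBr [in X in V (X - _)]mulrC -!scalerA.
  by apply: (stableB sV); apply: (stableZ sV).
- move=> o x _ [t ht tx]; exists t => //.
  by rewrite scalerA mulrC -scalerA; apply: (stableZ sV).
Qed.

Lemma gsub_ttors V : gsub V -> gsub (ttors V).
Proof.
move=> hV; have sV := gsub_stable full hV; have sT := ttors_stable sV.
split; [exact: stable0 sT|move=> a x y tx ty|move=> l x [t ht tx]].
  by apply: (stableD sT) => //; apply: (stableZ sT).
exists t => //; have [n hn] := Theta_homog ht.
by rewrite -(gproj_actE _ _ hn); apply: gsub_p.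
Qed.

Lemma ttors_mono U V : subset U V -> subset (ttors U) (ttors V).
Proof. by move=> s x [t ht /s]; exists t. Qed.

Lemma ttors_ttors V : subset (ttors (ttors V)) (ttors V).
Proof.
move=> x [t ht [t' ht' tx]]; exists (t' * t); first exact: atoms_prod_mul.
by rewrite -scalerA.
Qed.

(** Since V is graded and x homogeneous, any single homogeneous component of d also maps x into V. A
    nonzero one is a binary form and hence a product of linear forms. *)
Lemma ev2_torsion V l x d : gsub V -> gproj l x = x -> d != 0 -> V (ev2 d *: x) -> ttors V x.
Proof.
move=> hV hx d0 vx.
have [m0 hm0] : exists m, m \in msupp d.
  case E : (msupp d) => [|m s]; last by exists m; rewrite mem_head.
  by move/eqP: E; rewrite msupp_eq0 (negbTE d0).
set n := (m0 ord0 + m0 ord_max)%N.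
pose P (m : 'X_{1..2}) := (m ord0 + m ord_max)%N == n.
pose p := \sum_(m <- msupp d | P m) d@_m *: 'X^(m ord_max) : {poly k}.
have hp : hform n p = \sum_(m <- msupp d | P m) scal d@_m * (u ^+ m ord0 * v ^+ m ord_max).
  have h0 : hform n 0 = 0 by rewrite hform0.
  rewrite (big_morph (hform n) (hformD X n) h0); apply: eq_bigr => m /eqP e.
  rewrite hformZ; congr (_ * _); rewrite /hform.
  have lt_m : (m ord_max < n.+1)%N by rewrite ltnS -e leq_addl.
  rewrite (bigD1 (Ordinal lt_m)) //= coefXn eqxx rmorph1 mul1r big1 ?addr0 => [|j ne].
    by rewrite -e addnK mulrC.
  rewrite coefXn; case: eqP => [ej|_]; last by rewrite rmorph0 mul0r.
  by case/eqP: ne; apply: val_inj.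
have gv : V (hform n p *: x).
  have := gsub_p hV (cdeg *+ n + l) vx; rewrite ev2E scaler_suml gproj_sumE.
  congr V; rewrite hp scaler_suml [RHS]big_mkcond; apply: eq_bigr => m _.
  have h : Shomog (cdeg *+ (m ord0 + m ord_max)) (scal d@_m * (u ^+ m ord0 * v ^+ m ord_max)).
    by apply: Shomog_scalM; rewrite mulrnDr; apply: Shomog_mul; [apply: uE_homog|apply: vE_homog].
  rewrite -(gproj_act h hx) gprojK (inj_eq (addIr l)) /P.
  have -> : (cdeg *+ n == cdeg *+ (m ord0 + m ord_max)) = (m ord0 + m ord_max == n)%N.
    by apply/eqP/eqP => [/(@cdeg_inj _ X) ->|->].
  by case: eqP => [->|].
have sp : (size p <= n.+1)%N.
  apply: (leq_trans (size_sum _ _ _)); apply/bigmax_leqP_seq => m _ /eqP e.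
  by rewrite (leq_trans (size_scale_leq _ _)) // size_polyXn ltnS -e leq_addl.
have p0 : p != 0.
  apply/eqP => p0; have := congr1 (fun q : {poly k} => q`_(m0 ord_max)) p0.
  rewrite coef0 /p coef_sum big_mkcond (bigD1_seq m0) ?msupp_uniq //= /P eqxx.
  rewrite coefZ coefXn eqxx mulr1 big1_seq => [|m /andP[ne _]].
    by rewrite addr0 => /eqP; rewrite mcoeff_eq0 hm0.
  case: eqP => // e; rewrite coefZ coefXn; case: eqP => [e1|]; last by rewrite mulr0.
  case/eqP: ne; apply/mnmP => i; have e0 : m ord0 = m0 ord0.
    by apply/eqP; rewrite -(eqn_add2r (m ord_max)) e -e1.
  have [-> //|ne] := eqVneq i ord0.
  by have -> : i = ord_max; [apply: val_inj; case: i ne => -[|[|]]|].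
by exists (hform n p) => //; apply: hform_atoms.
Qed.

(** The powers of a linear form have distinct degrees, so the leading term of p alone maps x into
    V. *)
Lemma ev1_torsion V l x a b p : gsub V -> gproj l x = x -> p != 0 ->
  V (ev1 (lin a b) p *: x) -> exists n, V (lin a b ^+ n *: x).
Proof.
move=> hV hx p0 vx.
have sp : (0 < size p)%N by rewrite size_poly_gt0.
exists (size p).-1; have lt_p : ((size p).-1 < size p)%N by rewrite prednK.
have lc : p`_(size p).-1 != 0 by rewrite -[_`_ _]/(lead_coef p) lead_coef_eq0.
have := gsub_p hV (cdeg *+ (size p).-1 + l) vx; rewrite ev1E scaler_suml gproj_sumE.
have hh c n : Shomog (cdeg *+ n) (scal c * lin a b ^+ n).
  by apply: Shomog_scalM; apply: Shomog_exp; apply: Shomog_lin.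
rewrite (bigD1 (Ordinal lt_p)) //= (gproj_act (hh _ _) hx) big1 ?addr0 => [h|i ne].
  rewrite -[lin a b ^+ _]mul1r -(rmorph1 scal) -(mulVf lc) rmorphM -mulrA -scalerA.
  exact: gsub_Z.
rewrite -(gproj_act (hh _ _) hx) gprojK (inj_eq (addIr l)).
case: eqP => // /(@cdeg_inj _ X) e; case/eqP: ne; apply: val_inj; exact: esym.
Qed.

Definition small (e : I -> nat) : S := \prod_i xg i ^+ e i.

(** Over k[u, v] the algebra S is generated by the monomials with exponents below the weights:
    division with remainder turns the rest into linear forms. *)
Lemma span_small (O : S -> Prop) V (s : seq M) : stable O V -> (forall c, O (scal c)) ->
  (forall (b e : I -> nat) g, g \in s -> (forall i, (e i < wt i)%N) ->
     V ((\prod_i lin (xu i) (xv i) ^+ b i * small e) *: g)) ->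
  subset (rspan (idfun : S -> S) (eq 0) s) V.
Proof.
move=> sV Oc; elim: s => [|g s IHs] h x /=; first by move=> <-; apply: stable0 sV.
move=> [a [y [hy ->]]]; apply: (stableD sV); last first.
  by apply: IHs hy => b e g' gs; apply: h; rewrite inE gs orbT.
have [q ->] := S_repr a; rewrite sproj_sum scaler_suml; apply: (stable_sum sV) => m _.
rewrite -scalerA; apply: (stableZ sV) => //.
have -> : \prod_i xg i ^+ m i = \prod_i lin (xu i) (xv i) ^+ (m i %/ wt i) * small (fun i => m i %% wt i)%N.
  rewrite -big_split /=; apply: eq_bigr => i _.
  by rewrite -xg_wt -exprM -exprD mulnC -divn_eq.
by apply: h => [|i]; [apply: mem_head|rewrite ltn_mod wt_gt0].
Qed.

(** The sum of the weights is a common bound for all exponents, which yields a finite type of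
    exponent vectors. *)
Definition bounded_exp := {ffun I -> 'I_(\sum_i @wt k X i).+1}.
Definition smallf (e : bounded_exp) : S := small (fun i => e i).

Definition smalls (s : seq M) : seq M :=
  [seq smallf e *: g | e <- enum bounded_exp, g <- s].

Lemma smalls_mem (s : seq M) (e : I -> nat) g : g \in s -> (forall i, (e i < wt i)%N) ->
  small e *: g \in smalls s.
Proof.
move=> gs he.
have -> : small e = smallf [ffun i => inord (e i)].
  apply: eq_bigr => i _; rewrite ffunE inordK // ltnS.
  by apply: leq_trans (ltnW (he i)) _; rewrite (bigD1 i) //= leq_addr.
by apply: allpairs_f; rewrite ?mem_enum.
Qed.

End OneModule.

End TorsionRank.

(** * Finite generation over k[u, v] and over k[f] *)

Section TorsionChains.
Variables (k : closedFieldType) (X : weighted_line k).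
Local Notation S := (Salg X).
Local Notation lin := (lin X).
Local Notation scal := (scal X).
Local Notation full := (fun _ : S => True).
Local Notation Theta := (@Theta k X).
Variable M : gmod X.
Hypothesis fgM : fin_gen M.
Implicit Types (U V W Y : M -> Prop).

Lemma stable_dilate (a : S) V : stable full V -> stable full (dilate a V).
Proof.
move=> sV; split.
- by exists 0; rewrite ?scaler0 //; apply: stable0 sV.
- by move=> _ _ [x vx ->] [y vy ->]; exists (x - y); rewrite ?scalerBr //; apply: (stableB sV).
- move=> o _ _ [x vx ->]; exists (o *: x); first exact: (stableZ sV).
  by rewrite !scalerA mulrC.
Qed.

Lemma stable_idspan (s : seq M) : stable full (rspan (idfun : S -> S) (eq 0) s).
Proof.
have := @stable_rspan S M S (idfun : {rmorphism S -> S}) (eq 0) s (stable_zero _ _).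
by apply: stable_sub => a _; exists a.
Qed.

Lemma span_ev2 (s : seq M) :
  subset (rspan (idfun : S -> S) (eq 0) s) (rspan (ev2 X) (eq 0) (smalls s)).
Proof.
have sR := stable_rspan (smalls s) (@stable_zero S M (coefs (ev2 X))).
apply: (span_small sR) => [c|b e g gs he].
  by exists c%:MP; rewrite /= mmapC.
rewrite -scalerA; apply: (stableZ sR); last by apply: rspan_mem => //; apply: smalls_mem.
elim/big_ind: _ => [|_ _ [c ->] [d ->]|i _].
- by exists 1; rewrite rmorph1.
- by exists (c * d); rewrite rmorphM.
by have [d ->] := ev2_lin X (xu i) (xv i); exists (d ^+ b i); rewrite rmorphXn.
Qed.

(* Every step with W_j / W_(j+1) not torsion lowers the rank over k[u, v]. *)
Lemma rank_stabilizes (W : nat -> M -> Prop) : (forall n, gsub (W n)) ->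
  (forall n, subset (W n.+1) (W n)) ->
  exists N, forall j, (N <= j)%N -> subset (W N) (ttors (W j)).
Proof.
move=> gW decW; apply: contrapT => h.
have leW i j : (i <= j)%N -> subset (W j) (W i).
  move=> /subnK <-; elim: (j - i)%N => [y //|n IH]; rewrite addSn => y wy.
  by apply: IH; apply: decW.
have /choice[nxt hn] : forall N, exists j, (N <= j)%N /\ ~ subset (W N) (ttors (W j)).
  move=> N; apply: contrapT => hN; apply: h; exists N => j le_j; apply: contrapT => hs.
  by apply: hN; exists j.
have [s [_ hs]] := fin_gen_sub fgM (gsub_stable full (gsub_T M)).
pose f i := iter i nxt 0%N.
have [||||j _ hj] := @rank_chain S M _ (ev2 X) (eq 0) (stable_zero _ _) (smalls s) (fun i => W (f i)).
- by move=> i; apply: gsub_stable.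
- by move=> i _; apply: leW; case: (hn (f i)).
- by move=> i x <-; apply: stable0 (gsub_stable full (gW _)).
- by move=> x _; apply: span_ev2; apply: hs.
case: (hn (f j)) => _; apply; apply: gsub_homog => //.
  by apply: ttors_stable; apply: gsub_stable.
move=> l x hx wx; have [d d0 vx] := hj x wx.
exact: ev2_torsion hx d0 vx.
Qed.

Lemma ttors_uniform U V : gsub U -> gsub V -> subset U (ttors V) ->
  exists2 t, Theta t & forall x, U x -> V (t *: x).
Proof.
move=> hU hV UV; have sV := gsub_stable full hV.
have [s [hs Us]] := fin_gen_sub fgM (gsub_stable full hU).
have [t ht tV] : exists2 t, Theta t & forall x, x \in s -> V (t *: x).
  have : forall x, x \in s -> ttors V x by move=> x /hs/UV.
  elim: (s) => [_|x s' IHs h]; first by exists 1 => //; apply: atoms_prod1.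
  have [|t ht tV] := IHs; first by move=> y ys; apply: h; rewrite inE ys orbT.
  have [t' ht' tx] := h x (mem_head _ _); exists (t * t'); first exact: atoms_prod_mul.
  move=> y; rewrite inE => /orP[/eqP ->|/tV h'].
    by rewrite -scalerA; apply: (stableZ sV).
  by rewrite mulrC -scalerA; apply: (stableZ sV).
exists t => // x /Us; elim: (s) x tV => [|g s' IHs] x tV /=.
  by move=> <-; rewrite scaler0; apply: stable0 sV.
move=> [c [y [hy ->]]]; rewrite scalerDr; apply: (stableD sV).
  by rewrite scalerA mulrC -scalerA; apply: (stableZ sV) => //; apply: tV; apply: mem_head.
by apply: IHs => // z zs; apply: tV; rewrite inE zs orbT.
Qed.

Lemma avoid_point (t : S) : Theta t ->
  exists c : k, atoms_prod (fun=> False) (fun x y => dt c 1 x y != 0) t.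
Proof.
move=> ht; suff [s hs] : exists s : seq k, forall c, c \notin s ->
    atoms_prod (fun=> False) (fun x y => dt c 1 x y != 0) t.
  (* At every a in s this polynomial takes the value 1, so its roots avoid s; the factor 'X keeps
     the degree positive when s is empty. *)
  have [c rc] : exists c, root ('X * \prod_(a <- s) ('X - a%:P) + 1) c.
    have sz : size ('X * \prod_(a <- s) ('X - a%:P)) = (size s).+2.
      by rewrite mulrC size_mulX ?monic_neq0 ?monic_prod_XsubC // size_prod_XsubC.
    by apply/closed_rootP; rewrite size_polyDl sz // size_poly1.
  exists c; apply: hs; apply/negP => cs.
  move: rc; rewrite /root hornerD hornerM hornerC.
  have -> : (\prod_(a <- s) ('X - a%:P)).[c] = 0 by apply/eqP; rewrite -/(root _ _) root_prod_XsubC.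
  by rewrite mulr0 add0r oner_eq0.
elim: ht => [c c0|i b []|x y b nz _ [s hs]]; first by exists [::] => d _; apply: atoms_scal.
(* The form c u + v is proportional to x u + y v only if c = x / y; for y = 0 it never is. *)
exists (x / y :: s) => c; rewrite inE negb_or => /andP[ne /hs h].
apply: atoms_lin => //; rewrite /dt mul1r subr_eq0.
apply: contra ne => /eqP e; have [y0|y0] := eqVneq y 0.
  by move: nz; rewrite /nz2 -e y0 mulr0 eqxx.
by rewrite -e mulfK.
Qed.

Section Span.
Variables (s : seq M) (ga de : k).
Local Notation W0 := (rspan (idfun : S -> S) (eq 0) s).
Local Notation f := (lin ga de).

(** Modulo the form to be factored out, every linear form is a scalar multiple of f, so the
    coefficients from k[u, v] reduce to k[f]. *)
Lemma span_factor al be : dt ga de al be != 0 ->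
  subset W0 (rspan (ev1 f) (dilate (lin al be) W0) (smalls s)).
Proof.
move=> nz; have sW := stable_idspan s; have sD := stable_dilate (lin al be) sW.
have sR := stable_rspan (smalls s) (stable_sub (O' := coefs (ev1 f)) (fun _ _ => Logic.I) sD).
apply: (span_small sR) => [c|b e g gs he].
  by exists c%:P; rewrite /= map_polyC /horner_eval hornerC.
have Wg : W0 (small e *: g) by apply: (stableZ sW) => //; apply: rspan_mem.
have Rg : rspan (ev1 f) (dilate (lin al be) W0) (smalls s) (small e *: g).
  by apply: rspan_mem; [apply: stable0 sD|apply: smalls_mem].
rewrite -scalerA; move: (small e *: g) Wg Rg => y.
have Qlin x z y' : W0 y' -> rspan (ev1 f) (dilate (lin al be) W0) (smalls s) y' ->
    rspan (ev1 f) (dilate (lin al be) W0) (smalls s) (lin x z *: y').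
  move=> wy ry; have [c [d ->]] := lin_span X x z nz.
  rewrite scalerDl; apply: (stableD sR).
    by apply: (stableZ sR) => //; exists (c *: 'X); rewrite -mul_polyC rmorphM ev1_X /= map_polyC /horner_eval hornerC.
  apply: rspan_base; rewrite mulrC -scalerA; exists (scal d *: y') => //.
  exact: (stableZ sW).
elim/big_ind: _ y => [y _|a b' ha hb y wy ry|i _ y wy ry]; first by rewrite scale1r.
  by rewrite -scalerA; apply: ha; [apply: (stableZ sW)|apply: hb].
elim: (b i) => [|n IHn]; first by rewrite scale1r.
by rewrite exprS -scalerA; apply: Qlin => //; apply: (stableZ sW).
Qed.

(** One linear factor of t at a time: W_0 / b W_0 is followed by b W_0 / b l W_0, which is spanned
    by b times the generators of W_0 / l W_0. *)
Lemma span_Theta (t : S) : atoms_prod (fun=> False) (fun x y => dt ga de x y != 0) t ->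
  exists T, subset W0 (rspan (ev1 f) (dilate t W0) T).
Proof.
have sW := stable_idspan s.
elim=> [c c0|i b []|x y b nz _ [T hT]].
  exists [::] => z wz; exists (scal c^-1 *: z); first exact: (stableZ sW).
  by rewrite scalerA -rmorphM mulfV // rmorph1 scale1r.
exists (T ++ [seq b *: g | g <- smalls s]); rewrite rspan_cat => z /hT.
apply: rspan_mono => _ [w ww ->].
have := rspan_dilate b (span_factor nz ww); apply: rspan_mono => _ [_ [w' ww' ->] ->].
by exists w' => //; rewrite scalerA mulrC.
Qed.

End Span.

(* W_0 / t W_0 is finitely generated over k[f] for a linear form f prime to t, so
   every proper step of the chain lowers the rank over k[f]. *)
Lemma dcc_bounded (W : nat -> M -> Prop) (t : S) : (forall n, gsub (W n)) ->
  (forall n, saturated (W n)) -> (forall n, subset (W n.+1) (W n)) ->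
  Theta t -> (forall j x, W 0%N x -> W j (t *: x)) -> exists n, subset (W n) (W n.+1).
Proof.
move=> gW satW decW ht tW; have [c hc] := avoid_point ht.
have [s [hs Ws]] := fin_gen_sub fgM (gsub_stable full (gW 0%N)).
have W0E x : rspan (idfun : S -> S) (eq 0) s x -> W 0%N x.
  have sW0 := gsub_stable full (gW 0%N).
  elim: (s) x hs => [|g s' IHs] x hs' /=; first by move=> <-; apply: stable0 sW0.
  move=> [a [y [hy ->]]]; apply: (stableD sW0).
    by apply: (stableZ sW0) => //; apply: hs'; apply: mem_head.
  by apply: IHs => // z zs; apply: hs'; rewrite inE zs orbT.
have [T hT] := span_Theta s hc.
have sD := stable_dilate t (stable_idspan s).
have sDk : stable (coefs (ev1 (lin c 1))) (dilate t (rspan (idfun : S -> S) (eq 0) s)) by apply: stable_full.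
have [||||j _ hj] := @rank_chain S M _ (ev1 (lin c 1)) _ sDk T W.
- by move=> i; apply: gsub_stable.
- by [].
- by move=> i _ [y /W0E wy ->]; apply: tW.
- by move=> x /Ws/hT.
exists j; apply: gsub_homog => // [|l x hx wx]; first exact: gsub_stable.
have [d d0 vx] := hj x wx; have [n fx] := ev1_torsion (gW _) hx d0 vx.
(* The form u is independent of f = c u + v. Some power u^K lies in the ideal (t, f^n), which sends
   x into W_(j+1); so x is in W_(j+1) by saturation. *)
have nz : dt c 1 1 0 != 0 by rewrite /dt mulr0 mulr1 sub0r oppr_eq0 oner_neq0.
have aw : @away k X c 1 t by apply: atoms_prod_sub hc.
have [K [a [b e]]] := away_power_n 1 0 n aw.
have s1 := gsub_stable full (gW j.+1).
apply: satW; apply: (near_lin s1 nz fx (m := K)).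
rewrite e scalerDl -!scalerA; apply: (stableD s1); apply: (stableZ s1) => //.
apply: tW; elim: (j) wx => [//|j' IH] /decW; exact: IH.
Qed.

End TorsionChains.

(** * Vanishing of Hom(Y, M / Y) and the torsion of M / Y *)

Section LocalHoms.
Variables (k : closedFieldType) (X : weighted_line k).
Local Notation I := 'I_(npts X).
Local Notation L := (Lgrp X).
Local Notation S := (Salg X).
Local Notation cdeg := (cdeg X).
Local Notation lin := (lin X).
Local Notation scal := (scal X).
Local Notation full := (fun _ : S => True).
Local Notation Theta := (@Theta k X).
Local Notation atoms := (atoms_prod (fun=> True) (@nz2 k)).
Local Notation excep := (excep X).
Variable M : gmod X.
Hypothesis fgM : fin_gen M.
Variable Y : M -> Prop.
Hypothesis gY : gsub Y.
Hypothesis satY : saturated Y.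
Hypothesis nontorsion : exists y, Y y /\ ~ ttors (@gsub0 k X M) y.

Let sY : stable full Y := gsub_stable _ gY.

(* Y / Y' is torsion-free of rank one. *)
Lemma critical_submodule : exists Y' : M -> Prop, [/\ gsub Y', subset Y' Y,
  exists l y, [/\ gproj l y = y, Y y & ~ Y' y],
  forall x, Y x -> ttors Y' x -> Y' x
  & forall l c, gproj l c = c -> Y c -> ~ Y' c -> subset Y (ttors (sgen Y' c))].
Proof.
(* Take W maximal with Y / W not torsion. The torsion closure of W in Y has the same property, hence
   equals W; any larger W + S c loses it, whence rank one. *)
pose P W := [/\ gsub W, subset W Y & exists y, Y y /\ ~ ttors W y].
have [Y' [gY' sub' [y0 [Yy0 ny0]]] maxY'] : exists2 W, P W & forall W', P W' -> subset W W' -> subset W' W.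
  apply: (acc_maximal (fin_gen_acc fgM)); first by move=> W [gW _ _]; split=> //; apply: gsub_stable.
  exists (@gsub0 k X M); split=> //; first exact: gsub_zero.
  exact: subset0.
have sY' := gsub_stable full gY'.
exists Y'; split=> //.
- apply: contrapT => h; apply: ny0; apply: ttors_sub.
  apply: (gsub_homog gY sY') Yy0 => l x hx yx; apply: contrapT => nx.
  by apply: h; exists l, x.
- move=> x yx tx; apply: (maxY' (gand (ttors Y') Y)); last by split.
    split; first by apply: gsub_and => //; apply: gsub_ttors.
      by move=> z [].
    exists y0; split=> // h; apply: ny0; apply: ttors_ttors.
    by apply: ttors_mono h => z [].
  by move=> z yz; split; [apply: ttors_sub|apply: sub'].
- move=> l c hc yc nc y yy; apply: contrapT => ny; apply: nc.
  have gS := gsub_sgen gY' hc.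
  apply: (maxY' (sgen Y' c)).
  + split=> //; last by exists y.
    move=> z [a /sub' yz]; rewrite -(subrK (a *: c) z).
    by apply: (stableD sY) => //; apply: (stableZ sY).
  + by move=> z yz; exists 0; rewrite scale0r subr0.
  + by exists 1; rewrite scale1r subrr; apply: stable0 sY'.
Qed.

Section Point.
Variables (al be ga de : k).
Hypothesis dt_nz : dt al be ga de != 0.
Variables (s : S) (p : nat) (sigma : L).
Hypothesis unif : uniformizer al be s p sigma.
Local Notation ell := (lin al be).
Local Notation f := (lin ga de).
Local Notation away := (@away k X al be).

(** An element not vanishing at the point and a power of [ell] have no common zero, so together they
    detect membership in a saturated submodule. *)
Lemma away_near (e : S) n (x : M) : away e -> Y (e *: x) -> Y (ell ^+ n *: x) -> Y x.
Proof.
move=> he ye yl; have [K [a [b h]]] := away_power_n ga de n he.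
have nz : dt ga de al be != 0 by rewrite dtC oppr_eq0.
apply: satY; apply: (near_lin sY nz (n := K) (m := n)) => //.
by rewrite h scalerDl -!scalerA; apply: (stableD sY); apply: (stableZ sY).
Qed.

Variable Y' : M -> Prop.
Hypothesis gY' : gsub Y'.
Hypothesis subY' : subset Y' Y.
Hypothesis nonempty : exists l y, [/\ gproj l y = y, Y y & ~ Y' y].
Hypothesis torsion_free : forall x, Y x -> ttors Y' x -> Y' x.
Hypothesis rank_one : forall l c, gproj l c = c -> Y c -> ~ Y' c -> subset Y (ttors (sgen Y' c)).

Let sY' : stable full Y' := gsub_stable _ gY'.

Lemma atoms_free (a : S) x : atoms a -> Y x -> Y' (a *: x) -> Y' x.
Proof.
move=> /atoms_dvd_Theta[b tb] yx h; apply: torsion_free => //; exists (b * a) => //.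
by rewrite -scalerA; apply: (stableZ sY').
Qed.

(** Rank one gives a relation t c' = b c modulo Y'. Write t and b as powers of s times local units
    and cancel the smaller power by torsion-freeness: one of c, c' is locally a multiple of the
    other. *)
Lemma away_total l c l' c' : gproj l c = c -> gproj l' c' = c' -> Y c -> Y c' -> ~ Y' c -> ~ Y' c' ->
  exists2 e, away e & sgen Y' c (e *: c') \/ sgen Y' c' (e *: c).
Proof.
move=> hc hc' yc yc' nc nc'; have [t ht [b h]] := rank_one hc yc nc yc'.
have [n hn] := Theta_homog ht; have [B [hB BE]] := S_comp b.
have := gsub_p gY' (cdeg *+ n + l') h.
rewrite gprojB (gproj_actE _ _ hn) hc' (BE _ _ _ hc); set b' := B _ => h'.
have ta : atoms t by apply: atoms_prod_sub ht.
have [b0|hb'] := Shomog_atoms (hB (cdeg *+ n + l' - l)).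
  case: nc'; apply: (atoms_free ta) => //; move: h'.
  by rewrite /b' b0 scale0r subr0.
have [i [e [he te]]] := unif_factor dt_nz unif ta.
have [j [e' [he' be']]] := unif_factor dt_nz unif hb'.
rewrite -/b' in be'; rewrite te be' in h'.
have sa m : atoms (s ^+ m) by apply: atoms_prod_exp; apply: (unif_atoms unif).
have [le_ij|/ltnW le_ji] := leqP i j.
  exists e => //; left; exists (s ^+ (j - i) * e').
  apply: (atoms_free (sa i)); first by apply: (stableB sY); apply: (stableZ sY).
  by rewrite scalerBr !scalerA !mulrA -exprD subnKC.
exists e' => //; right; exists (s ^+ (i - j) * e).
apply: (atoms_free (sa j)); first by apply: (stableB sY); apply: (stableZ sY).
rewrite scalerBr !scalerA !mulrA -exprD subnKC // -opprB.
by apply: (stableN sY').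
Qed.

(* At the point, Y / Y' is a torsion-free module of rank one over a graded
   discrete valuation ring, hence generated by one homogeneous element. *)
Lemma local_generator : exists l c, [/\ gproj l c = c, Y c, ~ Y' c
  & forall y, Y y -> exists2 e, away e & sgen Y' c (e *: y)].
Proof.
(* The part of Y generated by c at the point. A maximal V c is all of Y, since any homogeneous x
   outside Y' is comparable with c. *)
pose V c : M -> Prop := fun y => Y y /\ exists2 e, away e & sgen Y' c (e *: y).
have sS l c : gproj l c = c -> stable full (sgen Y' c).
  by move=> hc; apply: gsub_stable; apply: gsub_sgen hc.
have sV l c : gproj l c = c -> stable full (V c).
  move=> /sS sc; split.
  - split; first exact: stable0 sY.
    by exists 1; [apply: atoms_prod1|rewrite scaler0; apply: stable0 sc].
  - move=> x y [yx [e he hx]] [yy [e' he' hy]]; split; first exact: (stableB sY).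
    exists (e * e'); first exact: atoms_prod_mul.
    rewrite scalerBr {1}[e * e']mulrC -!scalerA.
    by apply: (stableB sc); apply: (stableZ sc).
  - move=> o x _ [yx [e he hx]]; split; first exact: (stableZ sY).
    by exists e => //; rewrite scalerA mulrC -scalerA; apply: (stableZ sc).
pose P W := exists l c, [/\ gproj l c = c, Y c, ~ Y' c & W = V c].
have [W [l [c [hc yc nc ->]]] maxW] : exists2 W, P W & forall W', P W' -> subset W W' -> subset W' W.
  apply: (acc_maximal (fin_gen_acc fgM)).
    by move=> W [l [c [hc _ _ ->]]]; split=> //; apply: sV hc.
  by have [l [c [hc yc nc]]] := nonempty; exists (V c), l, c.
exists l, c; split=> // y yy.
suff /(_ y yy)[] : subset Y (V c) by [].
apply: gsub_homog => // [|l' x hx yx]; first exact: sV hc.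
have [y'x|ny'x] := pselect (Y' x).
  split=> //; exists 1; first exact: atoms_prod1.
  by exists 0; rewrite scale1r scale0r subr0.
have [e he [h|h]] := away_total hc hx yc yx nc ny'x; first by split=> //; exists e.
apply: (maxW (V x)); first by exists l', x.
- move=> z [yz [e1 he1 [a h1]]]; split=> //; exists (e * e1); first exact: atoms_prod_mul.
  have sx := sS _ _ hx; rewrite -scalerA.
  rewrite -(subrK (a *: c) (e1 *: z)) scalerDr; apply: (stableD sx).
    by exists 0; rewrite scale0r subr0; apply: (stableZ sY').
  by rewrite scalerA mulrC -scalerA; apply: (stableZ sx).
- split=> //; exists 1; first exact: atoms_prod1.
  by exists 1; rewrite subrr; apply: stable0 sY'.
Qed.

(** Each homogeneous component of b sends c into Y', and a nonzero component is injective on Y / Y';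
    so b acts as zero on homogeneous elements of every degree. *)
Lemma homog_annihilator l c (b : S) : gproj l c = c -> Y c -> ~ Y' c -> Y' (b *: c) ->
  forall l' (q : M), gproj l' q = q -> b *: q = 0.
Proof.
move=> hc yc nc h l' q hq; have [B [hB BE]] := S_comp b.
have B0 d : B d = 0.
  have [//|ha] := Shomog_atoms (hB d).
  case: nc; apply: (atoms_free ha) => //.
  by have := gsub_p gY' (d + l) h; rewrite (BE _ _ _ hc) addrK.
have [t _ ->] := gproj_sum (b *: q); rewrite big1 // => m _.
by rewrite (BE _ _ _ hq) B0 scale0r.
Qed.

Hypothesis hom_zero : forall G : M -> M -> Prop, grel G -> subset Y (near (rdom G)) ->
  (forall z, G 0 z -> Y z) -> forall y z, Y y -> G y z -> Y z.

(* The relation G below is a homomorphism Y -> M / Y that factors through Y / Y' and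
   sends the local generator c to f^-N q; it vanishes only if q lies in Y. *)
Lemma hom_vanish l c l' q n N : gproj l c = c -> Y c -> ~ Y' c ->
  (forall y, Y y -> exists2 e, away e & sgen Y' c (e *: y)) ->
  gproj l' q = q -> l' = cdeg *+ N + l -> Y (ell ^+ n *: q) -> Y q.
Proof.
move=> hc yc nc gen hq el' yq.
(* If e y = b c modulo Y', then y goes to z = b q / (e f^N) modulo Y. The factor f^N adjusts the
   degree of q to that of c, and the last clause keeps z supported at the point, where e and f act
   invertibly. *)
pose G y z := exists e b, [/\ away e, Y' (e *: y - b *: c), Y (e * f ^+ N *: z - b *: q)
  & Y (ell ^+ n *: z)].
have af : away f by apply: away_lin dt_nz.
have hG : grel G; first split.
- exists 1, 0; rewrite !scaler0 !scale0r subrr; split; [exact: atoms_prod1|exact: stable0 sY'| |];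
    exact: stable0 sY.
- move=> a y z y' z' [e [b [he h1 h2 h3]]] [e' [b' [he' h1' h2' h3']]].
  exists (e * e'), (a * e' * b + e * b'); split; first exact: atoms_prod_mul.
  + have -> : (e * e') *: (a *: y + y') - (a * e' * b + e * b') *: c =
      (a * e') *: (e *: y - b *: c) + e *: (e' *: y' - b' *: c).
      rewrite !scalerBr !scalerDr scalerDl !scalerA opprD addrACA.
      by congr (_ - _ + _); congr (_ *: _); ring.
    by apply: (stableD sY'); apply: (stableZ sY').
  + have -> : (e * e' * f ^+ N) *: (a *: z + z') - (a * e' * b + e * b') *: q =
      (a * e') *: ((e * f ^+ N) *: z - b *: q) + e *: ((e' * f ^+ N) *: z' - b' *: q).
      rewrite !scalerBr !scalerDr scalerDl !scalerA opprD addrACA.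
      by congr (_ - _ + (_ - _)); congr (_ *: _); ring.
    by apply: (stableD sY); apply: (stableZ sY).
  + rewrite scalerDr scalerA mulrC -scalerA.
    by apply: (stableD sY) => //; apply: (stableZ sY).
- move=> m y z [e [b [he h1 h2 h3]]].
  have [d hd] := atoms_prod_homog he; have [B [hB BE]] := S_comp b.
  exists e, (B (d + m - l)); split=> //.
  + have := gsub_p gY' (d + m) h1.
    by rewrite gprojB (gproj_actE _ _ hd) (BE _ _ _ hc).
  + have hf : Shomog (d + cdeg *+ N) (e * f ^+ N).
      by apply: Shomog_mul => //; apply: Shomog_exp; apply: Shomog_lin.
    have := gsub_p gY (d + cdeg *+ N + m) h2.
    rewrite gprojB (gproj_actE _ _ hf) (BE _ _ _ hq); congr (Y (_ - B _ *: _)).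
    by rewrite el' opprD addrA [d + _ + m]addrAC addrK.
  + have hl : Shomog (cdeg *+ n) (ell ^+ n) by apply: Shomog_exp; apply: Shomog_lin.
    by rewrite -(gproj_actE _ _ hl); apply: gsub_p.
apply: (@hom_zero G hG _ _ (f ^+ N *: c)).
(* Two independent forms bring y into the domain: [ell]^n y goes to 0, and f^(K+N) y goes to a1 a q,
   because f^K acts on q as a1 e modulo Y. *)
- move=> y /gen[e he [a ha]]; have [K [a1 [b1 h]]] := away_power_n ga de n he.
  have nz : dt ga de al be != 0 by rewrite dtC oppr_eq0.
  apply: (near_lin (gsub_stable full (gsub_rdom hG)) nz (n := (K + N)%N) (m := n)).
    exists (a1 * a *: q); exists e, (f ^+ (K + N) * a); split=> //.
    + rewrite scalerA mulrC -!scalerA -scalerBr; exact: (stableZ sY').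
    + rewrite !scalerA exprD h.
      have -> : (e * f ^+ N * (a1 * a)) *: q - ((a1 * e + b1 * ell ^+ n) * f ^+ N * a) *: q
          = - (b1 * f ^+ N * a) *: (ell ^+ n *: q).
        by rewrite -scalerBl scalerA; congr (_ *: _); ring.
      exact: (stableZ sY).
    + by rewrite scalerA mulrC -scalerA; apply: (stableZ sY).
  exists 0; exists e, (ell ^+ n * a); split=> //.
  + rewrite scalerA mulrC -!scalerA -scalerBr; exact: (stableZ sY').
  + rewrite scaler0 sub0r mulrC -scalerA; apply: (stableN sY); exact: (stableZ sY).
  + by rewrite scaler0; apply: stable0 sY.
- move=> z [e [b [he h1 h2 h3]]].
  have bq : b *: q = 0.
    apply: (homog_annihilator hc yc nc _ hq).
    by move: h1; rewrite scaler0 sub0r => /(stableN sY'); rewrite opprK.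
  apply: (away_near (e := e * f ^+ N) _ _ h3).
    by apply: atoms_prod_mul => //; apply: atoms_prod_exp.
  by move: h2; rewrite bq subr0.
- exact: (stableZ sY).
(* The element f^N c is related to q itself. *)
- exists 1, (f ^+ N); rewrite scale1r mul1r !subrr.
  by split=> //; [apply: atoms_prod1|apply: stable0 sY'|apply: stable0 sY].
Qed.

Lemma local_bound l n x : gproj l x = x -> Y (ell ^+ n *: x) -> Y (s ^+ p.-1 *: x).
Proof.
move=> hx yx; have [lc [c [hc yc nc gen]]] := local_generator.
have [j [a [z [lt_j ha [d hd e]]]]] := unif_degree unif (lc - l).
have af : away f by apply: away_lin dt_nz.
(* The multiple of c may be negative: its positive part is absorbed by multiplying x with f^N1, and
   its negative part becomes the exponent N in [hom_vanish]. *)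
have [N1 [N2 zE]] : exists N1 N2 : nat, z = N1%:Z - N2%:Z.
  by case: z {e} => m; [exists m, 0%N; rewrite subr0|exists 0%N, m.+1; rewrite sub0r NegzE].
pose q := f ^+ N1 *: (a *: (s ^+ j *: x)).
have hq : gproj (cdeg *+ N1 + (d + (sigma *+ j + l))) q = q.
  have hs := Shomog_exp j (unif_homog unif).
  have hf : Shomog (cdeg *+ N1) (f ^+ N1) by apply: Shomog_exp; apply: Shomog_lin.
  by rewrite /q (gproj_actE _ _ hf) (gproj_actE _ _ hd) (gproj_actE _ _ hs) hx.
have lE : cdeg *+ N1 + (d + (sigma *+ j + l)) = cdeg *+ N2 + lc.
  have -> : lc = sigma *+ j + d + (cdeg *+ N1 - cdeg *+ N2) + l.
    by rewrite -(subrK l lc) e zE mulrzBr -!pmulrn.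
  rewrite [_ + (_ - _)]addrA [_ - _ + l]addrAC [RHS]addrC subrK !addrA.
  by congr (_ + _); rewrite addrC [cdeg *+ N1 + d]addrC addrA.
have yq : Y (ell ^+ n *: q).
  have -> : ell ^+ n *: q = (f ^+ N1 * a * s ^+ j) *: (ell ^+ n *: x).
    by rewrite /q !scalerA; congr (_ *: _); ring.
  exact: (stableZ sY).
have Yq := hom_vanish hc yc nc gen hq lE yq.
have yj : Y (s ^+ j *: x).
  apply: (away_near (e := f ^+ N1 * a) (n := n)).
  - by apply: atoms_prod_mul => //; apply: atoms_prod_exp.
  - by rewrite -scalerA.
  - by rewrite scalerA mulrC -scalerA; apply: (stableZ sY).
have -> : p.-1 = (p.-1 - j + j)%N by rewrite subnK // -ltnS prednK // (unif_gt0 unif).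
by rewrite exprD -scalerA; apply: (stableZ sY).
Qed.

End Point.

Hypothesis hom_zero : forall G : M -> M -> Prop, grel G -> subset Y (near (rdom G)) ->
  (forall z, G 0 z -> Y z) -> forall y z, Y y -> G y z -> Y z.

(** Strip linear factors from t until the rest b no longer sends x into Y; the last stripped factor
    shows that b x is torsion supported at one point. *)
Lemma linear_factor l (t : S) x : Theta t -> gproj l x = x -> Y (t *: x) -> ~ Y x ->
  exists al be b m, [/\ nz2 al be, Shomog m b, ~ Y (b *: x) & Y (lin al be *: (b *: x))].
Proof.
move=> ht hx; elim: ht => [c c0|i b []|al be b nz hb IH] yt nx.
  case: nx; rewrite -[x]scale1r -(rmorph1 scal) -(mulVf c0) rmorphM -scalerA.
  exact: (stableZ sY).
have [yb|nb] := pselect (Y (b *: x)); first exact: IH.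
have [m hm] := atoms_prod_homog hb; exists al, be, b, m; split=> //.
by rewrite scalerA.
Qed.

(* For a torsion element x of M / Y supported at a point with uniformizer s of
   ramification index p, the degree of s^j x can be matched with that of a local
   generator of Y for some j < p, so that s^(p-1) x = 0 by [hom_vanish]. *)
Lemma excep_kills x : ttors Y x -> Y (excep *: x).
Proof.
have sE : stable full (fun x => Y (excep *: x)).
  split; first by rewrite scaler0; apply: stable0 sY.
    by move=> y z; rewrite scalerBr; apply: (stableB sY).
  by move=> o y _; rewrite scalerA mulrC -scalerA; apply: (stableZ sY).
move: x; apply: (gsub_homog (gsub_ttors gY) sE) => l x hx [t ht yt].
apply: contrapT => nx; have [n hE] := Theta_homog (Theta_excep X).
have hex : gproj (cdeg *+ n + l) (excep *: x) = excep *: x by rewrite (gproj_actE _ _ hE) hx.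
have [|al [be [b [m [nz hm nb yl]]]]] := linear_factor ht hex _ nx.
  by rewrite scalerA mulrC -scalerA; apply: (stableZ sY).
have [ga [de dt_nz]] : exists ga de, dt al be ga de != 0.
  have [a0|a0] := eqVneq al 0; last by exists 0, 1; rewrite /dt mulr1 mulr0 subr0.
  exists 1, 0; move: nz; rewrite /nz2 /dt a0 eqxx mul0r mulr1 sub0r oppr_eq0 //.
have [s [p [sigma unif]]] := uniformizer_ex X dt_nz.
have [Y' [gY' subY' ne tf r1]] := critical_submodule.
have bound l' n' z : gproj l' z = z -> Y (lin al be ^+ n' *: z) -> Y (s ^+ p.-1 *: z).
  exact: (local_bound dt_nz unif gY' ne tf r1 hom_zero).
have p0 := unif_gt0 unif.
have hbx : gproj (m + l) (b *: x) = b *: x by rewrite (gproj_actE _ _ hm) hx.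
have [[i0 hi]|/forallNP ord] := pselect (exists i : I, dt al be (xu i) (xv i) = 0); last first.
  (* At an ordinary point p = 1, so [bound] puts the element itself into Y. *)
  apply: nb; rewrite (unif_ordinary unif ord) /= in bound.
  rewrite -[b *: _]scale1r; apply: (bound (m + (cdeg *+ n + l)) 1%N); last by rewrite expr1.
  by rewrite (gproj_actE _ _ hm) hex.
pose rest := \prod_(i | i != i0) lin (xu i) (xv i).
have exE : excep = lin (xu i0) (xv i0) * rest by rewrite /excep (bigD1 i0).
have nzi : nz2 (xu i0) (xv i0) by rewrite /nz2 /xu /xv; case: (pt i0) => [z|]; rewrite oner_neq0 ?orbT.
have [c c0 lE] := prop_lin_ell X dt_nz nzi hi.
have [c' c0' ellE] := unif_ell unif.
have [mr hr] : exists d, Shomog d rest.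
  have tr : Theta rest.
    apply: big_ind => [|*|i _]; [exact: atoms_prod1|exact: atoms_prod_mul|].
    by apply: atoms_prod_lin; rewrite /nz2 /xu /xv; case: (pt i) => [z|]; rewrite oner_neq0 ?orbT.
  by have [d hd] := Theta_homog tr; exists (cdeg *+ d).
have hrx : gproj (mr + (m + l)) (rest *: (b *: x)) = rest *: (b *: x).
  by rewrite (gproj_actE _ _ hr) hbx.
(* At an exceptional point [excep] contains the factor [ell] once, so [ell]^2 kills rest b x modulo
   Y. By [bound] already s^(p-1) does, and [excep] is divisible by s^(p-1) rest. *)
have /(bound _ 2%N _ hrx) h : Y (lin al be ^+ 2 *: (rest *: (b *: x))).
  have -> : lin al be ^+ 2 *: (rest *: (b *: x)) = scal c^-1 *: (lin al be *: (b *: (excep *: x))).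
    rewrite !scalerA exE lE; congr (_ *: _).
    transitivity ((scal c^-1 * scal c) * (lin al be ^+ 2 * rest * b)); last by ring.
    by rewrite -rmorphM mulVf // rmorph1 mul1r.
  exact: (stableZ sY).
apply: nb; rewrite scalerA mulrC exE lE ellE -(prednK p0) exprSr.
have -> : scal c * (scal c' * (s ^+ p.-1 * s)) * rest * b = (scal c * scal c' * s) * (s ^+ p.-1 * rest * b) by ring.
by rewrite -scalerA; apply: (stableZ sY) => //; rewrite -!scalerA.
Qed.

End LocalHoms.

Lemma module_dcc_holds (k : closedFieldType) (X : weighted_line k) : module_dcc X.
Proof.
move=> M W gW satW decW hom0; have fgM := fgmod_fg M.
have [N hN] := rank_stabilizes fgM gW decW.
have [t ht tW] : exists2 t, Theta t & forall j x, W N x -> W (j + N)%N (t *: x).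
  (* If some late W_j is torsion, then W_N is torsion and one form kills it; otherwise [excep]
     serves for all j at once. *)
  have [[j0 le_j0 tj0]|h] := pselect (exists2 j, (N <= j)%N & subset (W j) (ttors (@gsub0 k X M))).
    have UV : subset (W N) (ttors (@gsub0 k X M)).
      move=> x /(hN _ le_j0) tx; apply: ttors_ttors; exact: (ttors_mono tj0 tx).
    have [t ht h] := ttors_uniform fgM (gW N) (gsub_zero M) UV.
    by exists t => // j x /h ->; apply: gsub_0.
  exists (excep X); first exact: Theta_excep.
  move=> j x wx; have tx := hN (j + N)%N (leq_addl _ _) x wx.
  apply: (excep_kills fgM (gW (j + N)%N) (satW (j + N)%N) _ (hom0 (j + N)%N)) => //.
  apply: contrapT => hn; apply: h; exists (j + N)%N; first exact: leq_addl.
  by move=> y wy; apply: contrapT => ny; apply: hn; exists y.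
have [n hn] := @dcc_bounded k X M fgM (fun j => W (j + N)%N) t (fun n => gW (n + N)%N)
  (fun n => satW (n + N)%N) (fun n => decW (n + N)%N) ht tW.
by exists (n + N)%N.
Qed.

Theorem proposition8p1 (k : closedFieldType) (X : weighted_line k)
  (hX : domestic X \/ tubular X) (S : stability_data (coh X)) :
  exists T : stability_data (coh X), finest T /\ finer T S.
Proof.
apply: finest_refinement.
- exact: coh_has_images.
- exact: coh_sub_acc.
- by apply: coh_torsion_dcc; apply: module_dcc_holds.
Qed.
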